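(* Let $N\in\{2,3\}$, let $\Omega$ be the unit ball of $\mathbb{R}^N$, and let $0<\varepsilon<\frac12$, $0<\delta<1$ and $0<\mathbf{n}<1$ (a constant refractive index). Then the density $\rho_{\varepsilon,\delta}$ of surface-localized transmission eigenmodes (defined in the context) satisfies $$\rho_{\varepsilon,\delta}>0 .$$ Furthermore, $$\rho_{\varepsilon,\delta}\ \ge\ \frac{2P^{(2)}(\mathbf{n})}{\pi(1-\mathbf{n}^2)}\quad\text{if } N=2,\qquad\qquad \rho_{\varepsilon,\delta}\ \ge\ \frac{P^{(3)}(\mathbf{n})}{1-\mathbf{n}^3}\quad\text{if } N=3,$$ where $P^{(2)}(x)=\arccos(x)-x\sqrt{1-x^2}$ and $P^{(3)}(x)=(1-x^2)^{3/2}$ for $x\in[-1,1]$. In particular these lower bounds depend only on $\mathbf{n}$ and not on $\varepsilon,\delta$.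
   Context: Transmission eigenvalue problem: for $k>0$ one seeks nontrivial pairs $(u,v)$, $u,v\in H^1(\Omega)$, with $$\Delta u+k^2\mathbf{n}^2u=0 \text{ in }\Omega,\qquad \Delta v+k^2v=0\text{ in }\Omega,\qquad u=v,\ \ \partial_\nu u=\partial_\nu v \text{ on }\partial\Omega,$$ where $\nu$ is the exterior unit normal. If such a nontrivial pair exists, $k$ is called an (interior, real) transmission eigenvalue (ITE) and $(u,v)$ a corresponding pair of transmission eigenfunctions. Surface localization: let $\mathcal{N}_\delta(\partial\Omega)=\{x\in\Omega:\operatorname{dist}(x,\partial\Omega)<\delta\}$ and, for $0\ne\psi\in L^2(\Omega)$, $\mathcal{E}_\delta(\psi)=\|\psi\|_{L^2(\mathcal{N}_\delta(\partial\Omega))}/\|\psi\|_{L^2(\Omega)}$. The function $\psi$ is surface-localized (with parameters $\varepsilon,\delta$) if $\mathcal{E}_\delta(\psi)>1-\varepsilon$. Modes: eigenfunction pairs are taken in separated form and identified up to multiplication by a nonzero constant. For $N=2$, with $J_m$ the Bessel function of order $m$, the ITEs are the positive roots $k$, over $m\in\{0,1,2,\dots\}$, of $F_m(x)=\mathbf{n}J_m(x)J_m'(\mathbf{n}x)-J_m(\mathbf{n}x)J_m'(x)$, with eigenfunction pairs $u=C_1J_m(k\mathbf{n}r)e^{\pm \mathrm{i}m\theta}$, $v=C_2J_m(kr)e^{\pm \mathrm{i}m\theta}$ (one mode if $m=0$, two modes if $m\ge1$), where $(C_1,C_2)\neq(0,0)$ is determined up to scaling by the boundary conditions. For $N=3$,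 with $j_m$ the spherical Bessel function of order $m$, the ITEs are the positive roots $k$, over $m\in\{0,1,2,\dots\}$, of $F^{(3)}_m(x)=\mathbf{n}j_m(x)j_m'(\mathbf{n}x)-j_m(\mathbf{n}x)j_m'(x)$, with $u=C_1j_m(k\mathbf{n}r)Y_m^l(\hat x)$, $v=C_2j_m(kr)Y_m^l(\hat x)$, $-m\le l\le m$ ($2m+1$ modes), where $Y_m^l$ are the spherical harmonics. Modes with different $m$ (or different angular factor) are counted as different even if they share the same $k$. Counting functions (counting with geometric multiplicity, i.e. counting modes $(u,v,k)$ as just described): $N(R)$ is the number of modes $(u,v,k)$ with $0<k<R$; $N^c(R,\varepsilon,\delta)$ is the number of modes $(u,v,k)$ with $0<k<R$ such that $\mathcal{E}_\delta(u)>1-\varepsilon$ or $\mathcal{E}_\delta(v)>1-\varepsilon$. The density is $$\rho_{\varepsilon,\delta}=\liminf_{R\to\infty}\frac{N^c(R,\varepsilon,\delta)}{N(R)} .$$ *)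

(* Defs.v *)
From HB Require Import structures.
From mathcomp Require Import all_boot all_order all_algebra.
From mathcomp Require Import all_classical all_reals all_analysis.
From mathcomp.real_closed Require Import complex.

Set Implicit Arguments.
Unset Strict Implicit.
Unset Printing Implicit Defensive.
Import Order.TTheory GRing.Theory Num.Theory.
Import numFieldNormedType.Exports.

Local Open Scope classical_set_scope.
Local Open Scope complex_scope.
Local Open Scope ring_scope.

Definition besselJ (R : realType) (m : nat) (x : R) : R :=
  limn (series (fun j : nat =>
    (-1) ^+ j / (j`! * (j + m)`!)%:R * (x / 2) ^+ (2 * j + m))).

(* j_m(x) = sqrt(pi/(2x)) J_{m+1/2}(x)
          = sum_j (-1)^j / (2^j j! (2m+2j+1)!!) x^(2j+m);
   the product below is the double factorial 1 * 3 * ... * (2(m+j)+1). *)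
Definition sphBesselJ (R : realType) (m : nat) (x : R) : R :=
  limn (series (fun j : nat =>
    (-1) ^+ j / (2 ^ j * j`! * \prod_(i < (m + j).+1) (2 * i + 1))%:R
      * x ^+ (2 * j + m))).

Definition characteristicF (R : realType) (f : R -> R) (n x : R) : R :=
  n * f x * derive1 f (n * x) - f (n * x) * derive1 f x.

(* [V] stands for R^2 or R^3, realized as iterated products. The norm that the
   library puts on a product is the max norm, so the Euclidean norm [en] is a
   separate parameter; the topology does not depend on this choice. *)
Section UnitBall.
Context {R : realType} {V : normedModType R}.
Variable en : V -> R.

Definition eball : set V := [set x | en x < 1].

Definition boundary (A : set V) : set V := closure A `\` A^°.

Definition eucl_dist (x : V) (A : set V) : R := inf [set en (x - y) | y in A].

Definition boundary_layer (delta : R) : set V :=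
  [set x | eball x /\ eucl_dist x (boundary eball) < delta].

(* Since nu(x) = x on the unit sphere, the derivative at x in direction nu(x) is
   'D_x; it is taken on real and imaginary parts. *)
Definition normal_derivative (w : V -> R[i]) (x : V) : R[i] :=
  'D_x (fun y => complex.Re (w y)) x +i* 'D_x (fun y => complex.Im (w y)) x.

Definition separated_wave (f : R -> R) (Y : V -> R[i]) (kappa : R) (C : R[i])
    : V -> R[i] :=
  fun x => C * (f (kappa * en x))%:C * Y x.

Definition eigenpair (f : R -> R) (Y : V -> R[i]) (n k : R) (u v : V -> R[i]) :=
  exists C1 C2 : R[i],
    [/\ (C1, C2) != (0, 0),
        u = separated_wave f Y (k * n) C1,
        v = separated_wave f Y k C2 &
        forall x, boundary eball x ->
          u x = v x /\ normal_derivative u x = normal_derivative v x].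

End UnitBall.

Section SurfaceLocalization.
Context {d : measure_display} {T : measurableType d} {R : realType}.
Variable mu : {measure set T -> \bar R}.

Definition L2norm (A : set T) (psi : T -> R[i]) : R :=
  Num.sqrt (\int[mu]_(x in A) Normc.normc (psi x) ^+ 2).

Definition localization (Omega layer : set T) (psi : T -> R[i]) : R :=
  L2norm layer psi / L2norm Omega psi.

End SurfaceLocalization.

Definition liminf_ratio (R : realType) (T : choiceType) (k : T -> R)
    (modes localized : set T) : \bar R :=
  limf_einf (fun r : R => (counting [set p | localized p /\ (k p < r)%R]
                          / counting [set p | modes p /\ (k p < r)%R])%E) (pinfty_nbhs R).

Section Dimension2.
Context {R : realType}.

Definition enorm2 (x : R * R) : R := Num.sqrt (x.1 ^+ 2 + x.2 ^+ 2).

(* e^(i l theta) for x = (r cos theta, r sin theta) *)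
Definition expi_theta (l : int) (x : R * R) : R[i] :=
  ((x.1 +i* x.2) / (enorm2 x)%:C) ^ l.

Definition lebesgue2 := (@lebesgue_measure R \x @lebesgue_measure R)%E.

(* The mode with wave number k and angular factor e^(i l theta) is encoded as
   (k, l); its Bessel order is m = |l|, so that each m >= 1 occurs twice. *)
Definition modes2 (n : R) : set (R * int) :=
  [set p | 0 < p.1 /\ characteristicF (besselJ `|p.2|%N) n p.1 = 0].

Definition localization2 (delta : R) (psi : R * R -> R[i]) : R :=
  localization lebesgue2 (eball enorm2) (boundary_layer enorm2 delta) psi.

Definition localized_modes2 (eps delta n : R) : set (R * int) :=
  [set p | modes2 n p /\ exists u v : R * R -> R[i],
    eigenpair enorm2 (besselJ `|p.2|%N) (expi_theta p.2) n p.1 u v /\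
    (localization2 delta u > 1 - eps \/ localization2 delta v > 1 - eps)].

Definition density2 (eps delta n : R) : \bar R :=
  liminf_ratio fst (modes2 n) (localized_modes2 eps delta n).

Definition P2 (x : R) : R := acos x - x * Num.sqrt (1 - x ^+ 2).

End Dimension2.

Section Dimension3.
Context {R : realType}.

Definition enorm3 (x : R * R * R) : R :=
  Num.sqrt (x.1.1 ^+ 2 + x.1.2 ^+ 2 + x.2 ^+ 2).

Definition lebesgue3 := (lebesgue2 \x @lebesgue_measure R)%E.

Definition legendre (m : nat) : {poly R} :=
  (2 ^ m * m`!)%:R^-1 *: (('X^2 - 1) ^+ m)^`(m).

Definition assoc_legendre (m q : nat) (t : R) : R :=
  Num.sqrt (1 - t ^+ 2) ^+ q * ((legendre m)^`(q)).[t].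

(* Y_m^l at x / |x|, normalized in L^2 of the sphere; the sign factor (-1)^l
   that some conventions include is left out. *)
Definition sph_harmonic (m : nat) (l : int) (x : R * R * R) : R[i] :=
  (Num.sqrt ((2 * m + 1)%:R / (4 * pi) * ((m - `|l|)`!)%:R / ((m + `|l|)`!)%:R)
   * assoc_legendre m `|l|%N (x.2 / enorm3 x))%:C * expi_theta l x.1.

(* The mode with wave number k and angular factor Y_m^l is encoded as (k, m, l). *)
Definition modes3 (n : R) : set (R * nat * int) :=
  [set p | [/\ 0 < p.1.1, (`|p.2| <= p.1.2)%N &
               characteristicF (sphBesselJ p.1.2) n p.1.1 = 0]].

Definition localization3 (delta : R) (psi : R * R * R -> R[i]) : R :=
  localization lebesgue3 (eball enorm3) (boundary_layer enorm3 delta) psi.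

Definition localized_modes3 (eps delta n : R) : set (R * nat * int) :=
  [set p | modes3 n p /\ exists u v : R * R * R -> R[i],
    eigenpair enorm3 (sphBesselJ p.1.2) (sph_harmonic p.1.2 p.2) n p.1.1 u v /\
    (localization3 delta u > 1 - eps \/ localization3 delta v > 1 - eps)].

Definition density3 (eps delta n : R) : \bar R :=
  liminf_ratio (fun p : R * nat * int => p.1.1)
    (modes3 n) (localized_modes3 eps delta n).

Definition P3 (x : R) : R := (1 - x ^+ 2) `^ (3 / 2).

End Dimension3.

(* Main.v *)
(* A separated mode of order m has wave number k exactly when the cross product of
   (A, B) at k and at n k vanishes, where A = x^(-nu) J_nu and B = x^(1 - nu) J_nu'
   (nu = m in the plane, nu = m + 1/2 in space). Writing (A, B) = Q (sin theta,
   cos theta) turns this condition into theta(k) - theta(n k) = pi j with j >= 1,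
   and each of these levels is crossed exactly once, upwards. Comparing theta with
   the WKB phase, up to O(1 + ln x) uniformly in the order, and summing over the
   orders gives the leading term of the number of modes with k < r.
   If n k <= nu, a dilation by a fixed tau < 1 divides the squared radial factor of u
   by at least a constant times nu, so that u concentrates in the boundary layer as
   soon as nu is large. Hence all but finitely many orders contribute every mode
   with n k <= nu to the localized count, and these modes are counted by the same
   sums, with min(r, nu / n) in place of r. *)
Require Import Defs.
From mathcomp Require Import all_boot all_order all_algebra.
From mathcomp Require Import all_classical all_reals all_analysis.
From mathcomp Require Import measurable_realfun.
From mathcomp Require Import zify ring lra.
From mathcomp.real_closed Require Import complex.
Import Order.TTheory GRing.Theory Num.Theory.
Import numFieldNormedType.Exports.

Set Implicit Arguments.
Unset Strict Implicit.
Unset Printing Implicit Defensive.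

Local Open Scope classical_set_scope.
Local Open Scope ring_scope.

(** * Bessel functions and their phase *)

Section EntireSeries.
Context {R : realType}.
Implicit Types (c : R ^nat) (x : R).

(** Asymptotics at fixed order do not suffice: about r orders contribute below r, and the turning
    point x = nu moves with the order. The phase turns the Bessel equation into the first-order
    Pruefer equation x theta' = cos^2 theta + (x^2 - nu^2) sin^2 theta, whose comparison with sqrt
    (x^2 - nu^2) / x costs only O(1 + ln x); summed over the orders with weight nu^(N - 2) this is
    O(r^(N - 1) ln r), below the main term r^N. Two signs are not visible in that equation. For x <
    nu its right-hand side has no evident sign, and the growth of theta comes from an integrated
    identity. The derivative of theta(k) - theta(n k) is controlled only near the levels, so
    uniqueness of the roots rests on a crossing argument rather than on monotonicity. When n k <= nu
    the phase at n k stays in (0, pi / 2), so the localized count involves essentially the phase at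
    k alone; this is where the numerators of the bounds come from. Powers x^nu are divided out from
    the start, which leaves entire functions of x^2 and treats integral and half-integral nu
    alike. *)

Lemma cvg_pseries_fact c x : (forall j, `|c j| <= j`!%:R^-1) -> cvgn (pseries c x).
Proof.
move=> hc; apply: normed_cvg.
apply: (@series_le_cvg _ _ (exp_coeff `|x|)) => [j|j|j|].
- by rewrite normr_ge0.
- by rewrite /exp_coeff /= divr_ge0// exprn_ge0.
- by rewrite /exp_coeff /= normrM normrX mulrC ler_wpM2l ?exprn_ge0.
- exact: is_cvg_series_exp_coeff.
Qed.

(** The bound by [1/j!] survives termwise differentiation, so every derivative of such a series is
    again entire and no radius of convergence has to be tracked. *)
Lemma pseries_diffs_fact c : (forall j, `|c j| <= j`!%:R^-1) ->
  forall j, `|pseries_diffs c j| <= j`!%:R^-1.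
Proof.
move=> hc j; rewrite /pseries_diffs normrM ger0_norm//.
have := hc j.+1; rewrite factS natrM invfM => h.
by rewrite -ler_pdivlMl ?ltr0Sn.
Qed.

Lemma is_derive_pseries c x : (forall j, `|c j| <= j`!%:R^-1) ->
  is_derive x 1 (fun y => limn (pseries c y)) (limn (pseries (pseries_diffs c) x)).
Proof.
move=> hc; have hd := pseries_diffs_fact hc; have hdd := pseries_diffs_fact hd.
apply: (@pseries_snd_diffs _ c (`|x| + 1)); try exact: cvg_pseries_fact.
by rewrite [ltRHS]ger0_norm ?ltrDl ?addr_ge0.
Qed.

End EntireSeries.

Section Bessel.
Context {R : realType}.
Variable q : nat.
Implicit Types x : R.

(* With nu = q/2, [bessE] is the entire function such that x^nu [bessE (x^2)]
   is a multiple of J_nu. *)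
Definition bess_coeff (j : nat) : R :=
  (-1) ^+ j / (\prod_(i < j) (2 * i.+1 * (2 * i.+1 + q)))%:R.

Definition bessE x := limn (pseries bess_coeff x).
Definition bessE' x := limn (pseries (pseries_diffs bess_coeff) x).
Definition bessE'' x := limn (pseries (pseries_diffs (pseries_diffs bess_coeff)) x).

Lemma bess_coeff_fact j : `|bess_coeff j| <= j`!%:R^-1.
Proof.
rewrite /bess_coeff normrM normrX normrN1 expr1n mul1r ger0_norm ?invr_ge0//.
rewrite lef_pV2 ?posrE ?ltr0n ?fact_gt0// ?ler_nat; last first.
  by apply: prodn_gt0 => i; rewrite !muln_gt0 /= addn_gt0.
elim: j => [|j IH]; first by rewrite big_ord0.
by rewrite big_ord_recr /= factS mulnC leq_mul// -[leqLHS]muln1 leq_mul//; lia.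
Qed.

Lemma bess_coeffS j :
  (2 * j.+1 * (2 * j.+1 + q))%:R * bess_coeff j.+1 = - bess_coeff j.
Proof.
rewrite /bess_coeff big_ord_recr /=.
set b := (2 * _ * _)%N; set a := (\prod_(i < j) _)%N.
rewrite (natrM _ a) invfM exprS mulN1r.
have b0 : b%:R != 0 :> R by rewrite pnatr_eq0 /b; lia.
by rewrite mulrCA [X in _ * X]mulrCA divff// mulr1 mulNr.
Qed.

Lemma is_derive_bessE x : is_derive x 1 bessE (bessE' x).
Proof. exact/is_derive_pseries/bess_coeff_fact. Qed.

Lemma is_derive_bessE' x : is_derive x 1 bessE' (bessE'' x).
Proof. exact/is_derive_pseries/pseries_diffs_fact/bess_coeff_fact. Qed.

Lemma bessE0 : bessE 0 = 1.
Proof.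
apply: lim_near_cst => //; near=> m.
rewrite -[m]prednK; last by near: m.
rewrite /pseries /series /= big_nat_recl// big1 ?addr0.
  by rewrite /bess_coeff big_ord0 expr0 divr1 mulr1.
by move=> i _; rewrite exprS mul0r mulr0.
Unshelve. all: by end_near. Qed.

(** The Bessel equation for x^nu E(x^2), read in the variable x^2. On partial sums the left-hand
    side is exactly 0 once the last two series are taken one term further, because the factor x
    raises the powers in the first. *)
Lemma bessE_ode x : 4 * x * bessE'' x + (4 + 2 * q%:R) * bessE' x + bessE x = 0.
Proof.
have h0 := bess_coeff_fact; have h1 := pseries_diffs_fact h0.
have h2 := pseries_diffs_fact h1.
have sh (c : R ^nat) (l : R) : c n @[n --> \oo] --> l -> c n.+1 @[n --> \oo] --> l.
  by move=> hc; rewrite (cvg_shiftS c).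
have hc : (fun n => 4 * x * pseries (pseries_diffs (pseries_diffs bess_coeff)) x n +
    (4 + 2 * q%:R) * pseries (pseries_diffs bess_coeff) x n.+1 +
    pseries bess_coeff x n.+1) @ \oo -->
    4 * x * bessE'' x + (4 + 2 * q%:R) * bessE' x + bessE x.
  apply: cvgD; last exact/sh/cvg_pseries_fact.
  apply: cvgD; apply: cvgM; try exact: cvg_cst; last exact/sh/cvg_pseries_fact.
  exact: cvg_pseries_fact.
rewrite -[LHS](cvg_lim _ hc)//.
apply/cvg_lim => //; apply: cvg_near_cst; apply: nearW => n.
rewrite /= /pseries /series /= {hc sh h0 h1 h2}.
elim: n => [|n IH].
  rewrite !big_nat1 big_nil /pseries_diffs !expr0.
  have := bess_coeffS 0; rewrite !natrM !natrD !natrM /=; lra.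
rewrite big_nat_recr// (big_nat_recr n.+1)// [X in _ + _ + X = _](big_nat_recr n.+1)//=.
have -> : forall a b c d e f : R, 4 * x * (a + b) + (4 + 2 * q%:R) * (c + d) + (e + f) =
   (4 * x * a + (4 + 2 * q%:R) * c + e) + (4 * x * b + (4 + 2 * q%:R) * d + f).
  by move=> *; ring.
rewrite IH add0r /pseries_diffs.
have := bess_coeffS n.+1; set u := bess_coeff n.+2 => h.
have -> : bess_coeff n.+1 = - ((2 * n.+2 * (2 * n.+2 + q))%:R * u) by rewrite h opprK.
rewrite !natrM !natrD !natrM -(natr1 n.+1) -(natr1 n) [x ^+ n.+1]exprS.
ring.
Qed.

End Bessel.

(** * Differentiation rules and the mean value theorem *)

Section Calculus.
Context {R : realType}.
Implicit Types (f g : R -> R) (x a b c d : R).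

Lemma der_cst c x : is_derive x 1 (fun=> c) (0 : R).
Proof. exact: is_derive_cst. Qed.

Lemma der_id x : is_derive x 1 (fun y => y) (1 : R).
Proof. exact: is_derive_id. Qed.

Lemma derD f g x a b : is_derive x 1 f a -> is_derive x 1 g b ->
  is_derive x 1 (fun y => f y + g y) (a + b).
Proof. by move=> ? ?; exact: is_deriveD. Qed.

Lemma derN f x a : is_derive x 1 f a -> is_derive x 1 (fun y => - f y) (- a).
Proof. by move=> ?; exact: is_deriveN. Qed.

Lemma derM f g x a b : is_derive x 1 f a -> is_derive x 1 g b ->
  is_derive x 1 (fun y => f y * g y) (a * g x + f x * b).
Proof.
move=> ? ?; apply: (is_derive_eq (is_deriveM _ _)).
by rewrite /GRing.scale /= addrC (mulrC a).
Qed.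

Lemma derX f n x a : is_derive x 1 f a ->
  is_derive x 1 (fun y => f y ^+ n) (n%:R * f x ^+ n.-1 * a).
Proof.
move=> h; have -> : (fun y => f y ^+ n) = f ^+ n.
  by apply/funext => y; rewrite exprfctE.
exact: (is_derive_eq (is_deriveX n h)).
Qed.

Lemma derV f x a : f x != 0 -> is_derive x 1 f a ->
  is_derive x 1 (fun y => (f y)^-1) (- a / f x ^+ 2).
Proof.
move=> f0 h; apply: (is_derive_eq (is_deriveV f0 h)).
by rewrite /GRing.scale /= mulrC mulrN mulNr.
Qed.

Lemma derC f g x a b : is_derive (g x) 1 f a -> is_derive x 1 g b ->
  is_derive x 1 (fun y => f (g y)) (a * b).
Proof. by move=> ? ?; exact: is_derive1_comp. Qed.

Lemma der_continuous f x a : is_derive x 1 f a -> {for x, continuous f}.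
Proof. by move=> h; apply/differentiable_continuous/derivable1_diffP. Qed.

Lemma MVT_closed f (df : R -> R) a b : a < b ->
  (forall x, a <= x <= b -> is_derive x 1 f (df x)) ->
  exists2 c, a < c < b & f b - f a = df c * (b - a).
Proof.
move=> ab h.
have [||c cab ->] := @MVT _ f df a b ab _ _.
- by move=> x; rewrite in_itv /= => /andP[/ltW ? /ltW ?]; apply: h; apply/andP.
- apply: derivable_within_continuous => x; rewrite in_itv /= => hx.
  by case: (h _ hx).
by exists c.
Qed.

Lemma der_nondecr f (df : R -> R) a b : a <= b ->
  (forall x, a <= x <= b -> is_derive x 1 f (df x)) ->
  (forall x, a < x < b -> 0 <= df x) -> f a <= f b.
Proof.
rewrite le_eqVlt => /predU1P[->//|ab] h h0.
have [c cab e] := MVT_closed ab h.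
by rewrite -subr_ge0 e mulr_ge0 ?h0// subr_ge0 ltW.
Qed.

Lemma der_incr f (df : R -> R) a b : a < b ->
  (forall x, a <= x <= b -> is_derive x 1 f (df x)) ->
  (forall x, a < x < b -> 0 < df x) -> f a < f b.
Proof.
move=> ab h h0.
have [c cab e] := MVT_closed ab h.
by rewrite -subr_gt0 e mulr_gt0 ?h0// subr_gt0.
Qed.

(** The integral starts at [-1] so that 0, where the phase starts, is an interior point with a
    two-sided derivative. *)
Lemma antiderivative f : continuous f ->
  {F : R -> R | forall x, - 1 < x -> is_derive x 1 F (f x)}.
Proof.
move=> cf.
exists (fun x : R => \int[lebesgue_measure]_(t in `[- 1, x]) f t)%R => x x1.
have xu : x < x + 1 by rewrite ltrDl.
have hi : lebesgue_measure.-integrable `[- 1, x + 1] (EFin \o f).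
  apply: continuous_compact_integrable; first exact: segment_compact.
  exact: continuous_subspaceT.
have [dF F'] := @continuous_FTC1_closed _ f (- 1) x (x + 1) xu hi x1 (cf x).
by split => //; rewrite -derive1E.
Qed.

End Calculus.

Ltac der_step := lazymatch goal with
 | |- is_derive _ _ (fun=> ?c) _ => exact: der_cst
 | |- is_derive _ _ (fun y => y) _ => exact: der_id
 | |- is_derive _ _ (fun y => @?f y + @?g y) _ => eapply (@derD _ f g)
 | |- is_derive _ _ (fun y => - @?f y) _ => eapply (@derN _ f)
 | |- is_derive _ _ (fun y => @?f y * @?g y) _ => eapply (@derM _ f g)
 | |- is_derive _ _ (fun y => @?f y ^+ ?n) _ => eapply (@derX _ f n)
 | |- is_derive _ _ (fun y => (@?f y)^-1) _ => eapply (@derV _ f)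
 | |- is_derive _ _ (fun y => sin (@?f y)) _ =>
     eapply (@derC _ sin f); lazymatch goal with
      | |- is_derive _ _ sin _ => exact: is_derive_sin | |- _ => idtac end
 | |- is_derive _ _ (fun y => cos (@?f y)) _ =>
     eapply (@derC _ cos f); lazymatch goal with
      | |- is_derive _ _ cos _ => exact: is_derive_cos | |- _ => idtac end
 | |- is_derive _ _ _ _ => eassumption
 end.
Ltac der := eapply is_derive_eq; [repeat der_step|].

Section BesselSystem.
Context {R : realType}.
Variable q : nat.
Implicit Types x : R.

Let nu : R := q%:R / 2.

(* x^nu [bessA x] and x^nu [bessB x] are J_nu(x) and x J_nu'(x), up to a common
   constant factor. *)
Definition bessA x : R := bessE q (x ^+ 2).
Definition bessD x : R := bessE' q (x ^+ 2).
Definition bessB x : R := nu * bessA x + 2 * x ^+ 2 * bessD x.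

Lemma der_bessA x : is_derive x 1 bessA (2 * x * bessD x).
Proof.
rewrite /bessA.
apply: (is_derive_eq (derC (g := fun y => y ^+ 2) (is_derive_bessE q (x ^+ 2)) (derX 2 (der_id x)))).
by rewrite /bessD /=; ring.
Qed.

Lemma der_bessB x : is_derive x 1 bessB (- x * (bessA x + 2 * nu * bessD x)).
Proof.
have hA := der_bessA x.
have hD : is_derive x 1 bessD (2 * x * bessE'' q (x ^+ 2)).
  rewrite /bessD.
  apply: (is_derive_eq (derC (g := fun y => y ^+ 2) (is_derive_bessE' q (x ^+ 2)) (derX 2 (der_id x)))).
  by rewrite /=; ring.
rewrite /bessB; der.
rewrite /=; have := bessE_ode q (x ^+ 2); rewrite -/(bessA x) -/(bessD x).
have -> : q%:R = 2 * nu by rewrite /nu; field.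
set e := bessE'' _ _ => h.
have {h} -> : bessA x = - (4 * x ^+ 2 * e + (4 + 2 * (2 * nu)) * bessD x).
  by apply/eqP; rewrite -addr_eq0 addrC h.
ring.
Qed.

(** Times [x ^+ q] this is (x J')^2 + (x^2 - nu^2) J^2 up to a constant factor, and it is the
    numerator of x times the derivative of the phase. *)
Definition bessW x : R := bessB x ^+ 2 + (x ^+ 2 - nu ^+ 2) * bessA x ^+ 2.

Let V x := x ^+ q * bessW x.

Let der_V x : is_derive x 1 V (2 * x ^+ q.+1 * bessA x ^+ 2).
Proof.
have hA := der_bessA x; have hB := der_bessB x.
rewrite /V /bessW; der; rewrite /= /bessB.
have hq : q%:R = 2 * nu by rewrite /nu; field.
have [q0|[p hp]] : q = 0%N \/ exists p, q = p.+1 by case: (q) => [|p]; [left|right; exists p].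
  have -> : nu = 0 by rewrite /nu q0 mul0r.
  by rewrite q0 /=; ring.
by rewrite hq hp (exprS x p.+1) (exprS x p) /=; ring.
Qed.

Lemma bessA0 : bessA 0 = 1.
Proof. by rewrite /bessA expr0n /= bessE0. Qed.

Lemma bessB0 : bessB 0 = nu.
Proof. by rewrite /bessB bessA0 expr0n /=; ring. Qed.

Lemma bessA_cts : continuous bessA.
Proof. by move=> x; exact: der_continuous (der_bessA x). Qed.

Lemma bessB_cts : continuous bessB.
Proof. by move=> x; exact: der_continuous (der_bessB x). Qed.

Lemma bessA_gt0_near0 : exists2 e, 0 < e & forall x, 0 <= x <= e -> 0 < bessA x.
Proof.
have : \forall x \near (0 : R), 0 < bessA x.
  have h : {for 0, continuous bessA} by exact: bessA_cts.
  by apply: (cvgr_gt _ h); rewrite bessA0.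
move=> /nbhs_ballP[e /= e0 he]; exists (e / 2); first by rewrite divr_gt0.
move=> x /andP[x0 xe]; apply: he; rewrite /ball /= sub0r normrN ger0_norm//.
by rewrite (le_lt_trans xe)// ltr_pdivrMr// ltr_pMr// ltr1n.
Qed.

(* The identity (x^(2 nu) W)' = 2 x^(2 nu + 1) A^2 makes the phase increase. *)
Lemma bessW_gt0 x : 0 < x -> 0 < bessW x.
Proof.
move=> x0; have [e e0 he] := bessA_gt0_near0.
suff : 0 < V x by rewrite /V pmulr_rgt0 ?exprn_gt0.
have V0 : V 0 = 0.
  by rewrite /V /bessW bessA0 bessB0; rewrite [X in _ * X](_ : _ = 0) ?mulr0//; ring.
pose y := Num.min e x.
have y0 : 0 < y by rewrite lt_min e0 x0.
apply: (@lt_le_trans _ _ (V y)).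
  rewrite -V0; apply: (der_incr y0 (fun z _ => der_V z)) => z /andP[z0 zy].
  have /he Az : 0 <= z <= e.
    rewrite ltW//= ltW// (lt_le_trans zy)// ge_min lexx//.
  by rewrite !mulr_gt0 ?exprn_gt0.
have yx : y <= x by rewrite ge_min lexx orbT.
apply: (der_nondecr yx (fun z _ => der_V z)).
move=> z /andP[yz _]; have z0 : 0 < z by exact: lt_trans yz.
by apply: mulr_ge0; [rewrite mulr_ge0 ?exprn_ge0 ?ltW|exact: sqr_ge0].
Qed.

Let rho2 x := bessA x ^+ 2 + bessB x ^+ 2.

(** A common zero of [bessA] and [bessB] at x > 0 would be a zero of [bessW]; both functions are
    even, which settles x < 0. *)
Lemma bess_rho2_gt0 x : 0 < bessA x ^+ 2 + bessB x ^+ 2.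
Proof.
have pos y : 0 < y -> 0 < bessA y ^+ 2 + bessB y ^+ 2.
  move=> y0; rewrite lt_neqAle addr_ge0 ?sqr_ge0// andbT eq_sym.
  apply/eqP => /eqP; rewrite paddr_eq0 ?sqr_ge0// !sqrf_eq0 => /andP[/eqP a /eqP b].
  by have := bessW_gt0 y0; rewrite /bessW a b !expr0n /= mulr0 addr0 ltxx.
have [x0|x0|<-] := ltgtP 0 x; first exact: pos.
  have := pos (- x); rewrite oppr_gt0 => /(_ x0).
  by rewrite /bessB /bessD /bessA !sqrrN.
by rewrite bessA0 expr1n ltr_wpDr ?sqr_ge0.
Qed.

(* The derivative of arg ([bessB] + i [bessA]), of which [phase] is a continuous
   determination. *)
Definition phase' x : R :=
  x * (bessA x ^+ 2 + 4 * nu * bessA x * bessD x + 4 * x ^+ 2 * bessD x ^+ 2)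
  / (bessA x ^+ 2 + bessB x ^+ 2).

Lemma phase'E x : x * phase' x = bessW x / (bessA x ^+ 2 + bessB x ^+ 2).
Proof.
rewrite /phase' mulrA; congr (_ / _); rewrite /bessW /bessB; ring.
Qed.

Lemma phase'_cts : continuous phase'.
Proof.
move=> x; have hA := der_bessA x; have hB := der_bessB x.
have hD : is_derive x 1 bessD (2 * x * bessE'' q (x ^+ 2)).
  rewrite /bessD.
  apply: (is_derive_eq (derC (g := fun y => y ^+ 2) (is_derive_bessE' q (x ^+ 2)) (derX 2 (der_id x)))).
  by rewrite /=; ring.
have [a h] : exists a, is_derive x 1 phase' a.
  rewrite /phase'; eexists; repeat der_step.
  by rewrite gt_eqF// bess_rho2_gt0.
exact: der_continuous h.
Qed.

(** At 0 the pair (A, B) is (1, nu), whose angle is [pi / 2 - atan nu]; this form includes nu =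
    0. *)
Definition phase x : R := projT1 (antiderivative phase'_cts) x
  - projT1 (antiderivative phase'_cts) 0 + (pi / 2 - atan nu).

Lemma der_phase x : 0 <= x -> is_derive x 1 phase (phase' x).
Proof.
move=> x0; have h := projT2 (antiderivative phase'_cts) x (lt_le_trans (ltrN10 _) x0).
by rewrite /phase; der; rewrite !addr0.
Qed.

Lemma phase'_gt0 x : 0 < x -> 0 < phase' x.
Proof.
move=> x0; rewrite -(pmulr_rgt0 _ x0) phase'E.
by rewrite divr_gt0 ?bessW_gt0 ?bess_rho2_gt0.
Qed.

Lemma phase_incr x y : 0 <= x -> x < y -> phase x < phase y.
Proof.
move=> x0 xy.
apply: (der_incr xy (fun z h => der_phase (le_trans x0 (andP h).1))) => z /andP[xz _].
exact/phase'_gt0/(le_lt_trans x0).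
Qed.

Lemma phase0 : phase 0 = pi / 2 - atan nu.
Proof. by rewrite /phase subrr add0r. Qed.

(** The component of (A, B) along (sin theta, cos theta): a polar radius with sign. *)
Definition bessQ x : R := bessA x * sin (phase x) + bessB x * cos (phase x).
Let P x := bessA x * cos (phase x) - bessB x * sin (phase x).

(** P^2 / (A^2 + B^2) is the squared sine of the angle between (A, B) and (sin theta, cos theta).
    Its derivative vanishes by the choice of [phase'], and it is 0 at 0 by the choice of the initial
    value. *)
Let P0 x : 0 <= x -> P x = 0.
Proof.
move=> x0.
have d (y : R) : 0 <= y -> is_derive y 1 (fun y => P y ^+ 2 / rho2 y) 0.
  move=> y0; have hA := der_bessA y; have hB := der_bessB y; have hp := der_phase y0.
  have r0 : rho2 y != 0 by rewrite gt_eqF// bess_rho2_gt0.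
  have hs := derC (g := phase) (is_derive_sin (phase y)) hp.
  have hc := derC (g := phase) (is_derive_cos (phase y)) hp.
  have hr : is_derive y 1 rho2 (2 * bessA y * (2 * y * bessD y) +
      2 * bessB y * (- y * (bessA y + 2 * nu * bessD y))).
    by rewrite /rho2; der; rewrite /=; ring.
  apply: (is_derive_eq (derM (derX 2 (derD (derM hA hc) (derN (derM hB hs))))
    (derV r0 hr))).
  have hB' : bessB y = nu * bessA y + 2 * y ^+ 2 * bessD y by [].
  move: r0; rewrite /phase' /= /rho2.
  move: (bessA y) (bessB y) (bessD y) (sin _) (cos _) hB' => a b e s c hb r0.
  have -> : y * (a ^+ 2 + 4 * nu * a * e + 4 * y ^+ 2 * e ^+ 2) =
     2 * y * e * b + a * (y * (a + 2 * nu * e)) by rewrite hb; ring.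
  by field.
have P00 : P 0 = 0.
  rewrite /P bessA0 bessB0 phase0 mul1r.
  rewrite sinB cosB sin_pihalf cos_pihalf !mul0r mul1r !subr0 add0r mul1r.
  by rewrite -{2}(atanK nu) /tan mulfVK ?subrr// gt_eqF// cos_gt0_pihalf// atan_gtNpi2 atan_ltpi2.
have [->//|xn0] := eqVneq x 0.
have {}x0 : 0 < x by rewrite lt_neqAle eq_sym xn0.
have [c _] := MVT_closed x0 (fun y h => d y (andP h).1).
rewrite P00 expr0n /= !mul0r subr0 => /eqP.
by rewrite mulf_eq0 invr_eq0 (gt_eqF (bess_rho2_gt0 x)) orbF sqrf_eq0 => /eqP.
Qed.

Lemma bessA_phase x : 0 <= x -> bessA x = bessQ x * sin (phase x).
Proof.
move=> x0; have := P0 x0; rewrite /P /bessQ => h.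
rewrite -[LHS]mulr1 -(cos2Dsin2 (phase x)).
transitivity (bessQ x * sin (phase x) + cos (phase x) * P x).
  by rewrite /bessQ /P; ring.
by rewrite /P h mulr0 addr0.
Qed.

Lemma bessB_phase x : 0 <= x -> bessB x = bessQ x * cos (phase x).
Proof.
move=> x0; have := P0 x0; rewrite /P /bessQ => h.
rewrite -[LHS]mulr1 -(cos2Dsin2 (phase x)).
transitivity (bessQ x * cos (phase x) - sin (phase x) * P x).
  by rewrite /bessQ /P; ring.
by rewrite /P h mulr0 subr0.
Qed.

Lemma bessQ_neq0 x : 0 <= x -> bessQ x != 0.
Proof.
move=> x0; apply/eqP => h; have := bess_rho2_gt0 x.
by rewrite bessA_phase// bessB_phase// h !mul0r expr0n addr0 ltxx.
Qed.

(** The Pruefer form of the Bessel equation: A and B have disappeared, and the comparisons of phases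
    below start from this equation. *)
Lemma phase'_sincos x : 0 <= x ->
  x * phase' x = cos (phase x) ^+ 2 + (x ^+ 2 - nu ^+ 2) * sin (phase x) ^+ 2.
Proof.
move=> x0; rewrite phase'E /bessW bessA_phase// bessB_phase//.
rewrite !exprMn -mulrDr [X in _ / (_ * X)]addrC cos2Dsin2 mulr1.
have := bessQ_neq0 x0; move: (bessQ x) => Q Q0; field.
exact: Q0.
Qed.

Lemma phase_cts x : 0 <= x -> {for x, continuous phase}.
Proof. by move=> x0; exact: der_continuous (der_phase x0). Qed.

Lemma phase0_bounds : 0 < phase 0 <= pi / 2.
Proof.
rewrite phase0 subr_gt0 atan_ltpi2 /= gerBl -atan0.
by apply: le_atan; rewrite divr_ge0.
Qed.

(** A zero of B in (0, nu] would leave W = (x^2 - nu^2) A^2 <= 0; so B keeps the sign of its initial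
    value nu. *)
Lemma bessB_pos x : 0 <= x <= nu -> 0 < nu -> 0 < bessB x.
Proof.
move=> /andP[x0 xnu] nu0.
have nz y : 0 <= y <= nu -> bessB y != 0.
  rewrite le_eqVlt => /andP[/predU1P[<-|y0] ynu]; first by rewrite bessB0 gt_eqF.
  have := bessW_gt0 y0; rewrite /bessW; apply: contraTneq => ->.
  rewrite expr0n add0r -leNgt mulr_le0_ge0 ?sqr_ge0//.
  by rewrite subr_le0 ler_sqr ?nnegrE// ltW.
rewrite ltNge; apply/negP => hx.
have cB : {within `[0, x], continuous bessB}.
  by apply: continuous_subspaceT; exact: bessB_cts.
have [|c] := IVT x0 cB (v := 0).
  by rewrite bessB0 ge_min hx orbT le_max ltW.
rewrite in_itv /= => /andP[c0 cx] /eqP; apply/negP/nz.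
by rewrite c0 (le_trans cx).
Qed.

(** To leave the first quadrant the phase would have to pass [pi / 2], where B = Q cos theta
    vanishes. *)
Lemma phase_lt_pihalf x : 0 <= x <= nu -> 0 < nu -> phase x < pi / 2.
Proof.
move=> xnu nu0; rewrite ltNge; apply/negP => hx.
have x0 : 0 <= x by case/andP: xnu.
have cp : {within `[0, x], continuous phase}.
  apply: derivable_within_continuous => y; rewrite in_itv /= => /andP[y0 _].
  by case: (der_phase y0).
have [|c] := IVT x0 cp (v := pi / 2).
  by rewrite ge_min (andP phase0_bounds).2 le_max hx orbT.
rewrite in_itv /= => /andP[c0 cx] hc.
have : 0 < bessB c by apply: bessB_pos => //; rewrite c0 (le_trans cx)// (andP xnu).2.
by rewrite bessB_phase// hc cos_pihalf mulr0 ltxx.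
Qed.

End BesselSystem.

(** * Zeros of the sine and a one-sided Gronwall inequality *)

Section RealLemmas.
Context {R : realType}.
Implicit Types (f : R -> R) (a b x y t : R).

Lemma sinD_natpi x j : sin (x + pi * j%:R) = (-1) ^+ j * sin x :> R.
Proof.
elim: j => [|j IH]; first by rewrite mulr0 addr0 mul1r.
by rewrite -natr1 mulrDr mulr1 addrA sinDpi IH exprS mulN1r mulNr.
Qed.

Lemma sin_eq0_natpi t : 0 < t -> sin t = 0 -> exists2 j, (0 < j)%N & t = pi * j%:R.
Proof.
move=> t0 st; pose j := Num.truncn (t / pi).
have /andP[j1 j2] : j%:R <= t / pi < j.+1%:R.
  by apply: truncn_itv; rewrite divr_ge0 ?ltW ?pi_gt0.
move: j1 j2; rewrite ler_pdivlMr ?pi_gt0// ltr_pdivrMr ?pi_gt0// => j1 j2.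
have tj : t = pi * j%:R.
  apply/eqP; rewrite -subr_eq0; apply/negP => /negP h.
  have : 0 < sin (t - pi * j%:R).
    apply: sin_gt0_pi; rewrite lt_neqAle eq_sym h subr_ge0 mulrC j1 /=.
    by move: j2; rewrite -natr1 mulrDl mul1r mulrC ltrBlDl.
  move: st; rewrite -[in sin t](subrK (pi * j%:R) t) sinD_natpi.
  by move/eqP; rewrite mulf_eq0 signr_eq0 /= => /eqP ->; rewrite ltxx.
exists j => //; rewrite lt0n; apply/eqP => j0.
by move: t0; rewrite tj j0 mulr0 ltxx.
Qed.

Lemma norm_sin_le x : `|sin x| <= `|x|.
Proof.
wlog x0 : x / 0 <= x => [hw|].
  have [/hw//|/ltW x0] := leP 0 x.
  by rewrite -normrN -sinN -[leRHS]normrN; apply: hw; rewrite oppr_ge0.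
rewrite (ger0_norm x0) ler_norml; apply/andP; split.
  have h (y : R) : is_derive y 1 (fun y : R => sin y + y) (cos y + 1) by der; ring.
  have := der_nondecr x0 (fun y _ => h y); rewrite sin0 addr0 -lerBlDr sub0r; apply.
  by move=> y _; rewrite -lerBlDr sub0r cos_geN1.
have h (y : R) : is_derive y 1 (fun y : R => y - sin y) (1 - cos y) by der; ring.
have := der_nondecr x0 (fun y _ => h y); rewrite sin0 subr0 subr_ge0; apply.
by move=> y _; rewrite subr_ge0 cos_le1.
Qed.

Lemma last_ge0 f a b : a <= b -> (forall x, a <= x <= b -> {for x, continuous f}) ->
  0 <= f a -> f b < 0 ->
  exists2 z, a <= z < b & 0 <= f z /\ forall x, z < x <= b -> f x < 0.
Proof.
move=> ab cf fa fb; pose S := [set x | a <= x <= b /\ 0 <= f x].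
have Sa : S a by rewrite /S /= lexx.
have hS : has_sup S by split; [exists a|exists b => x [/andP[]]].
have ub := ub_le_sup hS.2.
have az : a <= sup S by exact: ub.
have zb : sup S <= b by apply: ge_sup; [exists a|move=> x [/andP[]]].
have cz : {for sup S, continuous f} by apply: cf; rewrite az zb.
have fz : 0 <= f (sup S).
  rewrite leNgt; apply/negP => fz.
  have : \forall x \near sup S, f x < 0 by apply: (cvgr_lt _ cz).
  move=> /nbhs_ballP[e /= e0 he].
  have [x Sx zx] := sup_adherent e0 hS.
  have : f x < 0.
    apply: he; rewrite /ball /= ltr_distlC zx /=.
    have xz : x <= sup S by exact: ub.
    by rewrite (le_lt_trans xz)// ltrDl.
  by rewrite ltNge Sx.2.
exists (sup S); first by rewrite az lt_neqAle zb andbT; apply: contraTneq fz => ->; rewrite -ltNge.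
split=> // x /andP[zx xb]; rewrite ltNge; apply/negP => fx.
have : x <= sup S by apply: ub; split=> //; rewrite xb (le_trans az)// ltW.
by rewrite leNgt zx.
Qed.

(** The differential inequality is asked only where [f] is negative. If [f b < 0], then after the
    last point with [f] nonnegative the function f e^(-K x) is nondecreasing and starts at a
    nonnegative value, a contradiction. *)
Lemma gronwall_ge0 f (f' : R -> R) K a b : a <= b ->
  (forall x, a <= x <= b -> is_derive x 1 f (f' x)) ->
  0 <= f a -> (forall x, a < x < b -> f x < 0 -> K * f x <= f' x) -> 0 <= f b.
Proof.
move=> ab df fa hK; rewrite leNgt; apply/negP => fb.
have [z /andP[az zb] [fz fneg]] :=
  last_ge0 ab (fun x h => der_continuous (df x h)) fa fb.
have d x : z <= x <= b ->
    is_derive x 1 (fun y => f y * expR (- K * y)) ((f' x - K * f x) * expR (- K * x)).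
  move=> /andP[zx xb]; have dfx : is_derive x 1 f (f' x).
    by apply: df; rewrite xb (le_trans az).
  have de : is_derive x 1 (fun y => expR (- K * y)) (expR (- K * x) * - K).
    apply: (@derC _ expR (fun y => - K * y)); der; ring.
  by der; ring.
have := der_nondecr (ltW zb) d; rewrite leNgt => /(_ _)/negP; apply.
  move=> x /andP[zx xb]; rewrite mulr_ge0 ?expR_ge0// subr_ge0.
  by apply: hK; rewrite ?xb ?(le_lt_trans az)// fneg// zx ltW.
apply: (@lt_le_trans _ _ 0); last by rewrite mulr_ge0 ?expR_ge0.
by rewrite pmulr_llt0 ?expR_gt0.
Qed.

End RealLemmas.

(** * Levels of the phase difference *)

Section PhaseDifference.
Context {R : realType}.
Variables (q : nat) (n : R).
Hypothesis hn : 0 < n < 1.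
Implicit Types x y : R.

Let nu : R := q%:R / 2.
Let n0 : 0 < n. Proof. by case/andP: hn. Qed.
Let n1 : n < 1. Proof. by case/andP: hn. Qed.

Definition phase_diff x : R := phase q x - phase q (n * x).

Lemma phase_diff0 : phase_diff 0 = 0.
Proof. by rewrite /phase_diff mulr0 subrr. Qed.

Lemma phase_diff_gt0 x : 0 < x -> 0 < phase_diff x.
Proof.
move=> x0; rewrite subr_gt0; apply: phase_incr.
  by rewrite mulr_ge0// ltW.
by rewrite gtr_pMl.
Qed.

Lemma der_phase_diff x : 0 <= x ->
  is_derive x 1 phase_diff (phase' q x - n * phase' q (n * x)).
Proof.
move=> x0; have h1 := der_phase q x0.
have nx0 : 0 <= n * x by rewrite mulr_ge0// ltW.
have h2 := der_phase q nx0.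
have h3 : is_derive x 1 (fun y => phase q (n * y)) (phase' q (n * x) * n).
  by apply: (@derC _ (phase q) (fun y => n * y)) => //; der; ring.
by rewrite /phase_diff; der; ring.
Qed.

Lemma bess_cross x : 0 <= x ->
  bessA q x * bessB q (n * x) - bessA q (n * x) * bessB q x =
  bessQ q x * bessQ q (n * x) * sin (phase_diff x).
Proof.
move=> x0; have nx0 : 0 <= n * x by rewrite mulr_ge0// ltW.
by rewrite !bessA_phase// !bessB_phase// /phase_diff sinB; ring.
Qed.

Lemma bess_cross_eq0 x : 0 < x ->
  bessA q x * bessB q (n * x) = bessA q (n * x) * bessB q x <->
  exists2 j, (0 < j)%N & phase_diff x = pi * j%:R.
Proof.
move=> x0; have nx0 : 0 <= n * x by rewrite mulr_ge0// ltW.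
have e := bess_cross (ltW x0); split=> [h|[j j0 hj]].
  apply: sin_eq0_natpi; first exact: phase_diff_gt0.
  apply/eqP; move/eqP: e; rewrite h subrr eq_sym !mulf_eq0.
  by rewrite !(negbTE (bessQ_neq0 _ _))// ltW.
apply/eqP; rewrite -subr_eq0 e hj -[pi * _]add0r sinD_natpi sin0 !mulr0//.
Qed.

Lemma phase_diff_level_exists j x : (0 < j)%N -> 0 < x -> pi * j%:R < phase_diff x ->
  exists2 y, 0 < y < x & phase_diff y = pi * j%:R.
Proof.
move=> j0 x0 hx.
have pj : 0 < pi * j%:R :> R by rewrite mulr_gt0 ?pi_gt0 ?ltr0n.
have cp : {within `[0, x], continuous phase_diff}.
  apply: derivable_within_continuous => y; rewrite in_itv /= => /andP[y0 _].
  by case: (der_phase_diff y0).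
have [|c] := IVT (ltW x0) cp (v := pi * j%:R).
  by rewrite phase_diff0 ge_min ltW//= le_max (ltW hx) orbT.
rewrite in_itv /= => /andP[c0 cx] hc; exists c => //.
rewrite !lt_neqAle c0 cx !andbT; apply/andP; split.
  by apply: contraTneq pj => h; rewrite -hc -h phase_diff0 ltxx.
by apply: contraTneq hx => h; rewrite -h hc ltxx.
Qed.

(* Where [phase_diff x = pi j], sin^2 takes the same value at both phases and
   [x * phase_diff' = (1 - n^2) x^2 sin^2 >= 0]; Gronwall handles the points where
   this vanishes. *)
Lemma phase_diff_level_strict j x y : 0 < x -> x < y ->
  phase_diff x = pi * j%:R -> pi * j%:R < phase_diff y.
Proof.
move=> x0 xy hx.
pose f z := phase_diff z - pi * j%:R.
pose f' z := phase' q z - n * phase' q (n * z).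
(* On [[x, y]] the coefficient n^2 z^2 - nu^2 - 1 of the difference of squared sines is at most
   [y^2 + nu^2 + 1] in absolute value, that difference is at most |f z|, and 1 / z <= 1 / x. *)
pose K := (y ^+ 2 + nu ^+ 2 + 1) / x.
have K0 : 0 <= K by apply: divr_ge0; [rewrite !addr_ge0 ?sqr_ge0|exact: ltW].
have df z : x <= z -> is_derive z 1 f (f' z).
  move=> xz; have h := der_phase_diff (le_trans (ltW x0) xz).
  by rewrite /f; der; rewrite /f'; ring.
have f'E z : 0 <= z -> z * f' z = (1 - n ^+ 2) * z ^+ 2 * sin (phase q z) ^+ 2 +
    (n ^+ 2 * z ^+ 2 - nu ^+ 2 - 1) *
    (sin (phase q z) ^+ 2 - sin (phase q (n * z)) ^+ 2).
  move=> z0; have nz0 : 0 <= n * z by rewrite mulr_ge0// ltW.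
  transitivity (z * phase' q z - (n * z) * phase' q (n * z)).
    by rewrite /f'; ring.
  by rewrite !phase'_sincos// !cos2sin2 -/nu; ring.
have sinle z : `|sin (phase q z) ^+ 2 - sin (phase q (n * z)) ^+ 2| <= `|f z|.
  set a := phase q z; set b := phase q (n * z).
  have -> : sin a ^+ 2 - sin b ^+ 2 = sin (a - b) * sin (a + b).
    rewrite sinB sinD.
    transitivity (sin a ^+ 2 * (cos b ^+ 2 + sin b ^+ 2) -
      sin b ^+ 2 * (cos a ^+ 2 + sin a ^+ 2)); first by rewrite !cos2Dsin2; ring.
    ring.
  have -> : a - b = f z + pi * j%:R by rewrite /f subrK.
  rewrite sinD_natpi !normrM normrX normrN1 expr1n mul1r.
  by rewrite -[leRHS]mulr1 ler_pM// ?sin_max// norm_sin_le.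
have lb z : x <= z <= y ->
    (1 - n ^+ 2) * z ^+ 2 * sin (phase q z) ^+ 2 / z - K * `|f z| <= f' z.
  move=> /andP[xz zy]; have z0 : 0 < z by exact: lt_le_trans xz.
  rewrite -(ler_pM2l z0) (f'E z (ltW z0)) mulrBr (mulrC z (_ / z)) divfK ?gt_eqF//.
  rewrite lerD2l lerNl.
  apply: (le_trans (ler_norm _)); rewrite normrN normrM (mulrA z).
  apply: ler_pM => //.
  apply: (@le_trans _ _ (y ^+ 2 + nu ^+ 2 + 1)).
    have h1 : 0 <= n ^+ 2 * z ^+ 2 by rewrite mulr_ge0 ?sqr_ge0.
    have h2 : n ^+ 2 * z ^+ 2 <= y ^+ 2.
      rewrite -exprMn ler_sqr ?nnegrE ?mulr_ge0 ?(ltW n0) ?(ltW z0)//.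
        by rewrite (le_trans _ zy)// ler_piMl// ltW.
      by rewrite (le_trans (ltW z0)).
    have h3 := sqr_ge0 nu; rewrite ler_norml; apply/andP; split; lra.
  by rewrite /K mulrC -mulrA ler_peMr ?addr_ge0 ?sqr_ge0// mulrC ler_pdivlMr ?mul1r.
have pos0 z : 0 < z -> 0 <= (1 - n ^+ 2) * z ^+ 2 * sin (phase q z) ^+ 2 / z.
  move=> z0; apply: divr_ge0; last exact: ltW.
  apply: mulr_ge0; last exact: sqr_ge0.
  by apply: mulr_ge0; [rewrite subr_ge0 expr_le1// ltW|exact: sqr_ge0].
have fx : f x = 0 by rewrite /f hx subrr.
have fge0 z : x <= z <= y -> 0 <= f z.
  move=> /andP[xz zy]; apply: (gronwall_ge0 (K := K) xz (fun t h => df t (andP h).1)).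
    by rewrite fx.
  move=> t /andP[xt tz] ft; have t0 : 0 < t by exact: lt_trans xt.
  apply: le_trans (lb t _); last by rewrite ltW//= ltW// (lt_le_trans tz).
  by rewrite ltr0_norm// mulrN opprK lerDr pos0.
have fy0 : 0 <= f y by apply: fge0; rewrite lexx ltW.
rewrite -subr_gt0 lt_neqAle fy0 andbT; apply/eqP => /esym fy.
(* Assume [f y = 0]. Then [g] is nondecreasing and 0 at both ends, hence 0 on [[x, y]]. As its
   derivative dominates a positive multiple of the squared sine of the phase, that sine vanishes
   somewhere in every subinterval. *)
pose g z := f z * expR (K * z).
have dg z : x <= z -> is_derive z 1 g ((f' z + K * f z) * expR (K * z)).
  move=> xz; have dfz := df z xz.
  have de : is_derive z 1 (fun y => expR (K * y)) (expR (K * z) * K).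
    by apply: (@derC _ expR (fun y => K * y)); der; ring.
  by rewrite /g; der; ring.
have g' z : x < z < y ->
    (1 - n ^+ 2) * z ^+ 2 * sin (phase q z) ^+ 2 / z * expR (K * z) <=
    (f' z + K * f z) * expR (K * z).
  move=> /andP[xz zy]; rewrite ler_wpM2r ?expR_ge0// -lerBlDr.
  have xzy : x <= z <= y by rewrite !ltW.
  by have := lb z xzy; rewrite (ger0_norm (fge0 z xzy)).
have gmono s t : x <= s -> s <= t -> t <= y -> g s <= g t.
  move=> xs st ty; apply: (der_nondecr st (fun z h => dg z (le_trans xs (andP h).1))).
  move=> z /andP[sz zt].
  have xz : x < z by exact: le_lt_trans sz.
  apply: le_trans (g' z _); last by rewrite xz (lt_le_trans zt).
  by rewrite mulr_ge0 ?expR_ge0// pos0// (lt_trans x0).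
have g0 s : x <= s <= y -> g s = 0.
  move=> /andP[xs sy]; apply/eqP; rewrite eq_le.
  have gx : g x = 0 by rewrite /g fx mul0r.
  have gy : g y = 0 by rewrite /g (_ : f y = 0)// mul0r.
  by rewrite -{1}gy gmono//= -{1}gx gmono.
have sin0 s t : x <= s -> s < t -> t <= y ->
    exists2 c, s < c < t & sin (phase q c) = 0.
  move=> xs st ty.
  have [c /andP[sc ct]] := MVT_closed st (fun z h => dg z (le_trans xs (andP h).1)).
  rewrite (g0 t) ?(le_trans xs (ltW st))// (g0 s) ?xs ?(le_trans (ltW st) ty)// subrr => e.
  exists c; first by rewrite sc.
  have xc : x < c by exact: le_lt_trans sc.
  have c0 : 0 < c by exact: lt_trans xc.
  have cy : c < y by exact: lt_le_trans ty.
  have := g' c; rewrite xc cy => /(_ isT).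
  have -> : (f' c + K * f c) * expR (K * c) = 0.
    by apply/eqP; move/esym/eqP: e; rewrite mulf_eq0 (subr_eq0 t) (gt_eqF st) orbF.
  rewrite pmulr_lle0 ?expR_gt0// pmulr_lle0 ?invr_gt0//.
  rewrite pmulr_rle0; last by rewrite mulr_gt0 ?exprn_gt0// subr_gt0 expr_lt1// ltW.
  by move=> h; apply/eqP; rewrite -sqrf_eq0 eq_le h sqr_ge0.
(* Close to [x] the phase grows by less than pi, which leaves no room for two distinct zeros of its
   sine. *)
have [t /andP[xt ty] ht] : exists2 t, x < t < y & phase q t < phase q x + pi.
  have : \forall z \near x, phase q z < phase q x + pi.
    have h : {for x, continuous (phase q)} by exact/phase_cts/ltW.
    by apply: (cvgr_lt _ h); rewrite ltrDl pi_gt0.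
  move=> /nbhs_ballP[e /= e0 he]; pose m := Num.min (e / 2) ((y - x) / 2).
  have m0 : 0 < m by rewrite lt_min !divr_gt0// subr_gt0.
  exists (x + m).
    rewrite ltrDl m0 -ltrBrDl gt_min; apply/orP; right.
    by rewrite ltr_pdivrMr// ltr_pMr ?subr_gt0// ltr1n.
  apply: he; rewrite /ball /= opprD addNKr normrN gtr0_norm// gt_min.
  by rewrite ltr_pdivrMr// ltr_pMr// ltr1n.
have [c1 /andP[xc1 c1t] h1] := sin0 x t (lexx x) xt (ltW ty).
have [c2 /andP[c12 c2t] h2] := sin0 c1 t (ltW xc1) c1t (ltW ty).
have c10 : 0 < c1 by exact: lt_trans xc1.
have p12 := phase_incr q (ltW c10) c12.
have pc1 := phase_incr q (ltW x0) xc1.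
have pc2 := phase_incr q (ltW (lt_trans c10 c12)) c2t.
have : 0 < sin (phase q c2 - phase q c1) by apply: sin_gt0_pi; lra.
by rewrite sinB h1 h2 mulr0 mul0r subrr ltxx.
Qed.

(** So the first level is reached only beyond nu: a mode has k > nu, and only orders below r
    contribute to k < r. *)
Lemma phase_diff_lt_pi x : 0 < nu -> 0 < x <= nu -> phase_diff x < pi.
Proof.
move=> nu0 /andP[x0 xnu].
have hx : phase q x < pi / 2 by apply: phase_lt_pihalf => //; rewrite ltW.
have h0 : 0 < phase q (n * x).
  have /andP[+ _] := phase0_bounds (R := R) q.
  by move/lt_trans; apply; apply: phase_incr => //; rewrite mulr_gt0.
have := pi_gt0 R; rewrite /phase_diff; lra.
Qed.

End PhaseDifference.

(** * WKB asymptotics *)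

Section WKB.
Context {R : realType}.
Implicit Types (nu x s t : R) (q : nat).

(* x * wkb_profile (nu / x) is the integral of sqrt(t^2 - nu^2) / t over [nu, x]. *)
Definition wkb_profile s : R := Num.sqrt (1 - s ^+ 2) - s * acos s.

(** Up to the turning point nu the phase stays below [pi / 2], and the comparison function is taken
    to be 0. *)
Definition wkb nu x : R := if nu < x then x * wkb_profile (nu / x) else 0.

Lemma wkb_profile_cos t : 0 <= t <= pi -> wkb_profile (cos t) = sin t - t * cos t.
Proof.
move=> ht; rewrite /wkb_profile cosK ?in_itv//= -sin2cos2 sqrtr_sqr ger0_norm.
  by rewrite mulrC.
exact: sin_ge0_pi.
Qed.

Lemma acos_01 s : 0 <= s <= 1 -> 0 <= acos s <= pi / 2.
Proof.
move=> /andP[s0 s1]; have sN : -1 <= s by rewrite (le_trans _ s0).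
rewrite acos_ge0 ?sN//= leNgt; apply/negP => h.
have : cos (acos s) < cos (pi / 2).
  rewrite ltr_cos// ?in_itv /= ?acos_ge0 ?acos_lepi ?sN//.
  by rewrite divr_ge0 ?pi_ge0//= ler_pdivrMr// ler_peMr ?pi_ge0// ler1n.
by rewrite cos_pihalf acosK ?in_itv /= ?sN// ltNge s0.
Qed.

Lemma wkb_profile_bounds s : 0 <= s <= 1 -> 0 <= wkb_profile s <= 1.
Proof.
move=> hs; have /andP[t0 tp] := acos_01 hs; have /andP[s0 s1] := hs.
apply/andP; split; last first.
  rewrite /wkb_profile lerBlDr (@le_trans _ _ 1)// ?lerDl ?mulr_ge0//.
  by rewrite -[leRHS]sqrtr1 ler_wsqrtr// gerBl sqr_ge0.
have tpi : acos s <= pi.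
  by apply: (le_trans tp); rewrite ler_pdivrMr// ler_peMr ?pi_ge0// ler1n.
have sN : -1 <= s <= 1 by rewrite s1 (le_trans _ s0).
rewrite -(acosK sN) wkb_profile_cos ?t0//.
have h (u : R) : is_derive u 1 (fun u : R => sin u - u * cos u) (u * sin u).
  by der; rewrite /=; ring.
have := der_nondecr t0 (fun u _ => h u); rewrite sin0 mul0r subrr; apply.
move=> u /andP[u0 us]; rewrite mulr_ge0 ?sin_ge0_pi ?(ltW u0)//=.
by rewrite (le_trans (ltW us)).
Qed.

Section Fixed.
Variable q : nat.
Let nu : R := q%:R / 2.
Let nu0 : 0 <= nu. Proof. by rewrite divr_ge0. Qed.

Let c x := Num.sqrt (x ^+ 2 - nu ^+ 2).

Let radicand_gt0 x : nu < x -> 0 < x ^+ 2 - nu ^+ 2.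
Proof. by move=> h; rewrite subr_gt0 ltr_sqr ?nnegrE// (le_trans _ (ltW h)). Qed.

Let c_gt0 x : nu < x -> 0 < c x.
Proof. by move=> h; rewrite sqrtr_gt0 radicand_gt0. Qed.

Let c2 x : nu < x -> c x ^+ 2 = x ^+ 2 - nu ^+ 2.
Proof. by move=> h; rewrite sqr_sqrtr// ltW// radicand_gt0. Qed.

Let der_c x : nu < x -> is_derive x 1 c (x / c x).
Proof.
move=> h; rewrite /c.
have hs := is_derive1_sqrt (radicand_gt0 h).
eapply is_derive_eq.
  eapply (@derC _ Num.sqrt (fun x => x ^+ 2 - nu ^+ 2)); [exact: hs|].
  by repeat der_step.
have := c_gt0 h; rewrite /c => c0 /=.
by field; rewrite gt_eqF.
Qed.

Let c_scaled x : 0 < x -> x * Num.sqrt (1 - (nu / x) ^+ 2) = c x.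
Proof.
move=> x0; rewrite -{1}(ger0_norm (ltW x0)) -sqrtr_sqr -sqrtrM ?sqr_ge0//.
by congr Num.sqrt; field; rewrite gt_eqF.
Qed.

Let G x := c x - nu * acos (nu / x).

Let wkbE x : nu < x -> wkb nu x = G x.
Proof.
move=> h; have x0 : 0 < x by exact: le_lt_trans h.
rewrite /wkb h /wkb_profile mulrBr c_scaled//; congr (_ - _).
by rewrite mulrA mulrCA divff ?gt_eqF// mulr1.
Qed.

Let der_G x : nu < x -> is_derive x 1 G (c x / x).
Proof.
move=> h; have x0 : 0 < x by exact: le_lt_trans h.
have xn0 : x != 0 by rewrite gt_eqF.
have hc := der_c h; have c0 := c_gt0 h.
have hr : -1 < nu / x < 1.
  rewrite (@lt_le_trans _ _ 0) ?divr_ge0 ?(ltW x0)//=.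
  by rewrite ltr_pdivrMr// mul1r.
have hd : is_derive x 1 (fun y => acos (nu / y)) (nu / (x * c x)).
  eapply is_derive_eq.
    eapply (@derC _ acos (fun y => nu / y)); [exact: (is_derive1_acos hr)|].
    by repeat der_step.
  rewrite -(c_scaled x0); have : c x != 0 by rewrite gt_eqF.
  rewrite -(c_scaled x0) mulf_eq0 negb_or => /andP[_ hs] /=.
  by field; rewrite xn0 hs.
rewrite /G; der; rewrite mul0r add0r.
have cE := c2 h; have cn0 : c x != 0 by rewrite gt_eqF.
apply: (mulIf (mulf_neq0 xn0 cn0)).
transitivity (x ^+ 2 - nu ^+ 2); first by field; rewrite xn0 cn0.
by rewrite -cE; field; rewrite xn0.
Qed.

(* The branch of atan (c tan (phase)) that stays within pi/2 of [phase]; its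
   derivative is c / x plus a term bounded by the derivative of ln c / 2. *)
Let al x := phase q x + atan ((c x - 1) * (sin (phase q x) * cos (phase q x)) /
  (cos (phase q x) ^+ 2 + c x * sin (phase q x) ^+ 2)).

Let der_al x : nu < x -> is_derive x 1 al (c x / x + x / c x *
  (sin (phase q x) * cos (phase q x)) /
  (cos (phase q x) ^+ 2 + c x ^+ 2 * sin (phase q x) ^+ 2)).
Proof.
move=> h; have x0 : 0 < x by exact: le_lt_trans h.
have xn0 : x != 0 by rewrite gt_eqF.
have hc := der_c h; have c0 := c_gt0 h.
have hp := der_phase q (ltW x0).
have hp' := phase'_sincos q (ltW x0); rewrite -/nu -(c2 h) in hp'.
have hsc := cos2Dsin2 (phase q x).
have pos a : 0 < a -> cos (phase q x) ^+ 2 + a * sin (phase q x) ^+ 2 != 0.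
  move=> a0; rewrite gt_eqF//.
  have := sqr_ge0 (cos (phase q x)); have := sqr_ge0 (sin (phase q x)).
  move: hsc; set C := cos _ ^+ 2; set S := sin _ ^+ 2 => hsc S0 C0.
  by have [a1|a1] := leP 1 a; nra.
have p1 := pos _ c0; have p2 := pos _ (exprn_gt0 2 c0).
rewrite /al; eapply is_derive_eq.
  eapply (derD hp).
  eapply (@derC _ atan (fun x => (c x - 1) * (sin (phase q x) * cos (phase q x)) /
    (cos (phase q x) ^+ 2 + c x * sin (phase q x) ^+ 2))).
    exact: is_derive1_atan.
  by repeat der_step.
rewrite /= addr0.
move: (c x) (x / c x) (sin _) (cos _) (phase' q x) hp' hsc p1 p2 c0 => C d s k p hp' hsc p1 p2 C0.
set D1 := k ^+ 2 + C * s ^+ 2 in p1 *; set D2 := k ^+ 2 + C ^+ 2 * s ^+ 2 in hp' p2 *.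
(* These identities become polynomial once homogenized by the factor cos^2 + sin^2 = 1. *)
have e1 : 1 + ((C - 1) * (s * k) / D1) ^+ 2 = D2 / D1 ^+ 2.
  transitivity ((D2 * (k ^+ 2 + s ^+ 2)) / D1 ^+ 2); last by rewrite hsc mulr1.
  by rewrite /D2 /D1; field; exact: p1.
have e2 : (d * (s * k) + (C - 1) * (k * p * k + s * (- s * p))) / D1 +
   (C - 1) * (s * k) *
   (- (2 * k ^+ 1 * (- s * p) + (d * s ^+ 2 + C * (2 * s ^+ 1 * (k * p)))) / D1 ^+ 2) =
   (d * (s * k) + (C - 1) * (k ^+ 2 - C * s ^+ 2) * p) / D1 ^+ 2.
  transitivity ((k ^+ 2 + s ^+ 2) *
    ((d * (s * k) + (C - 1) * (k ^+ 2 - C * s ^+ 2) * p) / D1 ^+ 2)).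
    by rewrite /D1; field; exact: p1.
  by rewrite hsc mul1r.
rewrite e1 e2 (_ : p = D2 / x); last by rewrite -hp' mulrAC divff// mul1r.
transitivity (C * (k ^+ 2 + s ^+ 2) / x + d * (s * k) / D2); last by rewrite hsc mulr1.
have e3 : C * (k ^+ 2 + s ^+ 2) = D2 + (C - 1) * (k ^+ 2 - C * s ^+ 2).
  by rewrite /D2; ring.
by rewrite e3; field; rewrite p1 p2 xn0.
Qed.

(** The point where [c] equals 1: there [al] coincides with [phase] and ln c vanishes. It lies
    within distance 1 of nu. *)
Let x1 := Num.sqrt (nu ^+ 2 + 1).

Let x1_gt : nu < x1.
Proof.
rewrite -{1}(ger0_norm nu0) -sqrtr_sqr ltr_sqrt ?ltrDl// ltr_wpDl ?sqr_ge0//.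
Qed.

Let c_x1 : c x1 = 1.
Proof. by rewrite /c sqr_sqrtr ?addr_ge0 ?sqr_ge0// addrC addKr sqrtr1. Qed.

Let x1_le : x1 <= nu + 1.
Proof.
rewrite -[leRHS]ger0_norm ?addr_ge0// -sqrtr_sqr ler_wsqrtr//.
by rewrite sqrrD expr1n mulr1 addrAC lerDl mulrn_wge0.
Qed.

(** The derivative of [al - G] is (z / c) sin cos / (cos^2 + c^2 sin^2); since 2 c |sin cos| <=
    cos^2 + c^2 sin^2, it is at most z / (2 c^2) = (ln c)' / 2 in absolute value. Integrate from
    [x1], and use c <= x. *)
Let al_G x : x1 <= x -> `|(al x - G x) - (al x1 - G x1)| <= ln x / 2.
Proof.
move=> x1x; have nux : nu < x by exact: lt_le_trans x1x.
have x0 : 0 < x by exact: le_lt_trans nux.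
have c1x z : x1 <= z -> 1 <= c z.
  move=> hz; rewrite -c_x1 ler_wsqrtr// lerD2r ler_sqr ?nnegrE ?sqrtr_ge0//.
  by rewrite (le_trans _ hz)// sqrtr_ge0.
have lnle : ln (c x) <= ln x.
  rewrite ler_ln ?posrE// ?(lt_le_trans _ (c1x _ x1x))//.
  by rewrite -{2}(ger0_norm (ltW x0)) -sqrtr_sqr ler_wsqrtr// gerBl sqr_ge0.
pose r z := z / c z * (sin (phase q z) * cos (phase q z)) /
  (cos (phase q z) ^+ 2 + c z ^+ 2 * sin (phase q z) ^+ 2).
have dr z : x1 <= z -> is_derive z 1 (fun z => al z - G z) (r z).
  move=> hz; have nuz : nu < z by exact: lt_le_trans hz.
  have h1 := der_al nuz; have h2 := der_G nuz.
  by der; rewrite /r; ring.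
have dl z : x1 <= z -> is_derive z 1 (fun z => ln (c z) / 2) (z / c z ^+ 2 / 2).
  move=> hz; have nuz : nu < z by exact: lt_le_trans hz.
  have h1 := der_c nuz.
  have h2 : is_derive z 1 (fun z => ln (c z)) ((c z)^-1 * (z / c z)).
    exact: (@derC _ (@ln R) c _ _ _ (is_derive1_ln (c_gt0 nuz)) h1).
  by der; have := c_gt0 nuz => cz; field; rewrite gt_eqF.
have rb z : x1 <= z -> `|r z| <= z / c z ^+ 2 / 2.
  move=> hz; have nuz : nu < z by exact: lt_le_trans hz.
  have z0 : 0 < z by exact: le_lt_trans nuz.
  have cz := c_gt0 nuz.
  rewrite /r; move: (cos2Dsin2 (phase q z)).
  move: (c z) (sin _) (cos _) cz => C s k C0 hsc.
  have D0 : 0 < k ^+ 2 + C ^+ 2 * s ^+ 2.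
    have C20 := exprn_gt0 2 C0; have := sqr_ge0 k; have := sqr_ge0 s.
    move: (k ^+ 2) (s ^+ 2) (C ^+ 2) hsc C20 => k2 s2 a hsc a0 S0 K0.
    by have [a1|a1] := leP 1 a; nra.
  have zC0 := divr_ge0 (ltW z0) (ltW C0).
  rewrite -mulrA normrM (ger0_norm zC0).
  rewrite -[leRHS](_ : z / C * (1 / (2 * C)) = _); last by field; rewrite gt_eqF.
  rewrite (ler_wpM2l zC0)// normrM normfV (gtr0_norm D0).
  rewrite ler_pdivrMr// mulrAC ler_pdivlMr ?mulr_gt0// mul1r.
  have h1 := sqr_ge0 (k - C * s); have h2 := sqr_ge0 (k + C * s).
  have [h|h] := leP 0 (s * k); [rewrite ger0_norm//|rewrite ltr0_norm//]; nra.
have ln1 : ln (c x1) / 2 = 0 by rewrite c_x1 ln1 mul0r.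
rewrite (le_trans _ (_ : ln (c x) / 2 <= _))//; last by rewrite ler_pM2r ?invr_gt0.
rewrite ler_norml; apply/andP; split.
  have d z : x1 <= z <= x -> is_derive z 1 (fun z => al z - G z + ln (c z) / 2)
      (r z + z / c z ^+ 2 / 2).
    by move=> /andP[hz _]; exact: derD (dr z hz) (dl z hz).
  have hh := der_nondecr x1x d; rewrite ln1 addr0 in hh.
  set A := al x1 - G x1 in hh *; set B := al x - G x in hh *.
  suff : A <= B + ln (c x) / 2 by lra.
  apply: hh => z /andP[hz _].
  by have := rb z (ltW hz); rewrite ler_norml => /andP[+ _]; rewrite -lerBlDr sub0r.
have d z : x1 <= z <= x -> is_derive z 1 (fun z => ln (c z) / 2 - (al z - G z))
    (z / c z ^+ 2 / 2 - r z).
  by move=> /andP[hz _]; exact: derD (dl z hz) (derN (dr z hz)).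
have hh := der_nondecr x1x d; rewrite ln1 in hh.
set A := al x1 - G x1 in hh *; set B := al x - G x in hh *.
suff : 0 - A <= ln (c x) / 2 - B by lra.
apply: hh => z /andP[hz _].
by have := rb z (ltW hz); rewrite ler_norml => /andP[_ +]; rewrite subr_ge0.
Qed.

Let phase_gt0 x : 0 <= x -> 0 < phase q x.
Proof.
move=> x0; have /andP[h _] := phase0_bounds (R := R) q.
move: x0; rewrite le_eqVlt => /predU1P[<-//|x0].
exact/(lt_trans h)/phase_incr.
Qed.

Let wkb_ge0 x : 0 <= x -> 0 <= wkb nu x.
Proof.
move=> x0; rewrite /wkb; case: ltP => // h; rewrite mulr_ge0//.
suff /wkb_profile_bounds/andP[] : 0 <= nu / x <= 1 by [].
have {}x0 : 0 < x by exact: le_lt_trans h.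
by rewrite divr_ge0 ?(ltW x0)//= ler_pdivrMr// mul1r ltW.
Qed.

(** Up to nu, the phase is under [pi / 2] and the WKB phase is 0; between nu and [x1], both are
    bounded; beyond [x1], [al_G] applies and [al] is within [pi / 2] of the phase. *)
Let phase_wkb x : 1 <= x -> `|phase q x - wkb nu x| <= phase q x1 + pi + 1 + ln x.
Proof.
move=> xge1; have x0 : 0 < x by exact: lt_le_trans xge1.
have lnx : 0 <= ln x by exact: ln_ge0.
have px := phase_gt0 (ltW x0); have px1 := phase_gt0 (sqrtr_ge0 _ : 0 <= x1).
have pi0 := pi_gt0 R; have wx := wkb_ge0 (ltW x0).
have [xnu|nux] := leP x nu.
  have nup : 0 < nu by exact: lt_le_trans xnu.
  have pl : phase q x < pi / 2 by apply: phase_lt_pihalf; rewrite // ltW.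
  rewrite /wkb ltNge xnu /= subr0 gtr0_norm//; lra.
have [xx1|x1x] := ltP x x1.
  have pl : phase q x < phase q x1 by apply: phase_incr => //; exact: ltW.
  have wl : wkb nu x <= 1.
    rewrite (wkbE nux) /G (@le_trans _ _ (c x))//.
      rewrite gerBl mulr_ge0//.
      suff /acos_01/andP[] : 0 <= nu / x <= 1 by [].
      by rewrite divr_ge0 ?(ltW x0)//= ler_pdivrMr// mul1r ltW.
    rewrite -c_x1 ler_wsqrtr// lerD2r ler_sqr ?nnegrE ?sqrtr_ge0 ?(ltW x0)//.
    exact: ltW.
  rewrite ler_norml; apply/andP; split; lra.
have h := al_G x1x.
have al1 : al x1 = phase q x1 by rewrite /al c_x1 subrr !mul0r atan0 addr0.
have G1 : 0 <= G x1 <= 1.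
  rewrite -(wkbE x1_gt) wkb_ge0 ?sqrtr_ge0//= (wkbE x1_gt) /G c_x1 gerBl mulr_ge0//.
  suff /acos_01/andP[] : 0 <= nu / x1 <= 1 by [].
  have x10 : 0 < x1 by exact: le_lt_trans x1_gt.
  by rewrite divr_ge0 ?(ltW x10)//= ler_pdivrMr// mul1r ltW.
have hal : - (pi / 2) < al x - phase q x < pi / 2.
  by rewrite /al addrAC subrr add0r atan_gtNpi2 atan_ltpi2.
move: h G1 hal; rewrite al1 (wkbE nux) ler_norml => /andP[h1 h2] /andP[h3 h4] /andP[h5 h6].
rewrite ler_norml; apply/andP; split; lra.
Qed.

(** This makes the constant uniform in the order. On [[nu, x1]], of length at most 1, z^2 - nu^2 <=
    1 gives z theta' <= 1, and z >= 1 / 2 then bounds the slope by 2. Order 0, where [x1 = 1], is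
    handled by the value [phase 0 1]. *)
Let phase_x1 : (0 < q)%N -> phase q x1 <= pi / 2 + 2.
Proof.
move=> q0; have nuh : 1 / 2 <= nu by rewrite /nu ler_pM2r ?invr_gt0// ler1n.
have nup : 0 < nu by apply: lt_le_trans nuh; rewrite divr_gt0.
have [z /andP[nuz zx] e] := MVT_closed x1_gt (fun z h => der_phase q (le_trans nu0 (andP h).1)).
have z0 : 0 < z by exact: lt_trans nuz.
have p1 : phase q nu < pi / 2 by apply: phase_lt_pihalf => //; rewrite nu0 lexx.
have p' : phase' q z <= 2.
  rewrite -(ler_pM2l z0) (phase'_sincos q (ltW z0)) -/nu.
  apply: (@le_trans _ _ 1); last by lra.
  rewrite -(cos2Dsin2 (phase q z)) lerD2l ler_piMl ?sqr_ge0//.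
  have : z ^+ 2 < x1 ^+ 2 by rewrite ltr_sqr ?nnegrE ?sqrtr_ge0// ltW.
  by rewrite sqr_sqrtr ?addr_ge0 ?sqr_ge0//; lra.
have x1le := x1_le; have x1g := x1_gt.
have : phase' q z * (x1 - nu) <= 2 * 1.
  apply: ler_pM => //; [exact/ltW/phase'_gt0|lra|lra].
lra.
Qed.

Lemma phase_wkb_le x : 1 <= x ->
  `|phase q x - wkb nu x| <= Num.max (phase 0 1) (pi / 2 + 2) + pi + 1 + ln x.
Proof.
move=> xge1; apply: (le_trans (phase_wkb xge1)); rewrite !lerD2r le_max.
case: (posnP q) => [q0|/phase_x1->]; last by rewrite orbT.
by rewrite /x1 /nu q0 mul0r expr0n add0r sqrtr1 lexx.
Qed.

End Fixed.

Lemma phase_asymptotic : exists2 K : R, 0 <= K &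
  forall q x, 1 <= x -> `|phase q x - wkb (q%:R / 2) x| <= K + ln x.
Proof.
exists (Num.max (phase 0 1) (pi / 2 + 2) + pi + 1); last exact: phase_wkb_le.
have p0 := pi_ge0 R.
have : pi / 2 + 2 <= Num.max (phase 0 1) (pi / 2 + 2) :> R by rewrite le_max lexx orbT.
lra.
Qed.

End WKB.

(** * Riemann sums with explicit error *)

Section RiemannSum.
Context {R : realType}.
Implicit Types (h H : R -> R) (r s : R).

(** A derivative-free way to say that [H] is a primitive of [h]: the error over one cell is
    quadratic in its length, whatever the sample point. The constant 3 covers the Lipschitz
    constants of all the integrands used. *)
Definition primitive01 h H := forall s1 s s2, 0 <= s1 -> s1 <= s <= s2 -> s2 <= 1 ->
  `|H s2 - H s1 - h s * (s2 - s1)| <= 3 * (s2 - s1) ^+ 2.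

(** Each cell has length 1 / r and contributes an error of at most r * 3 / r^2; there are at most r
    cells. The offset [sigma] will be the shift d / 2 between m and the order nu. *)
Lemma riemann_sum h H (sigma r : R) (M1 M2 : nat) : primitive01 h H ->
  0 <= sigma <= 1 -> 0 < r -> (M1 <= M2)%N -> M2%:R <= r ->
  `|\sum_(M1 <= m < M2) h ((m%:R + sigma) / r) - r * (H (M2%:R / r) - H (M1%:R / r))|
  <= 3.
Proof.
move=> hH /andP[sg0 sg1] r0 M12 M2r.
apply: (@le_trans _ _ (3 * (M2 - M1)%:R / r)); last first.
  rewrite ler_pdivrMr// ler_pM2l//; apply: le_trans M2r; rewrite ler_nat; lia.
elim: M2 M12 M2r => [|M IH].
  rewrite leqn0 => /eqP -> _; rewrite big_geq// subrr mulr0 subrr normr0.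
  by rewrite subnn mulr0 mul0r.
rewrite leq_eqVlt => /predU1P[->|M1M] Mr.
  by rewrite big_geq// subrr mulr0 subrr normr0 subnn mulr0 mul0r.
have Mr' : M%:R <= r by apply: le_trans Mr; rewrite ler_nat.
have {}IH := IH M1M Mr'.
rewrite big_nat_recr//=.
set S := \sum_(M1 <= m < M) _ in IH *.
have e : S + h ((M%:R + sigma) / r) - r * (H (M.+1%:R / r) - H (M1%:R / r)) =
  (S - r * (H (M%:R / r) - H (M1%:R / r))) -
  r * (H (M.+1%:R / r) - H (M%:R / r) - h ((M%:R + sigma) / r) * (M.+1%:R / r - M%:R / r)).
  by rewrite -natr1; field; rewrite gt_eqF.
rewrite e; apply: (le_trans (ler_normB _ _)).
have -> : 3 * (M.+1 - M1)%:R / r = 3 * (M - M1)%:R / r + 3 / r.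
  by rewrite subSn// -natr1; field; rewrite gt_eqF.
apply: lerD => //.
rewrite normrM (gtr0_norm r0).
have := hH (M%:R / r) ((M%:R + sigma) / r) (M.+1%:R / r).
rewrite divr_ge0 ?(ltW r0)// => /(_ isT).
rewrite !ler_pM2r ?invr_gt0// lerDl sg0 -natr1 lerD2l sg1 => /(_ isT).
rewrite natr1 ler_pdivrMr// mul1r => /(_ Mr) h1.
apply: (le_trans (ler_wpM2l (ltW r0) h1)); rewrite -natr1 le_eqVlt; apply/orP; left.
by apply/eqP; field; rewrite gt_eqF.
Qed.

Lemma primitive01_norm h H (hlip : forall s t, 0 <= s -> s <= t -> t <= 1 ->
    `|h t - h s| <= 3 * (t - s)) :
  (forall a e s1 s2, 0 <= s1 -> s1 <= s2 -> s2 <= 1 ->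
    (forall s, s1 <= s <= s2 -> `|h s - a| <= e) ->
    `|H s2 - H s1 - a * (s2 - s1)| <= e * (s2 - s1)) ->
  primitive01 h H.
Proof.
move=> hH s1 s s2 s10 /andP[s1s ss2] s21.
rewrite expr2 mulrA; apply: hH => // [|t /andP[s1t ts2]]; first exact: le_trans ss2.
have [st|/ltW ts] := leP s t.
  apply: (le_trans (hlip _ _ _ st _)); [exact: le_trans s1s|exact: le_trans s21|].
  by rewrite ler_pM2l// lerB.
rewrite distrC; apply: (le_trans (hlip _ _ _ ts _)); [exact: le_trans s1t|exact: le_trans s21|].
by rewrite ler_pM2l// lerB.
Qed.

(* Substituting s = cos t avoids the endpoint 1, where acos is not differentiable. *)
Lemma primitive_cos (h H : R -> R) :
  (forall t : R, is_derive t 1 H (- sin t * h t)) ->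
  forall a e s1 s2, 0 <= s1 -> s1 <= s2 -> s2 <= 1 ->
    (forall s, s1 <= s <= s2 -> `|h (acos s) - a| <= e) ->
    `|H (acos s2) - H (acos s1) - a * (s2 - s1)| <= e * (s2 - s1).
Proof.
move=> dH a e s1 s2 s10 s12 s21 he.
have s11 : s1 <= 1 by exact: le_trans s21.
have s20 : 0 <= s2 by exact: le_trans s12.
have N1 s : 0 <= s -> s <= 1 -> -1 <= s <= 1.
  by move=> s0 ->; rewrite andbT (le_trans _ s0).
have i1 := N1 _ s10 s11; have i2 := N1 _ s20 s21.
have c1 : cos (acos s1) = s1 by apply: acosK; rewrite in_itv.
have c2 : cos (acos s2) = s2 by apply: acosK; rewrite in_itv.
have t12 : acos s2 <= acos s1.
  rewrite leNgt; apply/negP => h12.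
  have : cos (acos s2) < cos (acos s1).
    by rewrite ltr_cos// in_itv /= acos_ge0 ?acos_lepi.
  by rewrite c1 c2 ltNge s12.
have cosb t : acos s2 <= t <= acos s1 -> 0 <= sin t /\ `|h t - a| <= e.
  move=> /andP[h2 h1].
  have t0 : 0 <= t by rewrite (le_trans _ h2)// acos_ge0.
  have tp : t <= pi by rewrite (le_trans h1)// acos_lepi.
  have cm u v : 0 <= u -> u <= v -> v <= pi -> cos v <= cos u.
    move=> u0 uv vp; rewrite leNgt; apply/negP.
    rewrite ltr_cos ?in_itv /= ?u0 ?vp ?(le_trans uv vp) ?(le_trans u0 uv)//.
    by rewrite ltNge uv.
  rewrite sin_ge0_pi ?t0//; split=> //.
  rewrite -[in h t](cosK (x := t)) ?in_itv /= ?t0//; apply: he.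
  rewrite -{1}c1 -{1}c2.
  by rewrite !cm ?acos_ge0 ?acos_lepi.
rewrite ler_norml; apply/andP; split.
  have d t : acos s2 <= t <= acos s1 ->
      is_derive t 1 (fun t => - H t + (a - e) * cos t)
        (sin t * (h t - a + e)).
    by move=> _; have dHt := dH t; der; rewrite /=; ring.
  have := der_nondecr t12 d; rewrite c1 c2 => /(_ _) hh.
  suff : - H (acos s2) + (a - e) * s2 <= - H (acos s1) + (a - e) * s1 by lra.
  apply: hh => t /andP[h2 h1].
  have /cosb[st ct] : acos s2 <= t <= acos s1 by rewrite !ltW.
  by rewrite mulr_ge0//; move: ct; rewrite ler_norml => /andP[hl _]; lra.
have d t : acos s2 <= t <= acos s1 ->
    is_derive t 1 (fun t => H t - (a + e) * cos t)
      (sin t * (e - (h t - a))).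
  by move=> _; have dHt := dH t; der; rewrite /=; ring.
have := der_nondecr t12 d; rewrite c1 c2 => /(_ _) hh.
suff : H (acos s2) - (a + e) * s2 <= H (acos s1) - (a + e) * s1 by lra.
apply: hh => t /andP[h2 h1].
have /cosb[st ct] : acos s2 <= t <= acos s1 by rewrite !ltW.
by rewrite mulr_ge0//; move: ct; rewrite ler_norml => /andP[_ hl]; lra.
Qed.

End RiemannSum.

Section WKBMoments.
Context {R : realType}.
Implicit Types (s t : R) (d k : nat).

Lemma acosK01 s : 0 <= s <= 1 -> cos (acos s) = s.
Proof.
by move=> /andP[s0 s1]; rewrite acosK// in_itv /= s1 (le_trans _ s0).
Qed.

Lemma wkb_profile_acos s : 0 <= s <= 1 ->
  wkb_profile s = sin (acos s) - acos s * cos (acos s).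
Proof.
move=> hs; have /andP[a0 ap] := acos_01 hs; rewrite -wkb_profile_cos ?acosK01//.
by rewrite a0 (le_trans ap)// ler_pdivrMr// ler_peMr ?pi_ge0// ler1n.
Qed.

(** The slope of the profile is -acos s, of absolute value at most pi / 2 < 2. *)
Lemma wkb_profile_lip s1 s2 : 0 <= s1 -> s1 <= s2 -> s2 <= 1 ->
  `|wkb_profile s2 - wkb_profile s1| <= 2 * (s2 - s1).
Proof.
move=> s10 s12 s21.
have d (t : R) : is_derive t 1 (fun t => sin t - t * cos t) (- sin t * - t).
  by der; rewrite /=; ring.
have := primitive_cos d s10 s12 s21 (a := 0) (e := 2).
rewrite mul0r subr0 -!wkb_profile_acos ?s10 ?s21 ?(le_trans s12) ?(le_trans s10)//.
apply=> s /andP[h1 h2]; rewrite subr0 normrN.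
have /andP[a0 ap] : 0 <= acos s <= pi / 2.
  by apply: acos_01; rewrite (le_trans s10)// (le_trans h2).
by rewrite ger0_norm// (le_trans ap)// ltW// pihalf_lt2.
Qed.

Lemma exprn_lip k s1 s2 : (k <= 3)%N -> 0 <= s1 -> s1 <= s2 -> s2 <= 1 ->
  `|s2 ^+ k - s1 ^+ k| <= 3 * (s2 - s1).
Proof.
move=> k3 s10 s12 s21; have s20 : 0 <= s2 by exact: le_trans s12.
rewrite ger0_norm ?subr_ge0 ?lerXn2r// subrXX mulrC ler_wpM2r ?subr_ge0//.
apply: (@le_trans _ _ k%:R); last by rewrite ler_nat.
rewrite -[k in k%:R]card_ord -sumr_const; apply: ler_sum => i _.
by rewrite mulr_ile1 ?exprn_ge0 ?exprn_ile1// (le_trans s12).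
Qed.

Definition wkb_moment d s : R := s ^+ d * wkb_profile s.

(** Antiderivatives of [wkb_moment d], found by integrating in t = acos s; the second branch is the
    one for d = 1. *)
Definition wkb_prim d s : R := if d == 0%N
  then 3 / 4 * (cos (acos s) * sin (acos s)) + (pi / 2 - acos s) / 4
       - acos s * cos (acos s) ^+ 2 / 2
  else sin (acos s) / 3 - 4 / 9 * sin (acos s) ^+ 3 - acos s * cos (acos s) ^+ 3 / 3.

Lemma wkb_moment_bounds d s : 0 <= s <= 1 -> 0 <= wkb_moment d s <= 1.
Proof.
move=> hs; have /andP[w0 w1] := wkb_profile_bounds hs; have /andP[s0 s1] := hs.
by rewrite mulr_ge0 ?exprn_ge0//= mulr_ile1 ?exprn_ge0 ?exprn_ile1.
Qed.

Lemma wkb_prim_le d a e s1 s2 : (d <= 1)%N -> 0 <= s1 -> s1 <= s2 -> s2 <= 1 ->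
    (forall s, s1 <= s <= s2 -> `|wkb_moment d s - a| <= e) ->
    `|wkb_prim d s2 - wkb_prim d s1 - a * (s2 - s1)| <= e * (s2 - s1).
Proof.
move=> d1 s10 s12 s21 he.
have hE s : s1 <= s <= s2 ->
    wkb_moment d s = cos (acos s) ^+ d * (sin (acos s) - acos s * cos (acos s)).
  move=> /andP[h1 h2]; have hs : 0 <= s <= 1 by rewrite (le_trans s10)// (le_trans h2).
  by rewrite /wkb_moment wkb_profile_acos// acosK01.
case: d d1 he hE => [|[|//]] _ he hE.
  pose h (t : R) := cos t ^+ 0 * (sin t - t * cos t).
  apply: (@primitive_cos _ h (fun t => 3 / 4 * (cos t * sin t) + (pi / 2 - t) / 4 -
    t * cos t ^+ 2 / 2)) => //.
    move=> t; der; rewrite /h /=; have := cos2Dsin2 t => e1.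
    transitivity (- sin t * (sin t - t * cos t) - (1 - (cos t ^+ 2 + sin t ^+ 2)) / 4).
      by field.
    by rewrite e1; field.
  by move=> s hs; rewrite -[h _]hE// he.
pose h (t : R) := cos t ^+ 1 * (sin t - t * cos t).
apply: (@primitive_cos _ h (fun t => sin t / 3 - 4 / 9 * sin t ^+ 3 -
    t * cos t ^+ 3 / 3)) => //.
  move=> t; der; rewrite /h /=; have := cos2Dsin2 t => e1.
  transitivity (- sin t * (cos t * (sin t - t * cos t))
     + cos t / 3 * (1 - (cos t ^+ 2 + sin t ^+ 2))).
    by field.
  by rewrite e1; field.
by move=> s hs; rewrite -[h _]hE// he.
Qed.

Lemma wkb_prim_lip d s1 s2 : (d <= 1)%N -> 0 <= s1 -> s1 <= s2 -> s2 <= 1 ->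
  `|wkb_prim d s2 - wkb_prim d s1| <= s2 - s1.
Proof.
move=> d1 s10 s12 s21; rewrite -[leRHS]mul1r.
have := wkb_prim_le d1 s10 s12 s21 (a := 0) (e := 1); rewrite mul0r subr0; apply.
move=> s /andP[h1 h2]; have hs : 0 <= s <= 1 by rewrite (le_trans s10)// (le_trans h2).
by have /andP[m0 m1] := wkb_moment_bounds d hs; rewrite subr0 ger0_norm.
Qed.

Lemma wkb_moment_primitive d : (d <= 1)%N -> primitive01 (wkb_moment d) (wkb_prim d).
Proof.
move=> d1; apply: primitive01_norm; last by move=> *; exact: wkb_prim_le.
move=> s t s0 st t1.
have hl := wkb_profile_lip s0 st t1.
have t0 : 0 <= t by exact: le_trans st.
have /andP[w0 w1] : 0 <= wkb_profile s <= 1.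
  by apply: wkb_profile_bounds; rewrite s0 (le_trans st).
case: d d1 => [|[|//]] _; rewrite /wkb_moment ?expr0 ?mul1r ?expr1.
  by apply: (le_trans hl); rewrite ler_wpM2r ?subr_ge0// ler_nat.
move: hl w0 w1; set u := wkb_profile t; set v := wkb_profile s.
rewrite !ler_norml => /andP[h1 h2] w0 w1; apply/andP; split; nra.
Qed.

Lemma exprn_primitive k : (0 < k <= 2)%N ->
  primitive01 (fun s : R => s ^+ k) (fun s => s ^+ k.+1 / k.+1%:R).
Proof.
move=> /andP[k0 k2]; apply: primitive01_norm.
  by move=> s t; apply: exprn_lip; exact: leq_trans k2 _.
move=> a e s1 s2 s10 s12 s21 he.
have s11 : 0 <= s1 <= 1 by rewrite s10 (le_trans s12).
have s22 : 0 <= s2 <= 1 by rewrite s21 (le_trans s10).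
rewrite -{1}(acosK01 s11) -{1}(acosK01 s22).
apply: (@primitive_cos _ (fun t => cos t ^+ k) (fun t => cos t ^+ k.+1 / k.+1%:R)) => //.
  by move=> t; der; rewrite /=; field; rewrite ?nat1r ?natr1 pnatr_eq0.
move=> s hs; rewrite acosK01 ?he//; case/andP: hs => h1 h2.
by rewrite (le_trans s10)// (le_trans h2).
Qed.

(** The integral of [wkb_profile] over [0, 1]. Multiplied by 2 / pi it is 1 / 4, the Weyl
    coefficient of the unit disc; likewise 1 / 9 below gives 2 / (9 pi), that of the unit ball. *)
Lemma wkb_prim01 : wkb_prim 0 1 - wkb_prim 0 0 = pi / 8 :> R.
Proof.
rewrite /wkb_prim eqxx acos1 acos0 cos0 sin0 cos_pihalf sin_pihalf expr0n /=; lra.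
Qed.

Lemma wkb_prim11 : wkb_prim 1 1 - wkb_prim 1 0 = 1 / 9 :> R.
Proof.
rewrite /wkb_prim /= acos1 acos0 cos0 sin0 cos_pihalf sin_pihalf !expr0n expr1n /=; lra.
Qed.

End WKBMoments.

(** * Counting modes *)

Section AsymptoticSums.
Context {R : realType}.
Variable d : nat.
Hypothesis hd : (d <= 1)%N.
Implicit Types r n e K : R.

(** Here [d = N - 2]. The weight [2 * order_nu m ^+ d] is the number of angular factors, 2 in the
    disc (an overcount when m = 0) and 2 m + 1 in the ball. *)
Definition order_nu (m : nat) : R := m%:R + d%:R / 2.

Let sg : 0 <= (d%:R / 2 : R) <= 1 / 2.
Proof.
have : d%:R <= 1 :> R by rewrite (ler_nat _ d 1).
have : 0 <= d%:R :> R by []. lra.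
Qed.

Let nu_ge m : m%:R <= order_nu m.
Proof. by rewrite /order_nu lerDl; case/andP: sg. Qed.

Let nu_lt m k : (m < k)%N -> order_nu m < k%:R.
Proof.
move=> mk; have := sg; rewrite /order_nu => /andP[_ s1].
have : m.+1%:R <= k%:R :> R by rewrite ler_nat.
rewrite -natr1; lra.
Qed.

Let nu_ge0 m : 0 <= order_nu m.
Proof. exact: le_trans (nu_ge m). Qed.

(** From 1 + l^2 / 2 <= e^l one has (ln r)^2 <= 2 r, so r >= 8 / e^2 gives ln r <= e r / 2; the
    threshold [2 * K / e] lets the other half absorb [K]. *)
Lemma linear_dominates_ln K e : 0 < e ->
  exists2 r0, 1 <= r0 & forall r, r0 <= r -> K + ln r <= e * r.
Proof.
move=> e0; exists (Num.max 1 (Num.max (8 / e ^+ 2) (2 * K / e))).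
  by rewrite le_max lexx.
move=> r; rewrite !ge_max => /and3P[r1 r2 r3].
have r0 : 0 < r by exact: lt_le_trans r1.
have l0 : 0 <= ln r by exact: ln_ge0.
have h2 : ln r ^+ 2 <= 2 * r.
  have := expR_ge1Dxn 1 l0; rewrite lnK ?posrE// => h.
  have -> : ln r ^+ 2 = ln r ^+ 2 / 2`!%:R * 2 by rewrite mulfVK.
  by rewrite mulrC ler_pM2l// (le_trans _ h)// lerDr.
have h3 : 2 * K <= e * r by move: r3; rewrite ler_pdivrMr// (mulrC r).
have h4 : 8 <= r * e ^+ 2 by move: r2; rewrite ler_pdivrMr ?exprn_gt0.
suff : ln r <= e * r / 2 by lra.
have er0 : 0 <= e * r / 2 by rewrite divr_ge0// mulr_ge0 ?ltW.
rewrite -ler_sqr ?nnegrE// (le_trans h2)//.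
have -> : (e * r / 2) ^+ 2 = (r * e ^+ 2) * r / 4 by field.
rewrite ler_pdivlMr// mulrAC; apply: ler_wpM2r; [exact: ltW|lra].
Qed.

Let truncn_bounds r : 0 <= r -> (Num.truncn r)%:R <= r < (Num.truncn r)%:R + 1.
Proof. by move=> /truncn_itv; rewrite natr1. Qed.

Let wkb_moment_nu m r : 0 < r -> order_nu m <= r ->
  order_nu m ^+ d * wkb (order_nu m) r = r ^+ d.+1 * wkb_moment d (order_nu m / r).
Proof.
move=> r0 mr; rewrite /wkb /wkb_moment; case: ltP => h.
  by rewrite exprMn exprVn exprSr; field; rewrite expf_neq0 ?gt_eqF.
have -> : order_nu m = r by apply/le_anti; rewrite mr h.
rewrite divff ?gt_eqF// /wkb_profile acos1 !expr1n subrr sqrtr0; ring.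
Qed.

Let wkb_ge0 nu r : 0 <= nu -> 0 <= wkb nu r.
Proof.
move=> nu0; rewrite /wkb; case: ltP => // h.
have r0 : 0 < r by exact: le_lt_trans h.
suff /wkb_profile_bounds/andP[? _] : 0 <= nu / r <= 1 by rewrite mulr_ge0// ltW.
by rewrite divr_ge0 ?(ltW r0)//= ler_pdivrMr// mul1r ltW.
Qed.

Let wkb_le nu r : 0 <= nu -> 0 <= r -> wkb nu r <= r.
Proof.
move=> nu0 r0; rewrite /wkb; case: ltP => // h.
have {}r0 : 0 < r by exact: le_lt_trans h.
suff /wkb_profile_bounds/andP[_ ?] : 0 <= nu / r <= 1 by rewrite ler_piMr// ltW.
by rewrite divr_ge0 ?(ltW r0)//= ler_pdivrMr// mul1r ltW.
Qed.

Let nu_exp_le m r : 0 <= r -> order_nu m <= 2 * r -> order_nu m ^+ d <= 2 * r ^+ d.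
Proof.
move=> r0; case: d hd => [|[|//]] _; rewrite ?expr0 ?expr1// => _.
by rewrite mulr1 ler1n.
Qed.

Let I : R := wkb_prim d 1 - wkb_prim d 0.

Let moment_part r (M1 M2 : nat) : 0 < r -> (M1 <= M2)%N -> M2%:R <= r ->
  `|\sum_(M1 <= m < M2) order_nu m ^+ d * wkb (order_nu m) r
    - r ^+ d.+2 * (wkb_prim d (M2%:R / r) - wkb_prim d (M1%:R / r))| <= 3 * r ^+ d.+1.
Proof.
move=> r0 M12 M2r.
have -> : \sum_(M1 <= m < M2) order_nu m ^+ d * wkb (order_nu m) r =
    r ^+ d.+1 * \sum_(M1 <= m < M2) wkb_moment d ((m%:R + d%:R / 2) / r).
  rewrite big_distrr /=; apply: eq_big_nat => m /andP[_ mM].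
  rewrite wkb_moment_nu//; apply: ltW; exact: lt_le_trans (nu_lt mM) M2r.
set S := \sum_(M1 <= m < M2) _; set D := wkb_prim d _ - _.
have -> : r ^+ d.+1 * S - r ^+ d.+2 * D = r ^+ d.+1 * (S - r * D).
  by rewrite (exprS r d.+1); ring.
rewrite normrM ger0_norm ?exprn_ge0 ?(ltW r0)// [leRHS]mulrC ler_pM2l ?exprn_gt0//.
apply: riemann_sum => //; first exact: wkb_moment_primitive.
case/andP: sg => -> h; lra.
Qed.

Let prim_lip s1 s2 : 0 <= s1 -> s1 <= s2 -> s2 <= 1 ->
  `|wkb_prim d s2 - wkb_prim d s1| <= s2 - s1 :> R.
Proof. exact: wkb_prim_lip. Qed.

Let truncn_div r : 1 <= r -> 1 - 1 / r <= (Num.truncn r)%:R / r <= 1.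
Proof.
move=> r1; have r0 : 0 < r by exact: lt_le_trans r1.
have /andP[M1 M2] := truncn_bounds (ltW r0).
apply/andP; split; last by rewrite ler_pdivrMr// mul1r.
rewrite ler_pdivlMr// mulrBl divfK ?gt_eqF//; lra.
Qed.

Lemma wkb_sum r : 1 <= r ->
  `|\sum_(0 <= m < (Num.truncn r).+1) order_nu m ^+ d * wkb (order_nu m) r
    - I * r ^+ d.+2| <= 6 * r ^+ d.+1.
Proof.
move=> r1; have r0 : 0 < r by exact: lt_le_trans r1.
have /andP[M1 M2] := truncn_bounds (ltW r0).
have /andP[T1 T2] := truncn_div r1.
(* The last order may exceed [r] and then falls outside the Riemann sum; its single term is only of
   size r^(d+1). *)
rewrite big_nat_recr//=; set M := Num.truncn r in M1 M2 T1 T2 *.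
have := moment_part r0 (leq0n M) M1; rewrite mul0r.
set S := \sum_(0 <= m < M) _; set x := wkb_prim d _ => h.
have hx : `|wkb_prim d 1 - x| <= 1 / r.
  apply: (le_trans (prim_lip _ _ _)) => //; first by rewrite divr_ge0 ?(ltW r0).
  lra.
have nuM : order_nu M <= 2 * r.
  have := sg; rewrite /order_nu => /andP[_ s1]; lra.
have last0 : 0 <= order_nu M ^+ d * wkb (order_nu M) r.
  by rewrite mulr_ge0 ?exprn_ge0 ?wkb_ge0.
have last1 : order_nu M ^+ d * wkb (order_nu M) r <= 2 * r ^+ d.+1.
  rewrite exprSr mulrA; apply: ler_pM; rewrite ?exprn_ge0 ?wkb_ge0 ?wkb_le ?(ltW r0)//.
  by apply: nu_exp_le => //; exact: ltW.
have h2 : `|r ^+ d.+2 * (wkb_prim d 1 - x)| <= r ^+ d.+1.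
  rewrite normrM ger0_norm ?exprn_ge0 ?(ltW r0)// exprSr -mulrA ler_piMr ?exprn_ge0 ?(ltW r0)//.
  by rewrite -ler_pdivlMl// mulr1 -[X in _ <= X]mul1r.
rewrite /I; set a := r ^+ d.+2 in h h2 *; set b := r ^+ d.+1 in h h2 last1 *.
set l := _ ^+ d * _ in last0 last1 *.
have -> : S + l - (wkb_prim d 1 - wkb_prim d 0) * a =
  (S - a * (x - wkb_prim d 0)) + l - a * (wkb_prim d 1 - x) by ring.
apply: (le_trans (ler_normB _ _)).
have : `|S - a * (x - wkb_prim d 0) + l| <= 3 * b + 2 * b.
  by apply: (le_trans (ler_normD _ _)); rewrite lerD// ger0_norm.
lra.
Qed.

(** An error [E] per order costs O(r^(d+1) E) in total, negligible against r^(d+2) for E = O(ln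
    r). *)
Let weight_sum (E r : R) (M1 M2 : nat) : 0 <= E -> 1 <= r ->
  (M2 <= (Num.truncn r).+1)%N ->
  \sum_(M1 <= m < M2) 2 * order_nu m ^+ d * E <= 8 * r ^+ d.+1 * E.
Proof.
move=> E0 r1 hM; have r0 : 0 < r by exact: lt_le_trans r1.
have /andP[T1 T2] := truncn_bounds (ltW r0).
apply: (@le_trans _ _ (\sum_(M1 <= m < M2) 4 * r ^+ d * E)).
  apply: ler_sum_nat => m /andP[_ mM]; apply: ler_wpM2r => //.
  have : order_nu m ^+ d <= 2 * r ^+ d; last by lra.
  apply: nu_exp_le; first exact: ltW.
  have := sg; rewrite /order_nu => /andP[_ s1].
  have : m%:R <= (Num.truncn r)%:R :> R by rewrite ler_nat -ltnS (leq_trans mM).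
  lra.
rewrite sumr_const_nat -[leLHS]mulr_natl.
have -> : 8 * r ^+ d.+1 * E = (2 * r) * (4 * r ^+ d * E) by rewrite exprS; ring.
apply: ler_wpM2r; first by rewrite !mulr_ge0 ?exprn_ge0// ltW.
apply: (@le_trans _ _ (Num.truncn r).+1%:R); last by rewrite -natr1; lra.
by rewrite ler_nat (leq_trans (leq_subr _ _)).
Qed.

Lemma upper_sum n K e : 0 < n < 1 -> 0 <= K -> 0 < e ->
  exists2 r0, 1 <= r0 & forall r, r0 <= r ->
  \sum_(0 <= m < (Num.truncn r).+1) 2 * order_nu m ^+ d *
     ((wkb (order_nu m) r - wkb (order_nu m) (n * r) + 2 * (K + ln r)) / pi)
  <= (2 / pi * (I * (1 - n ^+ d.+2)) + e) * r ^+ d.+2.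
Proof.
move=> /andP[n0 n1] K0 e0.
(* The remainders add up to at most 16 r^(d+1) (3 + K + ln r), and pi >= 2: hence the share
   [e / 8]. *)
have [r1 r1ge1 hr1] := linear_dominates_ln (3 + K) (divr_gt0 e0 (ltr0Sn R 7)).
exists (Num.max r1 n^-1); first by rewrite le_max r1ge1.
move=> r; rewrite ge_max => /andP[r1r rn].
have rge1 : 1 <= r by exact: le_trans r1r.
have r0 : 0 < r by exact: lt_le_trans rge1.
have nr1 : 1 <= n * r by rewrite mulrC -ler_pdivrMr// div1r.
have nr0 : 0 < n * r by exact: mulr_gt0.
have lnr : 0 <= K + ln r by rewrite addr_ge0// ln_ge0.
have hM : ((Num.truncn (n * r)).+1 <= (Num.truncn r).+1)%N.
  by rewrite ltnS le_truncn// ger_pMl// ltW.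
have := wkb_sum rge1; have := wkb_sum nr1.
have := weight_sum 0 lnr rge1 (leqnn _).
set S := \sum_(0 <= m < _) 2 * _ ^+ d * _.
set A := \sum_(0 <= m < (Num.truncn (n * r)).+1) _.
set B := \sum_(0 <= m < (Num.truncn r).+1) _ => hS hA hB.
pose C := \sum_(0 <= m < (Num.truncn r).+1) order_nu m ^+ d * wkb (order_nu m) (n * r).
have AC : A <= C.
  rewrite /C (@big_cat_nat _ _ _ (Num.truncn (n * r)).+1)//= -/A lerDl; apply: sumr_ge0 => m _.
  by rewrite mulr_ge0 ?exprn_ge0 ?wkb_ge0.
have -> : \sum_(0 <= m < (Num.truncn r).+1) 2 * order_nu m ^+ d *
     ((wkb (order_nu m) r - wkb (order_nu m) (n * r) + 2 * (K + ln r)) / pi) =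
     (2 * (B - C) + 2 * S) / pi.
  rewrite /B /C /S -sumrB !big_distrr -big_split /= big_distrl /=.
  by apply: eq_bigr => m _; ring.
have p2 := pi_ge2 R; have p0 := pi_gt0 R.
rewrite ler_pdivrMr//.
move: hA hB hS; rewrite !exprMn !ler_norml.
have n1d : n ^+ d.+1 <= 1 by rewrite exprn_ile1 ?ltW.
have n0d : 0 <= n ^+ d.+1 by rewrite exprn_ge0 ?ltW.
have rd0 : 0 < r ^+ d.+1 by exact: exprn_gt0.
set a := r ^+ d.+2; set b := r ^+ d.+1 in rd0 *; set nd := n ^+ d.+2.
set nb := n ^+ d.+1 in n1d n0d *.
move=> /andP[hA _] /andP[_ hB] hS.
have hb : nb * b <= b by rewrite ler_piMl// ltW.
have hab : a = r * b by rewrite /a exprS.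
have hKr : b * (3 + K + ln r) <= b * (e / 8 * r) by rewrite ler_pM2l// hr1.
have -> : (2 / pi * (I * (1 - nd)) + e) * a * pi = 2 * I * (1 - nd) * a + e * a * pi.
  have h : (pi : R) != 0 by rewrite gt_eqF.
  by move: (pi) h => P h; field.
have : e * a * 2 <= e * a * pi by rewrite ler_pM2l// mulr_gt0// exprn_gt0.
have -> : e * a * 2 = 16 * (b * (e / 8 * r)) by rewrite hab; field.
move: AC hA hB hS hKr hb; move: (C) (A) (B) (S) (b * (e / 8 * r)) (e * a * pi) => C1 A1 B1 S1 x y.
nra.
Qed.

(** For nu <= n r the minimum is nu / n and the WKB phase there is (nu / n) [wkb_profile n]; the sum
    of nu^(d+1) over these orders gives the term with n^(d+1) / (d+2). For nu >= n r the minimum is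
    r, which gives the integral of [wkb_moment d] over [n, 1]. *)
Lemma lower_sum n K e (M0 : nat) : 0 < n < 1 -> 0 <= K -> 0 < e -> (0 < M0)%N ->
  exists2 r0, 1 <= r0 & forall r, r0 <= r ->
  (2 / pi * (wkb_profile n * n ^+ d.+1 / d.+2%:R + (wkb_prim d 1 - wkb_prim d n)) - e)
    * r ^+ d.+2 <=
  \sum_(M0 <= m < Num.truncn r) 2 * order_nu m ^+ d *
     ((wkb (order_nu m) (Num.min r (order_nu m / n)) - (K + ln r)) / pi - 2).
Proof.
move=> /andP[n0 n1] K0 e0 M00.
set g := wkb_profile n.
have /andP[g0 g1] : 0 <= g <= 1 by apply: wkb_profile_bounds; rewrite !ltW.
(* In [6 + M0], the Riemann sum and the truncation of [n * r] account for 3 each, and [M0] for the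
   omitted orders; 5 is 3 for the second Riemann sum plus 2 for its ends. *)
pose c1 : R := (6 + M0%:R) / n + 5.
have [r1 r1ge1 hr1] := linear_dominates_ln (c1 + K + 2) (divr_gt0 e0 (ltr0Sn R 15)).
exists (Num.max r1 (Num.max ((M0%:R + 1) / n) (2 / (1 - n)))); first by rewrite le_max r1ge1.
move=> r; rewrite !ge_max => /and3P[r1r rM0 rn].
have rge1 : 1 <= r by exact: le_trans r1r.
have r0 : 0 < r by exact: lt_le_trans rge1.
have nr0 : 0 < n * r by exact: mulr_gt0.
have lnr : 0 <= K + ln r by rewrite addr_ge0// ln_ge0.
have /andP[T1 T2] := truncn_bounds (ltW r0).
have /andP[T1' T2'] := truncn_bounds (ltW nr0).
have hM0 : M0%:R + 1 <= n * r by move: rM0; rewrite ler_pdivrMr// (mulrC r).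
have hn2 : 2 <= r - n * r.
  by move: rn; rewrite ler_pdivrMr ?subr_gt0// mulrBr mulr1 (mulrC r n).
set M := Num.truncn r in T1 T2 *; set M' := Num.truncn (n * r) in T1' T2'.
have M0M' : (M0 <= M')%N.
  by rewrite -ltnS -(ltr_nat R) -natr1; lra.
have M'M : (M'.+1 <= M)%N.
  by rewrite -ltnS -(ltr_nat R) -!natr1; lra.
have M'r : M'%:R <= r by apply: le_trans T1 => //; rewrite ler_nat ltnW.
pose F m := order_nu m ^+ d * wkb (order_nu m) (Num.min r (order_nu m / n)).
pose E := (K + ln r + 2 * pi).
have p2 := pi_ge2 R; have p0 := pi_gt0 R.
have -> : \sum_(M0 <= m < M) 2 * order_nu m ^+ d *
     ((wkb (order_nu m) (Num.min r (order_nu m / n)) - (K + ln r)) / pi - 2) =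
     (2 * \sum_(M0 <= m < M) F m - \sum_(M0 <= m < M) 2 * order_nu m ^+ d * E) / pi.
  rewrite big_distrr -sumrB big_distrl /=; apply: eq_bigr => m _; rewrite /F /E.
  have h : (pi : R) != 0 by rewrite gt_eqF.
  by move: (pi) h => P h; field.
have F0 m : 0 <= F m by rewrite mulr_ge0 ?exprn_ge0 ?wkb_ge0.
(* Order [M'] may lie on either side of n r; its nonnegative term is dropped. *)
have hF : \sum_(M0 <= m < M') F m + \sum_(M'.+1 <= m < M) F m <= \sum_(M0 <= m < M) F m.
  rewrite (@big_cat_nat _ _ _ M' M0 M _ _ M0M' (ltnW M'M))/=.
  by rewrite lerD2l (@big_ltn _ _ _ M')// lerDr.
have F1 : r ^+ d.+1 * (r * (g * n ^+ d.+1 / d.+2%:R) - (6 + M0%:R) / n) <=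
    \sum_(M0 <= m < M') F m.
  have -> : \sum_(M0 <= m < M') F m = g / n * r ^+ d.+1 *
      \sum_(M0 <= m < M') ((m%:R + d%:R / 2) / r) ^+ d.+1.
    rewrite big_distrr /=; apply: eq_big_nat => m /andP[M0m mM'].
    rewrite /F.
    have nu0 : 0 < order_nu m.
      by apply: lt_le_trans (nu_ge m); rewrite ltr0n (leq_trans M00).
    have hnu : order_nu m / n <= r.
      rewrite ler_pdivrMr// mulrC; apply: le_trans T1'; exact/ltW/nu_lt.
    rewrite min_r// /wkb ltr_pdivlMr// gtr_pMr// n1.
    have -> : order_nu m / (order_nu m / n) = n.
      by field; rewrite gt_eqF// gt_eqF.
    rewrite -/g -/(order_nu m) expr_div_n (exprSr (order_nu m)).
    have := expf_neq0 d.+1 (lt0r_neq0 r0); set a := r ^+ d.+1 => a0.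
    by field; rewrite a0 gt_eqF.
  have hk : (0 < d.+1 <= 2)%N by apply/andP; split.
  have := riemann_sum (exprn_primitive (R := R) hk) _ r0 M0M' M'r (sigma := d%:R / 2).
  have -> : 0 <= (d%:R / 2 : R) <= 1 by case/andP: sg => -> h; lra.
  move=> /(_ isT); set S := \sum_(M0 <= m < M') _.
  have a1 : `|n ^+ d.+2 - (M'%:R / r) ^+ d.+2| <= 3 / r.
    have M'n : M'%:R / r <= n by rewrite ler_pdivrMr.
    apply: (le_trans (exprn_lip _ _ M'n _)); rewrite ?divr_ge0 ?(ltW r0) ?(ltW n1)//.
    rewrite ler_pM2l// lerBlDr -{1}[r^-1]mul1r -mulrDl ler_pdivlMr//; lra.
  have a2 : (M0%:R / r) ^+ d.+2 <= M0%:R / r.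
    have b0 : 0 <= M0%:R / r by rewrite divr_ge0 ?(ltW r0).
    have b1 : M0%:R / r <= 1 by rewrite ler_pdivrMr// mul1r; lra.
    by rewrite exprS ler_piMr// exprn_ile1.
  have k1 : 1 <= d.+2%:R :> R by rewrite ler1n.
  have k0 : 0 < d.+2%:R :> R by exact: lt_le_trans k1.
  rewrite -mulrBl ler_norml => /andP[h _].
  have hS : r * n ^+ d.+2 / d.+2%:R - (6 + M0%:R) <= S.
    move: a1; rewrite ler_norml => /andP[_ a1].
    have : r * ((n ^+ d.+2 - 3 / r - M0%:R / r) / d.+2%:R) <=
       r * (((M'%:R / r) ^+ d.+2 - (M0%:R / r) ^+ d.+2) / d.+2%:R).
      by rewrite ler_pM2l// ler_pM2r ?invr_gt0//; lra.
    have -> : r * ((n ^+ d.+2 - 3 / r - M0%:R / r) / d.+2%:R) =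
       r * n ^+ d.+2 / d.+2%:R - (3 + M0%:R) / d.+2%:R.
      by move: k0; move: (d.+2%:R : R) => k k0; field; rewrite !gt_eqF.
    have : (3 + M0%:R) / d.+2%:R <= 3 + M0%:R :> R.
      by rewrite ler_pdivrMr// ler_peMr// addr_ge0.
    move: h; set X := r * (_ / _); set Y := r * _ / _; set Z := (3 + _) / _; lra.
  have b0 : 0 <= r ^+ d.+1 by rewrite exprn_ge0// ltW.
  rewrite [leRHS](_ : _ = r ^+ d.+1 * (g / n * S)); last by ring.
  apply: ler_wpM2l => //.
  have gn0 : 0 <= g / n by rewrite divr_ge0// ltW.
  apply: le_trans (ler_wpM2l gn0 hS).
  have -> : g / n * (r * n ^+ d.+2 / d.+2%:R - (6 + M0%:R)) =
      r * (g * n ^+ d.+1 / d.+2%:R) - g * ((6 + M0%:R) / n).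
    rewrite (exprS n d.+1); move: k0; move: (d.+2%:R : R) (n ^+ d.+1) => k x k0.
    by field; rewrite !gt_eqF.
  by rewrite lerD2l lerN2 ler_piMl// divr_ge0 ?addr_ge0// ltW.
have F2 : r ^+ d.+1 * (r * (wkb_prim d 1 - wkb_prim d n) - 5) <=
    \sum_(M'.+1 <= m < M) F m.
  have -> : \sum_(M'.+1 <= m < M) F m =
      \sum_(M'.+1 <= m < M) order_nu m ^+ d * wkb (order_nu m) r.
    apply: eq_big_nat => m /andP[mM' _]; rewrite /F min_l// ler_pdivlMr//.
    rewrite mulrC ltW// (lt_le_trans T2')//; apply: le_trans (nu_ge m).
    by rewrite natr1 ler_nat.
  have := moment_part r0 M'M T1; rewrite ler_norml => /andP[h _].
  have /andP[t1 t2] := truncn_div rge1; rewrite -/M in t1 t2.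
  have := prim_lip (divr_ge0 (ler0n R M) (ltW r0)) t2 (lexx 1).
  rewrite ler_norml => /andP[_ h1].
  have n1' : n <= M'.+1%:R / r by rewrite ler_pdivlMr// -natr1 ltW.
  have n2 : M'.+1%:R / r <= 1.
    by rewrite ler_pdivrMr// mul1r; apply: le_trans T1; rewrite ler_nat.
  have n3 : M'.+1%:R / r <= n + 1 / r.
    by rewrite -(ler_pM2r r0) mulrDl !divfK ?gt_eqF// -natr1; lra.
  have := prim_lip (ltW n0) n1' n2; rewrite ler_norml => /andP[_ h2].
  have b0 : 0 < r ^+ d.+1 by exact: exprn_gt0.
  have : r ^+ d.+2 * (wkb_prim d 1 - wkb_prim d n - 2 / r) <=
    r ^+ d.+2 * (wkb_prim d (M%:R / r) - wkb_prim d (M'.+1%:R / r)).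
    by rewrite ler_pM2l ?exprn_gt0//; lra.
  have -> : r ^+ d.+2 * (wkb_prim d 1 - wkb_prim d n - 2 / r) =
     r ^+ d.+1 * (r * (wkb_prim d 1 - wkb_prim d n) - 2).
    by rewrite (exprS r d.+1); field; rewrite gt_eqF.
  lra.
have hE : \sum_(M0 <= m < M) 2 * order_nu m ^+ d * E <= 8 * r ^+ d.+1 * E.
  by apply: weight_sum => //; rewrite /E; lra.
rewrite ler_pdivlMr//.
set J := _ / _ + (_ - _) in F1 F2 *.
have b0 : 0 < r ^+ d.+1 by exact: exprn_gt0.
have -> : (2 / pi * J - e) * r ^+ d.+2 * pi = 2 * J * r ^+ d.+2 - e * r ^+ d.+2 * pi.
  have h : (pi : R) != 0 by rewrite gt_eqF.
  by move: (pi) h => P h; field.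
have hJ : r ^+ d.+1 * (r * J - c1) <= \sum_(M0 <= m < M) F m.
  apply: le_trans hF; apply: le_trans (lerD F1 F2).
  rewrite -mulrDr ler_pM2l// /J /c1; set A := g * _ / _; set C := (6 + _) / n; lra.
have hKr : r ^+ d.+1 * (c1 + K + 2 + ln r) <= r ^+ d.+1 * (e / 16 * r).
  by rewrite ler_pM2l// hr1.
have c10 : 0 <= c1 by rewrite /c1 addr_ge0// divr_ge0 ?addr_ge0// ltW.
have hp : 2 * (r ^+ d.+1 * (c1 + (K + ln r))) <= pi * (r ^+ d.+1 * (c1 + (K + ln r))).
  by rewrite ler_wpM2r// mulr_ge0 ?(ltW b0)// addr_ge0.
have hq : pi * (r ^+ d.+1 * (c1 + K + 2 + ln r)) <= pi * (r ^+ d.+1 * (e / 16 * r)).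
  by rewrite ler_pM2l.
move: hE hJ hq hp; rewrite /E (exprS r d.+1).
set b := r ^+ d.+1 in b0 *.
have bc : 0 <= b * (c1 + (K + ln r)) by rewrite mulr_ge0 ?(ltW b0)// addr_ge0.
have bc1 : 0 <= b * c1 by rewrite mulr_ge0// ltW.
have bp : 0 <= b * pi by rewrite mulr_ge0// ltW.
move: bc bp; move: (pi : R) (ln r) => P l; lra.
Qed.

End AsymptoticSums.

(** * Radial factors and their decay towards the origin *)

Section RadialFunctions.
Context {R : realType}.
Implicit Types (f : R -> R) (x n : R) (m d q : nat).

(* With q = 2 m + d this covers J_m (d = 0) and the spherical j_m (d = 1). *)
Definition bessel_multiple f m d := exists2 C : R, 0 < C &
  forall x, f x = C * x ^+ m * bessA (2 * m + d) x.

Let bessel_multiple_series f m d (a : nat -> R) (C : R) : 0 < C ->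
  (forall x, f x = limn (series (fun j => a j * x ^+ (2 * j + m)))) ->
  (forall j, a j = C * bess_coeff (2 * m + d) j) -> bessel_multiple f m d.
Proof.
move=> C0 hf ha; exists C => // x.
rewrite hf; apply/cvg_lim => //.
have h := @cvg_pseries_fact _ _ (x ^+ 2) (@bess_coeff_fact R (2 * m + d)).
have -> : series (fun j => a j * x ^+ (2 * j + m)) =
    (fun k => C * x ^+ m * pseries (bess_coeff (2 * m + d)) (x ^+ 2) k).
  apply/funext => k; rewrite /pseries /series /= big_distrr /=.
  by apply: eq_bigr => j _; rewrite ha exprD exprM; ring.
by apply: cvgM; [exact: cvg_cst|exact: h].
Qed.

Let coeff_ratio q j : bess_coeff q j.+1 = - bess_coeff q j / (2 * j.+1 * (2 * j.+1 + q))%:R :> R.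
Proof.
rewrite -bess_coeffS mulrC mulKf// pnatr_eq0; lia.
Qed.

Lemma besselJ_multiple m : bessel_multiple (@besselJ R m) m 0.
Proof.
pose a j : R := (-1) ^+ j / (j`! * (j + m)`!)%:R / 2 ^+ (2 * j + m).
apply: (@bessel_multiple_series _ _ _ a ((m`!)%:R^-1 / 2 ^+ m)).
- by rewrite divr_gt0 ?invr_gt0 ?exprn_gt0 ?ltr0n ?fact_gt0.
- move=> x; rewrite /besselJ; congr (limn (series _)); apply/funext => j.
  by rewrite /a expr_div_n; ring.
elim=> [|j IH].
  by rewrite /a /bess_coeff big_ord0 muln0 !add0n fact0 mul1n !expr0 !mul1r invr1 mulr1.
rewrite coeff_ratio mulNr mulrN mulrA -IH /a.
have F k : k`!%:R != 0 :> R by rewrite pnatr_eq0 -lt0n fact_gt0.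
have e1 : (2 * j.+1 + m = (2 * j + m).+2)%N by lia.
have e2 : (2 * j.+1 * (2 * j.+1 + (2 * m + 0)) = 4 * (j.+1 * (j + m).+1))%N by nia.
rewrite e1 e2 addSn !factS !natrM exprS [2 ^+ _.+2]exprS [2 ^+ _.+1]exprS.
have P : 2 ^+ (2 * j + m) != 0 :> R by rewrite expf_neq0.
have := F j; have := F (j + m)%N; move: P.
set x := j`!%:R; set y := (j+m)`!%:R; set z := 2 ^+ _; set e := (-1) ^+ j.
have : j.+1%:R != 0 :> R by []. have : (j + m).+1%:R != 0 :> R by [].
move: (j.+1%:R : R) ((j + m).+1%:R : R) => u v u0 v0 z0 y0 x0.
by field; rewrite x0 y0 z0 u0 v0.
Qed.

Lemma sphBesselJ_multiple m : bessel_multiple (@sphBesselJ R m) m 1.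
Proof.
pose a j : R := (-1) ^+ j / (2 ^ j * j`! * \prod_(i < (m + j).+1) (2 * i + 1))%:R.
have prod_gt0 k : (0 < \prod_(i < k) (2 * i + 1))%N.
  by apply: prodn_gt0 => i; rewrite addn1.
apply: (@bessel_multiple_series _ _ _ a ((\prod_(i < m.+1) (2 * i + 1))%:R^-1)) => //.
  by rewrite invr_gt0 ltr0n.
elim=> [|j IH].
  by rewrite /a /bess_coeff big_ord0 addn0 expn0 fact0 !mul1n !expr0 !mul1r invr1 mulr1.
rewrite coeff_ratio mulNr mulrN mulrA -IH /a.
have F k : k`!%:R != 0 :> R by rewrite pnatr_eq0 -lt0n fact_gt0.
rewrite addnS big_ord_recr /= expnS factS !natrM exprS.
have -> : (2 * j.+1 + (2 * m + 1))%:R = (2 * (m + j).+1 + 1)%:R :> R.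
  by congr _%:R; lia.
have P : (2 ^ j)%:R != 0 :> R by rewrite pnatr_eq0 expn_eq0.
have Q : (\prod_(i < (m + j).+1) (2 * i + 1))%:R != 0 :> R by rewrite pnatr_eq0 -lt0n.
have := F j; move: P Q.
set x := j`!%:R; set y := (\prod_(i < _) _)%:R; set z := (2 ^ j)%:R; set e := (-1) ^+ j.
have : j.+1%:R != 0 :> R by []. have : (2 * (m + j).+1 + 1)%:R != 0 :> R by rewrite addn1.
move: (j.+1%:R : R) ((2 * (m + j).+1 + 1)%:R : R) => u v u0 v0 z0 y0 x0.
by field; rewrite x0 y0 z0 u0 v0.
Qed.

(* For x <= nu the logarithmic derivative of x^(2 nu) A^2 on [tau x, t x] is at least
   2 nu sqrt (1 - t^2) / (t x); t is the midpoint of [tau, 1]. *)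
Definition decay_rate (tau : R) : R :=
  let t := (1 + tau) / 2 in 2 * Num.sqrt (1 - t ^+ 2) * (t - tau) / t.

Lemma decay_rate_gt0 tau : 0 < tau < 1 -> 0 < decay_rate tau.
Proof.
move=> /andP[t0 t1]; rewrite /decay_rate; set t := (1 + tau) / 2.
have ht : tau < t by rewrite /t; lra.
have ht1 : t < 1 by rewrite /t; lra.
have ht0 : 0 < t by exact: lt_trans ht.
rewrite divr_gt0// mulr_gt0 ?subr_gt0// mulr_gt0// sqrtr_gt0 subr_gt0.
by rewrite expr_lt1// ltW.
Qed.

Section Fixed.
Variables (f : R -> R) (m d : nat).
Hypothesis hf : bessel_multiple f m d.
Hypothesis hd : (d <= 1)%N.
Let q := (2 * m + d)%N.
Let nu : R := q%:R / 2.

Let f' (C x : R) := C * (m%:R * x ^+ m.-1 * bessA q x + x ^+ m * (2 * x * bessD q x)).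

Let der_f C x : (forall x, f x = C * x ^+ m * bessA q x) -> is_derive x 1 f (f' C x).
Proof.
move=> hC; have hA := der_bessA q x.
have -> : f = (fun x => C * x ^+ m * bessA q x) by apply/funext.
by der; rewrite /f' /=; ring.
Qed.

Let xf' C x : x * f' C x = C * x ^+ m * (bessB q x - d%:R / 2 * bessA q x).
Proof.
have -> : bessB q x - d%:R / 2 * bessA q x = m%:R * bessA q x + 2 * x ^+ 2 * bessD q x.
  by rewrite /bessB /q natrD natrM; field.
rewrite /f'; case: m => [|k] /=; first by rewrite expr0; ring.
by rewrite (exprS x k); ring.
Qed.

Lemma bessel_multiple_derivable x : derivable f x 1.
Proof. by case: hf => C _ /der_f h; case: (h x). Qed.

Lemma bessel_multiple_cts : continuous f.
Proof. by case: hf => C _ /der_f h x; exact: der_continuous (h x). Qed.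

(** The radial factor is x^(-d/2) J_nu up to a constant, so x f' is a multiple of B - (d / 2) A; the
    extra term cancels in the cross product. *)
Lemma characteristicF_eq0 n x : 0 < n -> 0 < x -> characteristicF f n x = 0 <->
  bessA q x * bessB q (n * x) = bessA q (n * x) * bessB q x.
Proof.
move=> n0 x0; case: hf => C C0 hC.
have D y : derive1 f y = f' C y by rewrite derive1E; apply: derive_val; exact: der_f.
have e : x * characteristicF f n x = C ^+ 2 * x ^+ m * (n * x) ^+ m *
    (bessA q x * bessB q (n * x) - bessA q (n * x) * bessB q x).
  rewrite /characteristicF !D.
  transitivity (f x * ((n * x) * f' C (n * x)) - f (n * x) * (x * f' C x)); first by ring.
  by rewrite !xf' !hC; ring.
have k0 : C ^+ 2 * x ^+ m * (n * x) ^+ m != 0.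
  apply: mulf_neq0; [apply: mulf_neq0|]; apply: expf_neq0; rewrite gt_eqF//.
  exact: mulr_gt0.
split=> [h|h].
  move/eqP: e; rewrite h mulr0 eq_sym mulf_eq0 (negbTE k0) /= subr_eq0.
  by move/eqP.
by move: e; rewrite h subrr mulr0 => /eqP; rewrite mulf_eq0 gt_eqF//= => /eqP.
Qed.

(** Up to nu the phase lies in (0, pi / 2), so sine and cosine are both positive. *)
Let AB_gt0 x : 0 <= x <= nu -> 0 < nu -> 0 < bessA q x * bessB q x.
Proof.
move=> xnu nu0; have x0 : 0 <= x by case/andP: xnu.
rewrite bessA_phase// bessB_phase// mulrACA -expr2 mulr_gt0//.
  by rewrite lt_neqAle eq_sym sqrf_eq0 bessQ_neq0// sqr_ge0.
have /andP[p0 _] := phase0_bounds (R := R) q.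
have px : 0 < phase q x.
  move: x0; rewrite le_eqVlt => /predU1P[<-//|x0].
  exact/(lt_trans p0)/phase_incr.
have p1 : phase q x < pi / 2 by exact: phase_lt_pihalf.
rewrite mulr_gt0 ?sin_gt0_pihalf ?cos_gt0_pihalf ?px ?p1 ?andbT//.
by rewrite (lt_trans _ px)// oppr_lt0 divr_gt0 ?pi_gt0.
Qed.

Lemma bessel_multiple_neq0 x : 0 < x <= nu -> f x != 0.
Proof.
move=> /andP[x0 xnu]; case: hf => C C0 hC.
rewrite hC !mulf_neq0 ?expf_neq0 ?(gt_eqF C0) ?(gt_eqF x0)//.
have := @AB_gt0 x; rewrite (ltW x0) xnu => /(_ isT (lt_le_trans x0 xnu)).
by apply: contraTneq => ->; rewrite mul0r ltxx.
Qed.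

(** This keeps the coefficient of u nonzero. If A(x) = 0, the root condition gives A(n x) B(x) = 0;
    A(n x) is nonzero because n x <= nu, so A and B would vanish together at x. *)
Lemma bessel_multiple_charF_deriv n x : 0 < n -> 0 < x -> n * x <= nu ->
  characteristicF f n x = 0 -> f x != 0.
Proof.
move=> n0 x0 nxnu /(characteristicF_eq0 n0 x0) h.
have nx0 : 0 < n * x by exact: mulr_gt0.
have := @AB_gt0 (n * x); rewrite (ltW nx0) nxnu => /(_ isT (lt_le_trans nx0 nxnu)) ab.
case: hf => C C0 hC; rewrite hC !mulf_neq0 ?expf_neq0 ?(gt_eqF C0) ?(gt_eqF x0)//.
apply/eqP => A0; move: h; rewrite A0 mul0r => /esym/eqP; rewrite mulf_eq0.
case/orP => /eqP h; first by rewrite h mul0r ltxx in ab.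
by have := bess_rho2_gt0 q x; rewrite A0 h expr0n addr0 ltxx.
Qed.

(** The square of J_nu, up to a constant. *)
Let Psi x := x ^+ q * bessA q x ^+ 2.

Let der_Psi x : 0 < x ->
  is_derive x 1 Psi (2 * x ^+ q * (bessA q x * bessB q x) / x).
Proof.
move=> x0; have hA := der_bessA q x; rewrite /Psi; der.
apply: (mulIf (lt0r_neq0 x0)); rewrite divfK ?gt_eqF// /bessB /=.
case: q => [|k] /=; first by rewrite expr0; ring.
rewrite (exprS x k).
have -> : k.+1%:R = 2 * (k.+1%:R / 2) :> R by rewrite mulrC divfK.
by field.
Qed.

Let Psi_mono x y : 0 < x -> x <= y -> y <= nu -> Psi x <= Psi y.
Proof.
move=> x0 xy ynu.
apply: (der_nondecr xy (fun z h => der_Psi (lt_le_trans x0 (andP h).1))) => z /andP[xz zy].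
have z0 : 0 < z by exact: lt_trans xz.
have znu : z <= nu by exact: le_trans (ltW zy) ynu.
apply: divr_ge0; last exact: ltW.
apply: mulr_ge0; first by rewrite mulr_ge0// exprn_ge0// ltW.
by apply: ltW; apply: AB_gt0; [rewrite (ltW z0) znu|exact: lt_le_trans znu].
Qed.

(** At z <= t nu, W > 0 yields B^2 >= nu^2 (1 - t^2) A^2, hence Psi' >= 2 nu sqrt (1 - t^2) Psi / z.
    The mean value theorem on [tau x, t x] and the growth of [Psi] up to nu do the rest. *)
Let Psi_decay tau x : 0 < tau < 1 -> 0 < x <= nu ->
  (1 + nu * decay_rate tau) * Psi (tau * x) <= Psi x.
Proof.
move=> /andP[t0 t1] /andP[x0 xnu]; rewrite /decay_rate; set t := (1 + tau) / 2.
have ht : tau < t by rewrite /t; lra.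
have ht1 : t < 1 by rewrite /t; lra.
have ht0 : 0 < t by exact: lt_trans ht.
have tx0 : 0 < tau * x by exact: mulr_gt0.
have ttx : tau * x < t * x by rewrite ltr_pM2r.
have txx : t * x < x by rewrite gtr_pMl.
apply: (le_trans _ (Psi_mono (lt_trans tx0 ttx) (ltW txx) xnu)).
have [z /andP[z1 z2] e] := MVT_closed ttx
  (fun z h => der_Psi (lt_le_trans tx0 (andP h).1)).
have z0 : 0 < z by exact: lt_trans z1.
have znu : z < nu by rewrite (lt_trans z2)// (lt_le_trans txx).
have nu0 : 0 < nu by exact: lt_trans znu.
have AB : 0 < bessA q z * bessB q z by apply: AB_gt0; rewrite ?ltW.
set mu := Num.sqrt (1 - t ^+ 2).
have mu2 : mu ^+ 2 = 1 - t ^+ 2.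
  by rewrite sqr_sqrtr// subr_ge0 expr_le1// ltW.
have mu0 : 0 <= mu by exact: sqrtr_ge0.
have hAB : nu * mu * bessA q z ^+ 2 <= bessA q z * bessB q z.
  have l0 : 0 <= nu * mu * bessA q z ^+ 2.
    by apply: mulr_ge0; [rewrite mulr_ge0// ltW|exact: sqr_ge0].
  rewrite -ler_sqr ?nnegrE ?(ltW AB)//.
  rewrite [leLHS](_ : _ = nu ^+ 2 * mu ^+ 2 * bessA q z ^+ 2 * bessA q z ^+ 2); last by ring.
  rewrite [leRHS](_ : _ = bessB q z ^+ 2 * bessA q z ^+ 2); last by ring.
  rewrite mu2; apply: ler_wpM2r; first exact: sqr_ge0.
  have := bessW_gt0 q z0; rewrite /bessW -/nu => hW.
  have hz : z ^+ 2 <= t ^+ 2 * nu ^+ 2.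
    have tnu : 0 <= t * nu by rewrite mulr_ge0// ltW.
    rewrite -exprMn ler_sqr ?nnegrE ?(ltW z0)//.
    by apply: ltW; apply: (lt_le_trans z2); rewrite ler_pM2l.
  have := sqr_ge0 (bessA q z); nra.
have PsiE : Psi (t * x) = Psi (tau * x) +
    2 * z ^+ q * (bessA q z * bessB q z) / z * (t * x - tau * x).
  by rewrite -e addrC subrK.
rewrite PsiE mulrDl mul1r lerD2l.
have P0 y : 0 < y -> 0 <= Psi y.
  by move=> y0; apply: mulr_ge0; [exact/exprn_ge0/ltW|exact: sqr_ge0].
have h1 : 2 * (nu * mu) * Psi (tau * x) / (t * x) <=
    2 * z ^+ q * (bessA q z * bessB q z) / z.
  apply: (@le_trans _ _ (2 * (nu * mu) * Psi z / z)).
    have nm : 0 <= 2 * (nu * mu) by rewrite !mulr_ge0 ?(ltW nu0).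
    apply: ler_pM.
    - exact: mulr_ge0 nm (P0 _ tx0).
    - by rewrite invr_ge0 ltW// mulr_gt0.
    - by apply: ler_wpM2l => //; apply: Psi_mono => //; exact: ltW.
    - by rewrite lef_pV2 ?posrE ?(mulr_gt0 ht0 x0) ?(ltW z2).
  rewrite ler_pM2r ?invr_gt0//.
  have -> : 2 * (nu * mu) * Psi z = 2 * z ^+ q * (nu * mu * bessA q z ^+ 2).
    by rewrite /Psi; ring.
  by rewrite ler_pM2l// mulr_gt0// exprn_gt0.
apply: (le_trans _ (ler_wpM2r _ h1)); last by rewrite subr_ge0 ltW.
rewrite le_eqVlt; apply/orP; left; apply/eqP.
by field; rewrite !gt_eqF.
Qed.

(** Since f^2 is a multiple of Psi / x^d, the dilation also brings in tau^(-d); the leading factor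
    [tau] compensates it for d <= 1. At x = 0 the left-hand side vanishes because m > 0. *)
Lemma bessel_multiple_decay tau x : (0 < m)%N -> 0 < tau < 1 -> 0 <= x <= nu ->
  tau * (1 + nu * decay_rate tau) * f (tau * x) ^+ 2 <= f x ^+ 2.
Proof.
move=> m0 ht /andP[x0 xnu]; case: hf => C C0 hC.
have /andP[t0 t1] := ht.
move: x0; rewrite le_eqVlt => /predU1P[<-|x0].
  rewrite !hC mulr0 expr0n (gtn_eqF m0) !mulr0 !mul0r expr0n /= mulr0//.
have fE y : 0 < y -> f y ^+ 2 = C ^+ 2 * Psi y / y ^+ d.
  move=> y0; rewrite hC /Psi /q exprD mulnC exprM !exprMn; field.
  by rewrite expf_neq0// gt_eqF.
rewrite !fE ?mulr_gt0//.
have hPsi := @Psi_decay tau x ht; rewrite x0 xnu in hPsi.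
have {}hPsi := hPsi isT.
have xd : 0 < x ^+ d by exact: exprn_gt0.
have td : 0 < tau ^+ d by exact: exprn_gt0.
rewrite exprMn.
have -> : tau * (1 + nu * decay_rate tau) * (C ^+ 2 * Psi (tau * x) / (tau ^+ d * x ^+ d)) =
  (tau / tau ^+ d) * (C ^+ 2 * ((1 + nu * decay_rate tau) * Psi (tau * x)) / x ^+ d).
  by field; rewrite !gt_eqF.
have h1 : C ^+ 2 * ((1 + nu * decay_rate tau) * Psi (tau * x)) / x ^+ d <=
   C ^+ 2 * Psi x / x ^+ d.
  by rewrite ler_pM2r ?invr_gt0// ler_pM2l ?exprn_gt0.
apply: le_trans h1; rewrite ler_piMl//.
  have nu0 : 0 <= nu by exact: le_trans (ltW x0) xnu.
  apply: divr_ge0; last exact: ltW.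
  apply: mulr_ge0; first exact: sqr_ge0.
  apply: mulr_ge0.
    by rewrite addr_ge0// mulr_ge0// ltW// decay_rate_gt0.
  by apply: mulr_ge0; [apply/exprn_ge0/ltW; exact: mulr_gt0|exact: sqr_ge0].
rewrite ler_pdivrMr// mul1r.
by case: d hd => [|[|//]] _; rewrite ?expr0 ?expr1// ltW.
Qed.

End Fixed.
End RadialFunctions.

Section CountingLemmas.
Context {R : realType} {T : choiceType}.

Lemma counting_le (A : set T) (s : seq T) : (forall x, A x -> x \in s) ->
  (counting A <= (size s)%:R%:E :> \bar R)%E.
Proof.
move=> sA; have fA : finite_set A.
  by apply: (@sub_finite_set _ _ [set` s]) => //; exact: finite_seq.
rewrite /counting asboolT// lee_fin ler_nat.
apply: (@leq_trans (size (undup s))); last exact: size_undup.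
apply: uniq_leq_size; first exact: finmap.fset_uniq.
move=> x xA; rewrite mem_undup; apply: sA.
by move: xA; rewrite in_fset_set// inE.
Qed.

Lemma counting_ge (A : set T) (s : seq T) : uniq s -> (forall x, x \in s -> A x) ->
  ((size s)%:R%:E <= counting A :> \bar R)%E.
Proof.
move=> us sA; rewrite /counting; case: asboolP => [fA|_]; last by rewrite leey.
rewrite lee_fin ler_nat; apply: uniq_leq_size => // x xs.
by rewrite in_fset_set// inE; exact: sA.
Qed.

Lemma uniq_flatten_key (key : T -> nat) (F : nat -> seq T) (ms : seq nat) :
  uniq ms -> (forall m, m \in ms -> uniq (F m)) ->
  (forall m x, m \in ms -> x \in F m -> key x = m) -> uniq (flatten (map F ms)).
Proof.
elim: ms => //= m ms IH /andP[mms ums] uF kF; rewrite cat_uniq uF ?mem_head//=.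
rewrite IH// ?andbT; first last.
- by move=> k x kms; apply: kF; rewrite inE kms orbT.
- by move=> k kms; apply: uF; rewrite inE kms orbT.
apply/hasPn => x /flattenP[s /mapP[k kms ->] xk]; apply/negP => /= xm.
have := kF k x; rewrite inE kms orbT => /(_ isT xk) e1.
by move: mms; rewrite -(kF m x _ xm) ?mem_head// e1 kms.
Qed.

End CountingLemmas.

Section LiminfLemmas.
Context {R : realType}.

Lemma lee_ratio (x y : R) (u v : \bar R) : 0 < x -> 0 < y ->
  (x%:E <= u -> 0 <= v -> v <= y%:E -> (x / y)%:E <= u / v)%E.
Proof.
move=> x0 y0 xu v0 vy; rewrite EFinM; apply: lee_pmul => //.
- by rewrite lee_fin ltW.
- by rewrite lee_fin invr_ge0 ltW.
have -> : (y^-1)%:E = (y%:E)^-1%E by rewrite inver gt_eqF.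
by rewrite lee_pV2// inE//= lee_fin ltW.
Qed.

Lemma liminf_ge (f : R -> \bar R) (c : R) :
  (forall e, 0 < e -> exists r0, forall r, r0 <= r -> ((c - e)%:E <= f r)%E) ->
  (c%:E <= limf_einf f (pinfty_nbhs R))%E.
Proof.
move=> h; apply/lee_addgt0Pr => e e0; have [r0 hr] := h e e0.
rewrite -leeBlDr// -EFinB limf_einfE.
apply: ereal_sup_ge; exists (ereal_inf (f @` [set r | r0 <= r])).
  exists [set r | r0 <= r] => //; exists r0; split; first exact: num_real.
  by move=> x /ltW.
by apply: le_ereal_inf_tmp => _ [r rr <-]; exact: hr.
Qed.

End LiminfLemmas.

Section LevelRoots.
Context {R : realType}.
Variables (n : R) (q : nat).
Hypothesis hn : 0 < n < 1.
Implicit Types (x k : R) (j : nat).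

(** The root is named by its level, so that roots can be listed. If the level is never attained the
    value is 0, which is not a wave number. *)
Definition level_root j : R := xget 0 [set k | 0 < k /\ phase_diff q n k = pi * j%:R].

Lemma phase_diff_level_inj j x y : 0 < x -> 0 < y ->
  phase_diff q n x = pi * j%:R -> phase_diff q n y = pi * j%:R -> x = y.
Proof.
move=> x0 y0 hx hy; have [xy|yx|//] := ltgtP x y.
  by have := phase_diff_level_strict hn x0 xy hx; rewrite hy ltxx.
by have := phase_diff_level_strict hn y0 yx hy; rewrite hx ltxx.
Qed.

Lemma level_rootE j k : 0 < k -> phase_diff q n k = pi * j%:R -> level_root j = k.
Proof.
move=> k0 hk; rewrite /level_root; case: xgetP => [x _ [x0 hx]|/(_ k)[]//].
exact: phase_diff_level_inj hx hk.
Qed.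

Lemma level_rootP j x : (0 < j)%N -> 0 < x -> pi * j%:R < phase_diff q n x ->
  0 < level_root j < x /\ phase_diff q n (level_root j) = pi * j%:R.
Proof.
move=> j0 x0 hx; have [y /andP[y0 yx] hy] := phase_diff_level_exists hn j0 x0 hx.
by rewrite (level_rootE y0 hy) y0 yx.
Qed.

Definition levels x := Num.truncn (phase_diff q n x / pi).

Lemma levels_le x : 0 < x -> (levels x)%:R <= phase_diff q n x / pi.
Proof.
by move=> x0; rewrite truncn_le divr_ge0 ?pi_ge0// ltW// phase_diff_gt0.
Qed.

Lemma levels_gt x : 0 < x -> phase_diff q n x / pi < (levels x)%:R + 1.
Proof.
move=> x0; have /truncn_itv/andP[_] : 0 <= phase_diff q n x / pi.
  by rewrite divr_ge0 ?pi_ge0// ltW// phase_diff_gt0.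
by rewrite natr1.
Qed.

Lemma level_le j k x : 0 < k -> k < x -> phase_diff q n k = pi * j%:R ->
  (j <= levels x)%N.
Proof.
move=> k0 kx hk; have x0 : 0 < x by exact: lt_trans kx.
rewrite -ltnS -(ltr_nat R) -natr1; apply: lt_trans (levels_gt x0).
rewrite ltr_pdivlMr ?pi_gt0// mulrC.
exact: (phase_diff_level_strict hn k0 kx hk).
Qed.

Lemma level_lt j x : 0 < x -> (j <= (levels x).-1)%N -> (0 < j)%N ->
  pi * j%:R < phase_diff q n x.
Proof.
move=> x0 jl j0; rewrite mulrC -ltr_pdivlMr ?pi_gt0//; apply: lt_le_trans (levels_le x0).
by rewrite ltr_nat; case: (levels x) jl j0 => [|l] //=; case: j.
Qed.

End LevelRoots.

(** * Counting modes, for the disc and the ball at once *)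

Section ModeCounting.
Context {R : realType} {T I : choiceType}.
Variables (n : R) (d : nat) (f : nat -> R -> R).
Variables (mk : R -> I -> T) (kp : T -> R) (ip : T -> I).
Variables (ord : I -> nat) (idx : nat -> seq I).
Variables (modes localized : set T) (M0 : nat).
Hypotheses (hn : 0 < n < 1) (hd : (d <= 1)%N).
Hypothesis hf : forall m, bessel_multiple (f m) m d.
Hypotheses (mkK : forall p, mk (kp p) (ip p) = p)
  (kpK : forall k i, kp (mk k i) = k) (ipK : forall k i, ip (mk k i) = i).
Hypotheses (idx_uniq : forall m, uniq (idx m))
  (idx_ord : forall m i, i \in idx m -> ord i = m)
  (idx_size : forall m, (size (idx m))%:R <= 2 * order_nu d m ^+ d :> R)
  (idx_size0 : forall m, (0 < m)%N -> (size (idx m))%:R = 2 * order_nu d m ^+ d :> R).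
Hypothesis modesP : forall p, modes p <-> [/\ 0 < kp p, ip p \in idx (ord (ip p)) &
  characteristicF (f (ord (ip p))) n (kp p) = 0].
Hypothesis M00 : (0 < M0)%N.
Hypothesis localizedP : forall p, modes p -> (M0 <= ord (ip p))%N ->
  n * kp p <= order_nu d (ord (ip p)) -> localized p.

Let q m := (2 * m + d)%N.
Let n0 : 0 < n. Proof. by case/andP: hn. Qed.

Let nuE m : (q m)%:R / 2 = order_nu d m :> R.
Proof. by rewrite /q natrD natrM /order_nu; field. Qed.

Let char_root m k : 0 < k -> characteristicF (f m) n k = 0 <->
  exists2 j, (0 < j)%N & phase_diff (q m) n k = pi * j%:R.
Proof.
move=> k0; rewrite (characteristicF_eq0 (hf m) n0 k0).
exact: bess_cross_eq0.
Qed.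

Let row (K : nat -> nat) m : seq T :=
  [seq mk (level_root n (q m) j) i | i <- idx m, j <- iota 1 (K m)].

Let size_rows K a b : (size (flatten [seq row K m | m <- index_iota a b]))%:R =
  \sum_(a <= m < b) (size (idx m))%:R * (K m)%:R :> R.
Proof.
rewrite size_flatten /shape -map_comp sumnE big_map natr_sum.
by apply: eq_bigr => m _; rewrite /= size_allpairs size_iota natrM.
Qed.

(** A mode is determined by its angular index and its level. Crossings are strict, so a level met
    before [r] is among the [levels] at [r]; and an order of at least [r] would keep the phase
    difference below pi. *)
Let counting_modes r : 1 <= r ->
  (counting [set p | modes p /\ (kp p < r)%R] <= (\sum_(0 <= m < (Num.truncn r).+1)
    2 * order_nu d m ^+ d * (phase_diff (q m) n r / pi))%:E)%E.
Proof.
move=> r1; have r0 : 0 < r by exact: lt_le_trans r1.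
pose s := flatten [seq row (fun m => levels n (q m) r) m | m <- index_iota 0 (Num.truncn r).+1].
apply: (@le_trans _ _ (size s)%:R%:E).
  apply: counting_le => p [/modesP[k0 pidx /(char_root _ k0)[j j0 hj]] kr].
  apply/flattenP; exists (row (fun m => levels n (q m) r) (ord (ip p))); last first.
    apply/allpairsP; exists (ip p, j); split => //=.
      by rewrite mem_iota j0 add1n ltnS; exact: level_le hj.
    by rewrite (level_rootE hn k0 hj) mkK.
  apply/mapP; exists (ord (ip p)) => //; rewrite mem_index_iota/= ltnS.
  rewrite -ltnS -(ltr_nat R).
  have /andP[_] := truncn_itv (ltW r0); apply: lt_trans.
  have num : (ord (ip p))%:R <= order_nu d (ord (ip p)) :> R.
    by rewrite /order_nu lerDl divr_ge0.
  apply: (le_lt_trans num); rewrite ltNge; apply/negP => rnu.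
  have : phase_diff (q (ord (ip p))) n (kp p) < pi.
    apply: phase_diff_lt_pi => //; rewrite nuE; first exact: lt_le_trans rnu.
    by rewrite k0 (le_trans (ltW kr)).
  by rewrite hj ltNge ler_peMr ?pi_ge0// ler1n j0.
rewrite lee_fin size_rows; apply: ler_sum => m _.
apply: ler_pM => //; exact: levels_le.
Qed.

Let counting_localized r : 1 <= r ->
  ((\sum_(M0 <= m < Num.truncn r) 2 * order_nu d m ^+ d *
    (phase_diff (q m) n (Num.min r (order_nu d m / n)) / pi - 2))%:E <=
  counting [set p | localized p /\ (kp p < r)%R])%E.
Proof.
move=> r1; have r0 : 0 < r by exact: lt_le_trans r1.
pose X m := Num.min r (order_nu d m / n).
(* The last level is given up so that the remaining ones lie strictly below the phase difference at
   [X m], as [level_rootP] requires. With the truncation in [levels] this costs 2 per order. *)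
pose K m := (levels n (q m) (X m)).-1.
have X0 m : (M0 <= m)%N -> 0 < X m.
  move=> hm; rewrite lt_min r0 divr_gt0// /order_nu ltr_pwDl ?divr_ge0// ltr0n.
  exact: leq_trans hm.
have rootP m j : (M0 <= m)%N -> j \in iota 1 (K m) ->
    [/\ (0 < j)%N, 0 < level_root n (q m) j < X m &
    phase_diff (q m) n (level_root n (q m) j) = pi * j%:R].
  move=> hm; rewrite mem_iota add1n ltnS => /andP[j0 jK].
  by have [] := level_rootP hn j0 (X0 m hm) (level_lt hn (X0 m hm) jK j0).
pose s := flatten [seq row K m | m <- index_iota M0 (Num.truncn r)].
have keyP m x : x \in row K m -> ord (ip x) = m.
  by move=> /allpairsP[[i j] [/= /idx_ord im _ ->]]; rewrite ipK.
apply: (@le_trans _ _ (size s)%:R%:E).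
  rewrite lee_fin size_rows; apply: ler_sum_nat => m /andP[hm _].
  rewrite idx_size0; last exact: leq_trans hm.
  apply: ler_wpM2l.
    by rewrite mulr_ge0// exprn_ge0// /order_nu addr_ge0// divr_ge0.
  have := levels_gt (q m) hn (X0 m hm); rewrite /K.
  case: (levels _ _ _) => [|l] /=; rewrite -/(X m) -?natr1; lra.
apply: counting_ge.
  apply: (@uniq_flatten_key _ (fun x => ord (ip x))).
  - exact: iota_uniq.
  - move=> m; rewrite mem_index_iota => /andP[hm _].
    apply: allpairs_uniq; [exact: idx_uniq|exact: iota_uniq|].
    move=> [i j] [i' j'] /allpairsP[[a b] [_ hb [-> ->]]] /allpairsP[[a' b'] [_ hb' [-> ->]]] /= e.
    have [_ _ h1] := rootP m b hm hb; have [_ _ h2] := rootP m b' hm hb'.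
    have ea : a = a' by rewrite -(ipK (level_root n (q m) b) a) e ipK.
    have ek := congr1 kp e; rewrite !kpK in ek.
    rewrite ea; congr (_, _); apply/eqP; rewrite -(eqr_nat R); apply/eqP.
    by apply: (mulfI (lt0r_neq0 (pi_gt0 R))); rewrite -h1 ek h2.
  - by move=> m x _; exact: keyP.
move=> x /flattenP[_ /mapP[m + ->] xm]; rewrite mem_index_iota => /andP[hm mM].
have om := keyP m x xm.
move: xm => /allpairsP[[i j] [/= im jK xE]].
have [j0 /andP[k0 kX] hk] := rootP m j hm jK.
have kx : kp x = level_root n (q m) j by rewrite xE kpK.
have ix : ip x = i by rewrite xE ipK.
have [kr knu] : level_root n (q m) j < r /\ level_root n (q m) j < order_nu d m / n.
  by move: kX; rewrite lt_min => /andP[].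
split; last by rewrite kx.
apply: localizedP; rewrite ?om ?kx//.
  apply/modesP; rewrite om kx ix; split => //.
  by apply/(char_root _ k0); exists j.
by rewrite mulrC -ler_pdivlMr// ltW.
Qed.

Let J := wkb_profile n * n ^+ d.+1 / d.+2%:R + (wkb_prim d 1 - wkb_prim d n).
Let I0 : R := wkb_prim d 1 - wkb_prim d 0.

Let counting_upper e : 0 < e -> exists2 r0, 1 <= r0 & forall r, r0 <= r ->
  (counting [set p | modes p /\ (kp p < r)%R] <=
   ((2 / pi * (I0 * (1 - n ^+ d.+2)) + e) * r ^+ d.+2)%:E)%E.
Proof.
move=> e0; have [K K0 hK] := phase_asymptotic (R := R).
have [r1 r1ge1 hr1] := upper_sum hd hn K0 e0.
exists (Num.max r1 n^-1); first by rewrite le_max r1ge1.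
move=> r; rewrite ge_max => /andP[r1r rn].
have rge1 : 1 <= r by exact: le_trans r1r.
have r0 : 0 < r by exact: lt_le_trans rge1.
have nr1 : 1 <= n * r by rewrite mulrC -ler_pdivrMr// div1r.
apply: (le_trans (counting_modes rge1)); rewrite lee_fin.
apply: le_trans (hr1 r r1r); apply: ler_sum => m _.
apply: ler_wpM2l.
  by rewrite mulr_ge0// exprn_ge0// /order_nu addr_ge0// divr_ge0.
rewrite ler_pM2r ?invr_gt0 ?pi_gt0//.
have := hK (q m) r rge1; have := hK (q m) (n * r) nr1; rewrite nuE.
have : ln (n * r) <= ln r.
  by rewrite ler_ln ?posrE ?mulr_gt0// ler_piMl ?(ltW r0)// ltW//; case/andP: hn.
rewrite !ler_norml /phase_diff => hln /andP[h1 h2] /andP[h3 h4]; lra.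
Qed.

Let counting_lower e : 0 < e -> exists2 r0, 1 <= r0 & forall r, r0 <= r ->
  (((2 / pi * J - e) * r ^+ d.+2)%:E <= counting [set p | localized p /\ (kp p < r)%R])%E.
Proof.
move=> e0; have [K K0 hK] := phase_asymptotic (R := R).
(* The phase at [n * X] is not compared with WKB: it is below pi / 2 < 2, and this 2 joins the
   constant. *)
have K20 : 0 <= K + 2 by rewrite addr_ge0.
have [r1 r1ge1 hr1] := lower_sum hd hn K20 e0 M00.
exists r1 => // r r1r.
have rge1 : 1 <= r by exact: le_trans r1r.
have r0 : 0 < r by exact: lt_le_trans rge1.
apply: le_trans (counting_localized rge1); rewrite lee_fin.
apply: (le_trans (hr1 r r1r)); apply: ler_sum_nat => m /andP[hm _].
have nu1 : 1 <= order_nu d m :> R.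
  have h1 : 1 <= m%:R :> R by rewrite ler1n (leq_trans M00).
  by apply: (le_trans h1); rewrite /order_nu lerDl divr_ge0.
have nu0 : 0 < order_nu d m :> R by exact: lt_le_trans nu1.
apply: ler_wpM2l; first by rewrite mulr_ge0// exprn_ge0// ltW.
rewrite lerD2r ler_pM2r ?invr_gt0 ?pi_gt0//.
set X := Num.min _ _.
have X1 : 1 <= X.
  rewrite le_min rge1 ler_pdivlMr// mul1r (le_trans _ nu1)// ltW//; by case/andP: hn.
have X0 : 0 < X by exact: lt_le_trans X1.
have Xr : X <= r by rewrite ge_min lexx.
have nXnu : n * X <= order_nu d m.
  by rewrite mulrC -ler_pdivlMr// ge_min lexx orbT.
have p1 : phase (q m) (n * X) < pi / 2.
  by apply: phase_lt_pihalf; rewrite nuE// mulr_ge0 ?(ltW n0) ?(ltW X0).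
have := hK (q m) X X1; rewrite nuE.
have hln : ln X <= ln r by rewrite ler_ln ?posrE.
have p2 := pihalf_lt2 R.
rewrite ler_norml /phase_diff => /andP[h1 h2]; lra.
Qed.

Lemma liminf_ratio_ge : 0 < J -> 0 < I0 ->
  ((J / (I0 * (1 - n ^+ d.+2)))%:E <= liminf_ratio kp modes localized)%E.
Proof.
move=> J0 I00; apply: liminf_ge => e e0.
have nd : 0 < 1 - n ^+ d.+2.
  by case/andP: hn => _ n1; rewrite subr_gt0 exprn_ilt1// ltW.
have p0 := pi_gt0 R.
pose a := 2 / pi * J; pose b := 2 / pi * (I0 * (1 - n ^+ d.+2)).
have a0 : 0 < a by rewrite /a mulr_gt0// divr_gt0.
have b0 : 0 < b by rewrite /b mulr_gt0// ?divr_gt0// mulr_gt0.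
have -> : J / (I0 * (1 - n ^+ d.+2)) = a / b.
  rewrite /a /b; have h : (pi : R) != 0 by rewrite gt_eqF.
  move: (pi) (1 - _) nd (I0) I00 h => P N N0 I1 I10 h.
  by field; rewrite h (gt_eqF N0) (gt_eqF I10).
(* The second bound is e' (1 + a / b) <= e b, which gives (a - e') / (b + e') >= a / b - e; the
   first keeps a - e' positive. *)
pose e' := Num.min (a / 2) (e * b / (1 + a / b)).
have ab0 : 0 < a / b by rewrite divr_gt0.
have ab1 : 0 < 1 + a / b by rewrite addr_gt0.
have e'0 : 0 < e'.
  by rewrite lt_min; apply/andP; split; apply: divr_gt0 => //; exact: mulr_gt0.
have e'a : e' <= a / 2 by rewrite ge_min lexx.
have e'b : e' * (1 + a / b) <= e * b.
  by rewrite -ler_pdivlMr// ge_min lexx orbT.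
have [r1 r1ge1 h1] := counting_upper e'0.
have [r2 _ h2] := counting_lower e'0.
exists (Num.max r1 r2) => r; rewrite ge_max => /andP[r1r r2r].
have r0 : 0 < r by apply: lt_le_trans r1r; exact: lt_le_trans r1ge1.
have rd : 0 < r ^+ d.+2 by exact: exprn_gt0.
have ae : 0 < a - e' by lra.
have be : 0 < b + e' by rewrite addr_gt0.
apply: le_trans (lee_ratio _ _ (h2 r r2r) _ (h1 r r1r)).
- rewrite lee_fin -/a -/b.
  have -> : (a - e') * r ^+ d.+2 / ((b + e') * r ^+ d.+2) = (a - e') / (b + e').
    by rewrite invfM mulrACA divff ?gt_eqF// mulr1.
  rewrite ler_pdivlMr// mulrBl mulrDr divfK ?gt_eqF//.
  have : 0 <= e * e' by rewrite mulr_ge0// ltW.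
  move: e'b; rewrite mulrDr mulr1 (mulrC e' (a / b)); lra.
- exact: mulr_gt0.
- exact: mulr_gt0.
by rewrite /counting; case: asboolP => // _; rewrite lee_fin.
Qed.

End ModeCounting.

(** * Localization near the boundary *)

Section Scaling.
Local Open Scope ereal_scope.
Context {R : realType}.

(** For the dilation by tau in dimension N the factor is c = tau^(-N). *)
Definition scales d (T : measurableType d) (mu : {measure set T -> \bar R})
    (s : T -> T) (c : R) :=
  measurable_fun setT s /\ forall A, measurable A -> mu (s @^-1` A) = c%:E * mu A.

Lemma scales_integral d (T : measurableType d) (mu : {measure set T -> \bar R})
    (s : T -> T) (c : R) (D : set T) (f : T -> \bar R) :
  scales mu s c -> (0 <= c)%R -> measurable D -> measurable_fun D f ->
  (forall x, D x -> 0 <= f x) ->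
  \int[mu]_(x in s @^-1` D) f (s x) = c%:E * \int[mu]_(x in D) f x.
Proof.
move=> [ms hs] c0 mD mf f0.
rewrite -(ge0_integral_pushforward ms)//; last first.
  by move=> y; rewrite inE; exact: f0.
rewrite -(ge0_integral_mscale _ mD (NngNum c0))//.
apply: eq_measure_integral => A mA _; exact: (hs A mA).
Qed.

(** Tau times the image of Lebesgue measure under the dilation gives half-open intervals their
    length, so it is Lebesgue measure. *)
Lemma scales_lebesgue (tau : R) : (0 < tau)%R ->
  scales (@lebesgue_measure R) (fun x => tau * x)%R tau^-1.
Proof.
move=> t0.
have ms : measurable_fun setT (fun x : measurableTypeR R => tau * x : measurableTypeR R)%R.
  exact: measurable_funM.
split=> // A mA.
pose m' : {measure set (measurableTypeR R) -> \bar R} :=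
  mscale (NngNum (ltW t0)) (measure_function_pushforward__canonical__measure_function_Measure
    (@lebesgue_measure R) ms).
have : lebesgue_measure A = m' A.
  apply: lebesgue_measure_unique => // _ [[a b]] _ <-.
  have e : (fun x : R => tau * x)%R @^-1` [set` `]a, b]] = [set` `](a / tau)%R, (b / tau)%R]].
    apply/seteqP; split => x /=; rewrite !in_itv /= ltr_pdivrMr// ler_pdivlMr//;
      by rewrite (mulrC x).
  transitivity (tau%:E * lebesgue_measure [set` `](a / tau)%R, (b / tau)%R]]); last by rewrite -e.
  rewrite !lebesgue_measure_itv /= !lte_fin ltr_pM2r ?invr_gt0//.
  case: ifPn => // _; last by rewrite mule0.
  by congr (_%:E); rewrite /=; field; rewrite gt_eqF.
rewrite /m' /= /mscale /pushforward => -> /=.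
by rewrite muleA -EFinM mulVf ?gt_eqF// mul1e.
Qed.

Lemma scales_prod d1 d2 (T1 : measurableType d1) (T2 : measurableType d2)
    (m1 : {measure set T1 -> \bar R}) (m2 : {sigma_finite_measure set T2 -> \bar R})
    (s1 : T1 -> T1) (s2 : T2 -> T2) (c1 c2 : R) :
  (0 <= c1)%R -> (0 <= c2)%R -> scales m1 s1 c1 -> scales m2 s2 c2 ->
  scales (m1 \x m2)%E (fun x => (s1 x.1, s2 x.2)) (c1 * c2).
Proof.
move=> c10 c20 h1 [ms2 hs2].
have ms1 : measurable_fun setT s1 by case: h1.
split=> [|A mA].
  apply: measurable_fun_pair; first exact: (measurableT_comp ms1 measurable_fst).
  exact: (measurableT_comp ms2 measurable_snd).
pose h := m2 \o xsection A.
have mh : measurable_fun setT h by exact: measurable_fun_xsection.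
rewrite /product_measure1.
transitivity (\int[m1]_x (c2%:E * h (s1 x))).
  apply: eq_integral => x _ /=; rewrite -hs2; last exact: measurable_xsection.
  by congr (m2 _); apply/seteqP; split => y /=; rewrite /xsection /= !inE.
rewrite ge0_integralZl//; last exact: (measurableT_comp mh ms1).
have := scales_integral h1 c10 measurableT mh (fun x _ => measure_ge0 m2 _).
rewrite preimage_setT => ->.
by rewrite muleA -EFinM mulrC.
Qed.

End Scaling.

Section LocalizationCriterion.
Local Open Scope ereal_scope.
Context {R : realType} {dT : measure_display} {T : measurableType dT}.
Variables (mu : {measure set T -> \bar R}) (en : T -> R) (s : T -> T).
Variables (c tau k delta eps Bd : R) (psi : T -> R[i]).

Let g x : R := (Normc.normc (psi x) ^+ 2)%R.
Let Omega := [set x | (en x < 1)%R].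
Let layer := [set x | (en x < 1 /\ 1 - delta < en x)%R].

Hypotheses (men : measurable_fun setT en) (mg : measurable_fun setT g).
Hypotheses (hs : scales mu s c) (c1 : (1 <= c)%R) (tau0 : (0 < tau)%R)
  (ens : forall x, en (s x) = (tau * en x)%R) (tau_delta : (1 - delta < tau < 1)%R).
Hypotheses (muOmega : mu Omega < +oo) (Bd0 : (0 <= Bd)%R) (g_le : forall x, Omega x -> (g x <= Bd)%R).
Hypothesis g_pos : exists B (a : R), [/\ measurable B, B `<=` Omega, 0 < mu B,
  (0 < a)%R & forall x, B x -> (a <= g x)%R].
Hypotheses (k0 : (0 < k)%R) (decay : forall x, Omega x -> (k * g (s x) <= g x)%R).
Hypotheses (heps : (0 < eps < 1)%R) (hk : (k^-1 < 1 - (1 - eps) ^+ 2)%R).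

Let g0 x : (0 <= g x)%R. Proof. exact: sqr_ge0. Qed.

Let m_lt a : measurable [set x | (en x < a)%R].
Proof.
rewrite -[X in measurable X]setTI.
have -> : [set x | (en x < a)%R] = en @^-1` `]-oo, a[.
  by apply/seteqP; split => x /=; rewrite in_itv.
exact: men.
Qed.

Let m_gt a : measurable [set x | (a < en x)%R].
Proof.
rewrite -[X in measurable X]setTI.
have -> : [set x | (a < en x)%R] = en @^-1` `]a, +oo[.
  by apply/seteqP; split => x /=; rewrite in_itv/= andbT.
exact: men.
Qed.

Let mlayer : measurable layer.
Proof. exact: (measurableI _ _ (m_lt 1%R) (m_gt (1 - delta)%R)). Qed.

Let mgE D : measurable_fun D (EFin \o g).
Proof. by apply/measurable_EFinP; exact: measurable_funTS. Qed.

Let gE0 x : 0 <= (g x)%:E. Proof. by rewrite lee_fin. Qed.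

Let int_ge0 D : 0 <= \int[mu]_(x in D) (g x)%:E.
Proof. by apply: integral_ge0 => x _; rewrite lee_fin. Qed.

(** [L2norm] is built on a real-valued integral, whose value for an infinite integral is 0;
    finiteness excludes this default. *)
Let intOmega_fin : \int[mu]_(x in Omega) (g x)%:E < +oo.
Proof.
apply: (@le_lt_trans _ _ (\int[mu]_(x in Omega) (cst Bd%:E) x)).
  apply: ge0_le_integral => //.
  - exact: m_lt.
rewrite integral_cst; last exact: m_lt.
by apply: lte_mul_pinfty; rewrite ?lee_fin.
Qed.

Let intOmega_gt0 : 0 < \int[mu]_(x in Omega) (g x)%:E.
Proof.
have [B [a [mB BO muB a0 hB]]] := g_pos.
apply: (@lt_le_trans _ _ (\int[mu]_(x in B) (g x)%:E)); last first.
  by apply: ge0_subset_integral => //; exact: m_lt.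
apply: (@lt_le_trans _ _ (\int[mu]_(x in B) (cst a%:E) x)).
  by rewrite integral_cst// mule_gt0.
apply: ge0_le_integral => //.
by move=> x _; rewrite lee_fin ltW.
Qed.

Let inner := [set x | (en x < tau)%R].

(** The map [s] pulls the ball of radius tau back to the unit ball, so c times the inner integral is
    the integral of g(s x) over the unit ball, at most 1 / k times that of g by the decay; and c >=
    1. *)
Let int_inner : \int[mu]_(x in inner) (g x)%:E <= (k^-1)%:E * \int[mu]_(x in Omega) (g x)%:E.
Proof.
have c0 : (0 <= c)%R by exact: le_trans c1.
have inv : s @^-1` inner = Omega.
  apply/seteqP; split => x /=; rewrite /inner /Omega /= ens.
    by rewrite gtr_pMr.
  by rewrite gtr_pMr.
apply: (@le_trans _ _ (c%:E * \int[mu]_(x in inner) (g x)%:E)).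
  by apply: lee_pemull; rewrite ?lee_fin.
rewrite -(scales_integral hs c0 (m_lt tau) (@mgE _)); last first.
  by move=> x _; rewrite lee_fin.
have k1 : 0 <= (k^-1)%:E by rewrite lee_fin invr_ge0 ltW.
rewrite inv -ge0_integralZl//; last exact: m_lt.
apply: ge0_le_integral => //.
- exact: m_lt.
- by move=> x _; exact: gE0.
- apply: measurable_funTS; apply/measurable_EFinP; exact: (measurableT_comp mg hs.1).
- exact/measurable_funeM/mgE.
- by move=> x /decay h; rewrite -EFinM lee_fin mulrC ler_pdivlMr// mulrC.
Qed.

Let int_split : \int[mu]_(x in Omega) (g x)%:E <=
  \int[mu]_(x in layer) (g x)%:E + \int[mu]_(x in inner) (g x)%:E.
Proof.
have sub : Omega `<=` layer `|` inner.
  move=> x Ox; have [h|h] := ltP (1 - delta)%R (en x); first by left.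
  by right; case/andP: tau_delta => h1 _; exact: le_lt_trans h1.
apply: (@le_trans _ _ (\int[mu]_(x in layer `|` inner) (g x)%:E)).
  apply: ge0_subset_integral => //; first exact: m_lt.
  by apply: measurableU => //; exact: m_lt.
have -> : layer `|` inner = layer `|` (inner `\` layer).
  apply/seteqP; split => x [h|h]; [by left| |by left|by right; case: h].
  by have [xl|xl] := pselect (layer x); [left|right].
have mD : measurable (inner `\` layer) by apply: measurableD => //; exact: m_lt.
rewrite ge0_integral_setU//=; last by apply/disj_setPS => x [h [_ /(_ h)]].
by rewrite leeD2l//; apply: ge0_subset_integral => //; exact: m_lt.
Qed.

(** Layer and inner ball cover the domain, so the squared ratio is at least 1 - 1 / k, which exceeds
    (1 - eps)^2. *)
Lemma localization_gt : (1 - eps < localization mu Omega layer psi)%R.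
Proof.
rewrite /localization /L2norm /Rintegral -/g.
have lay_le : \int[mu]_(x in layer) (g x)%:E <= \int[mu]_(x in Omega) (g x)%:E.
  by apply: ge0_subset_integral => //; [exact: m_lt|move=> x []].
have := int_split; have := int_inner; have := intOmega_gt0; have := intOmega_fin.
have := int_ge0 layer; have := int_ge0 inner; move: lay_le.
set IL := \int[mu]_(x in layer) _; set II := \int[mu]_(x in inner) _.
set IO := \int[mu]_(x in Omega) _.
have -> : fine IO = fine (\int[mu]_(x in Omega) (g x)%:E) by [].
rewrite -/IO; case: IO => [io||]//; case: IL => [il||]//; case: II => [ii||]//.
rewrite -EFinD -EFinM !lee_fin !lte_fin /= => ilo ii0 il0 _ io0 iiio iolli.
have /andP[e0 e1] := heps.
have so : (0 < Num.sqrt io)%R by rewrite sqrtr_gt0.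
rewrite ltr_pdivlMr// -ltr_sqr ?nnegrE ?sqrtr_ge0//; last first.
  by rewrite mulr_ge0 ?sqrtr_ge0// subr_ge0 ltW.
rewrite exprMn !sqr_sqrtr ?(ltW io0)//.
have : ((1 - eps) ^+ 2 * io < (1 - k^-1) * io)%R.
  by rewrite ltr_pM2r// ltrBrDl -ltrBrDr.
rewrite mulrBl mul1r; lra.
Qed.

End LocalizationCriterion.

(** * Geometry of the ball and the boundary conditions *)

Section EuclideanBall.
Context {R : realType} {V : normedModType R}.
Variable en : V -> R.
Hypotheses (en_cts : continuous en) (en_ge0 : forall x, 0 <= en x)
  (enZ : forall a x, en (a *: x) = `|a| * en x)
  (en_triangle : forall x y, en x <= en (x - y) + en y).

Lemma boundary_eball x : boundary (eball en) x <-> en x = 1.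
Proof.
have oB : open (eball en).
  have -> : eball en = en @^-1` `]-oo, 1[.
    by apply/seteqP; split => y /=; rewrite /eball /= in_itv.
  by apply: open_comp.
rewrite /boundary; split=> [[cx nx]|ex].
  apply/le_anti/andP; split; last first.
    rewrite leNgt; apply/negP => h; apply: nx.
    by apply: (open_nbhs_nbhs (conj oB _)); exact: h.
  have cl : closed (en @^-1` `]-oo, 1]).
    by apply: closed_comp.
  have sub : eball en `<=` en @^-1` `]-oo, 1].
    by move=> y /= h; rewrite in_itv /= ltW.
  have := closure_subset sub cx; rewrite -(closure_id _).1//.
split; last by move=> /interior_subset; rewrite /eball /= ex ltxx.
move=> B Bx.
have hc : (1 - t) *: x @[t --> (0 : R)] --> x.
  rewrite -[X in _ --> X]scale1r -[1 in X in _ --> X]subr0.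
  by apply: cvgZr_tmp; apply: cvgB; [exact: cvg_cst|exact: cvg_id].
have /nbhs_ballP[e /= e0 he] : \forall t \near (0 : R), B ((1 - t) *: x) by exact: hc.
pose t := Num.min (e / 2) (1 / 2).
have t0 : 0 < t by rewrite lt_min !divr_gt0.
have te : t < e by rewrite gt_min ltr_pdivrMr// ltr_pMr// ltr1n.
have t1 : t < 1 by rewrite gt_min; apply/orP; right; lra.
exists ((1 - t) *: x); split; last first.
  by apply: he; rewrite /ball /= sub0r normrN gtr0_norm.
by rewrite /eball /= enZ ex mulr1 ger0_norm ?subr_ge0 ?(ltW t1)//; lra.
Qed.

Hypothesis en_unit : exists x, en x = 1.

Let en0 : en 0 = 0.
Proof. by have := enZ 0 0; rewrite scale0r normr0 mul0r. Qed.

(** The distance to the sphere is 1 - |x|: the triangle inequality gives one direction, and the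
    boundary point x / |x| the other; there x is nonzero because 1 - delta > 0. *)
Lemma boundary_layerE delta : 0 < delta < 1 ->
  boundary_layer en delta = [set x | en x < 1 /\ 1 - delta < en x].
Proof.
move=> /andP[d0 d1].
have lb x : has_lbound [set en (x - y) | y in boundary (eball en)].
  by exists 0 => _ [y _ <-].
apply/seteqP; split => x [xb]; rewrite /eball /= in xb; split => //.
  have [u eu] := en_unit.
  have hS : has_inf [set en (x - y) | y in boundary (eball en)].
    by split => //; exists (en (x - u)), u => //; apply/boundary_eball.
  have e0 : 0 < delta - eucl_dist en x (boundary (eball en)) by rewrite subr_gt0.
  have [_ [y /boundary_eball ey <-]] := inf_adherent e0 hS.
  rewrite addrCA subrr addr0 => h.
  have := en_triangle y x; rewrite ey.
  have -> : en (y - x) = en (x - y).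
    by rewrite -(opprB x y) -scaleN1r enZ normrN1 mul1r.
  lra.
have x0 : 0 < en x by lra.
pose y := (en x)^-1 *: x.
have ey : en y = 1 by rewrite /y enZ gtr0_norm ?invr_gt0// mulVf ?gt_eqF.
apply: (@le_lt_trans _ _ (en (x - y))).
  by apply: ge_inf => //; exists y => //; apply/boundary_eball.
have -> : x - y = (1 - (en x)^-1) *: x by rewrite scalerBl scale1r.
rewrite enZ ltr0_norm; last by rewrite subr_lt0 invf_gt1.
rewrite opprB mulrBl mulVf ?gt_eqF// mul1r; lra.
Qed.

Variables (f : R -> R) (Y : V -> R[i]).
Hypothesis df : forall x, derivable f x 1.
Hypothesis YZ : forall a x, 0 < a -> Y (a *: x) = Y x.

Let dirder (F : V -> R) (x : V) (phi : R -> R) (l : R) :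
  is_derive (0 : R) 1 phi l -> (\forall h \near (0 : R), F (h *: x + x) = phi h) ->
  'D_x F x = l.
Proof.
move=> dphi hF; have phi0 : F x = phi 0.
  by have := nbhs_singleton hF; rewrite scale0r add0r.
apply/cvg_lim => //.
have : h^-1 *: (phi (h *: 1 + 0) - phi 0) @[h --> (0 : R)^'] --> l.
  by case: dphi => d <-; exact: d.
apply: cvg_trans; apply: near_eq_cvg; near=> h.
rewrite phi0 addr0 [h *: 1]mulr1; congr (_ *: (_ - _)).
by apply/esym; near: h; exact: nbhs_dnbhs hF.
Unshelve. all: by end_near. Qed.

(** The derivative in direction x at x sees only the open ray through x, on which the angular factor
    is constant; the formula for [F] is asked only there. *)
Let dirder_wave (kappa a : R) (F : V -> R) (x : V) : en x = 1 ->
  (forall y, F y = f (kappa * en y) * a \/ ~ (exists2 t, 0 < t & y = t *: x)) ->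
  'D_x F x = kappa * derive1 f kappa * a.
Proof.
move=> ex hF.
apply: (dirder (phi := fun h => f (kappa * (1 + h)) * a)).
  have hf : is_derive (kappa * (1 + 0)) 1 f (derive1 f kappa).
    by rewrite addr0 mulr1 derive1E; apply/derivableP.
  have hg : is_derive (0 : R) 1 (fun h => kappa * (1 + h)) kappa by der; ring.
  have hfg := derC (g := fun h => kappa * (1 + h)) hf hg.
  by der; ring.
have : \forall h \near (0 : R), -1 < h by apply: lt_nbhsr; rewrite ltrN10.
apply: filterS => h h1.
have h0 : 0 < h + 1 by rewrite -ltrBlDr sub0r.
have -> : h *: x + x = (h + 1) *: x by rewrite scalerDl scale1r.
have [->|[]] := hF ((h + 1) *: x); last by exists (h + 1).
by rewrite enZ ex mulr1 gtr0_norm// addrC.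
Qed.

Lemma normal_derivative_wave (kappa : R) (C : R[i]) (x : V) : en x = 1 ->
  normal_derivative (separated_wave en f Y kappa C) x =
  C * (kappa * derive1 f kappa)%:C%C * Y x.
Proof.
move=> ex; rewrite /normal_derivative.
have reE (r : R) (z : R[i]) : complex.Re (r%:C%C * z) = r * complex.Re z.
  by case: z => a b; rewrite /= mul0r subr0.
have imE (r : R) (z : R[i]) : complex.Im (r%:C%C * z) = r * complex.Im z.
  by case: z => a b; rewrite /= mul0r addr0.
have wE y : separated_wave en f Y kappa C y = (f (kappa * en y))%:C%C * (C * Y y).
  by rewrite /separated_wave; ring.
rewrite (dirder_wave (kappa := kappa) (a := complex.Re (C * Y x))) //; last first.
  move=> y; have [[t t0 ->]|] := pselect (exists2 t, 0 < t & y = t *: x); last by right.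
  by left; rewrite wE reE YZ.
rewrite (dirder_wave (kappa := kappa) (a := complex.Im (C * Y x))) //; last first.
  move=> y; have [[t t0 ->]|] := pselect (exists2 t, 0 < t & y = t *: x); last by right.
  by left; rewrite wE imE YZ.
transitivity ((kappa * derive1 f kappa)%:C%C * (C * Y x)); last by ring.
by apply/eqP; rewrite eq_complex /= reE imE !eqxx.
Qed.

(** With C1 = f(k) and C2 = f(k n) the boundary values agree by symmetry, and equality of the normal
    derivatives is k times the characteristic equation. *)
Lemma eigenpair_exists (n k : R) : characteristicF f n k = 0 -> f k != 0 ->
  eigenpair en f Y n k (separated_wave en f Y (k * n) (f k)%:C%C)
    (separated_wave en f Y k (f (k * n))%:C%C).
Proof.
move=> hF fk; exists (f k)%:C%C, (f (k * n))%:C%C; split => //.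
  by rewrite xpair_eqE negb_and eq_complex /= (negbTE fk).
move=> x /boundary_eball ex; split.
  by rewrite /separated_wave ex !mulr1 (mulrC (f k)%:C%C).
rewrite !normal_derivative_wave//; congr (_ * _).
rewrite -!rmorphM; congr (_%:C%C).
move/eqP: hF; rewrite /characteristicF subr_eq0 => /eqP.
rewrite (mulrC k n) => h.
transitivity (k * (n * f k * derive1 f (n * k))); first by ring.
by rewrite h; ring.
Qed.

End EuclideanBall.

Section WaveLocalization.
Context {R : realType} {dT : measure_display} {T : measurableType dT}.
Variables (mu : {measure set T -> \bar R}) (en : T -> R) (s : T -> T).
Variables (c tau delta eps BY : R) (Y : T -> R[i]).
Variables (f : R -> R) (m d : nat).

Let gY x : R := Normc.normc (Y x) ^+ 2.
Let Omega := [set x | en x < 1].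
Let layer := [set x | en x < 1 /\ 1 - delta < en x].
Let nu : R := (2 * m + d)%:R / 2.

Hypotheses (men : measurable_fun setT en) (mgY : measurable_fun setT gY).
Hypothesis en_ge0 : forall x, 0 <= en x.
Hypotheses (hs : scales mu s c) (c1 : 1 <= c)
  (ens : forall x, en (s x) = tau * en x) (Ys : forall x, Y (s x) = Y x)
  (tau01 : 0 < tau < 1) (tau_delta : 1 - delta < tau).
Hypotheses (muOmega : (mu Omega < +oo)%E) (gY_le : forall x, gY x <= BY).
Hypothesis gY_pos : exists B (a b : R), [/\ measurable B, (0 < mu B)%E, 0 < a, 0 < b &
  forall x, B x -> en x < 1 /\ (a <= en x /\ b <= gY x)].
Hypotheses (hf : bessel_multiple f m d) (hd : (d <= 1)%N) (m0 : (0 < m)%N).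
Hypothesis heps : 0 < eps < 1.
Hypothesis hk : (tau * (1 + nu * decay_rate tau))^-1 < 1 - (1 - eps) ^+ 2.

Lemma wave_localization (C : R[i]) (kappa : R) : C != 0 -> 0 < kappa <= nu ->
  1 - eps < localization mu Omega layer (fun x => C * (f (kappa * en x))%:C%C * Y x).
Proof.
move=> C0 /andP[k0 knu].
have fcts := bessel_multiple_cts hf.
have f2cts (A : set R) : {within A, continuous (fun x => f x ^+ 2)}.
  by apply: continuous_subspaceT => x; apply: cvgM; exact: fcts.
pose nC := Normc.normc C ^+ 2.
have nC0 : 0 < nC.
  rewrite lt_neqAle sqr_ge0 andbT eq_sym sqrf_eq0.
  by apply: contra C0 => /eqP /Normc.eq0_normc ->.
have gE x : Normc.normc (C * (f (kappa * en x))%:C%C * Y x) ^+ 2 =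
    nC * f (kappa * en x) ^+ 2 * gY x.
  rewrite !Normc.normcM !exprMn; congr (_ * _ * _).
  by rewrite /= expr0n addr0 sqr_sqrtr// sqr_ge0.
have gY0 x : 0 <= gY x by exact: sqr_ge0.
have ken x : Omega x -> 0 <= kappa * en x <= kappa.
  by move=> h; rewrite mulr_ge0 ?(ltW k0)//= ler_piMr// ltW.
have [cM _ hM] := EVT_max (ltW k0) (f2cts _).
have nu0 : 0 < nu by exact: lt_le_trans knu.
have /andP[t0 t1] := tau01.
have dr := decay_rate_gt0 tau01.
have BY0 : 0 <= BY.
  have [B [a [b [mB muB a0 b0 hB]]]] := gY_pos.
  have [x Bx] : B !=set0.
    by apply/set0P/eqP => B0; move: muB; rewrite B0 measure0 ltxx.
  exact: le_trans (gY0 x) (gY_le x).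
apply: (@localization_gt _ _ _ mu en s c tau (tau * (1 + nu * decay_rate tau)) delta eps
  (nC * f cM ^+ 2 * BY)) => //.
- have -> : (fun x => Normc.normc (C * (f (kappa * en x))%:C%C * Y x) ^+ 2) =
      (fun x => nC * f (kappa * en x) ^+ 2 * gY x) by apply/funext.
  apply: measurable_funM => //; apply: measurable_funM => //.
  apply: measurable_funX; apply: measurableT_comp => //.
    exact: continuous_measurable_fun.
  exact: measurable_funM.
- by rewrite tau_delta.
- by apply: mulr_ge0 => //; apply: mulr_ge0; [exact: ltW|exact: sqr_ge0].
- move=> x Ox; rewrite gE; apply: ler_pM => //.
    by rewrite mulr_ge0 ?sqr_ge0// ltW.
  by rewrite ler_pM2l//; apply: hM; rewrite in_itv /= ken.
- have [B [a [b [mB muB a0 b0 hB]]]] := gY_pos.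
  have [x0 Bx0] : B !=set0.
    by apply/set0P/eqP => B0; move: muB; rewrite B0 measure0 ltxx.
  have [x01 [ax0 _]] := hB _ Bx0.
  have ak : kappa * a <= kappa by rewrite ler_piMr ?(ltW k0)// (le_trans ax0)// ltW.
  (* On [[kappa a, kappa]], inside (0, nu], [f] has no zero, so the minimum of its square is a
     positive lower bound on [B]. *)
  have [cm + hm] := EVT_min ak (f2cts _).
  rewrite in_itv /= => /andP[cm1 cm2].
  have fm0 : 0 < f cm ^+ 2.
    rewrite lt_neqAle sqr_ge0 andbT eq_sym sqrf_eq0.
    apply: (bessel_multiple_neq0 hf); rewrite (lt_le_trans _ cm1) ?mulr_gt0//=.
    exact: le_trans cm2 knu.
  exists B, (nC * f cm ^+ 2 * b); split => //.
  + by move=> x /hB[].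
  + by apply: mulr_gt0 => //; exact: mulr_gt0.
  + move=> x /hB[x1 [ax bx]]; rewrite gE; apply: ler_pM => //.
    * by rewrite mulr_ge0 ?sqr_ge0// ltW.
    * exact: ltW.
    * rewrite ler_pM2l//; apply: hm; rewrite in_itv /= ler_pM2l// ax /=.
      by case/andP: (ken _ x1).
- by rewrite mulr_gt0// addr_gt0// mulr_gt0.
- move=> x Ox; have gYs : gY (s x) = gY x by rewrite /gY Ys.
  rewrite !gE ens gYs [leLHS]mulrA; apply: ler_wpM2r => //.
  rewrite mulrCA ler_pM2l// (mulrCA kappa tau); apply: (bessel_multiple_decay hf hd m0 tau01).
  have /andP[h1 h2] := ken x Ox.
  by rewrite h1 (le_trans h2).
Qed.

End WaveLocalization.

(** * The disc *)

Section Dimension2Facts.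
Context {R : realType}.
Implicit Types (x y : R * R) (a : R) (l : int).

Lemma minkowski2 (a b c d : R) :
  Num.sqrt ((a + c) ^+ 2 + (b + d) ^+ 2) <=
  Num.sqrt (a ^+ 2 + b ^+ 2) + Num.sqrt (c ^+ 2 + d ^+ 2).
Proof.
set p := Num.sqrt (a ^+ 2 + b ^+ 2); set q := Num.sqrt (c ^+ 2 + d ^+ 2).
have p2 : p ^+ 2 = a ^+ 2 + b ^+ 2 by rewrite sqr_sqrtr// addr_ge0 ?sqr_ge0.
have q2 : q ^+ 2 = c ^+ 2 + d ^+ 2 by rewrite sqr_sqrtr// addr_ge0 ?sqr_ge0.
have p0 : 0 <= p by exact: sqrtr_ge0.
have q0 : 0 <= q by exact: sqrtr_ge0.
rewrite -[leRHS]ger0_norm ?addr_ge0// -sqrtr_sqr ler_wsqrtr//.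
suff : a * c + b * d <= p * q by rewrite !sqrrD p2 q2; lra.
apply: (le_trans (ler_norm _)).
rewrite -ler_sqr ?nnegrE ?mulr_ge0// exprMn p2 q2 real_normK ?num_real//.
have := sqr_ge0 (a * d - b * c); lra.
Qed.

Lemma enorm2_ge0 x : 0 <= enorm2 x.
Proof. exact: sqrtr_ge0. Qed.

Lemma enorm2Z a x : enorm2 (a *: x) = `|a| * enorm2 x.
Proof.
rewrite /enorm2 /= -sqrtr_sqr -sqrtrM ?sqr_ge0//.
by congr Num.sqrt; rewrite /GRing.scale /=; ring.
Qed.

Lemma enorm2_triangle x y : enorm2 x <= enorm2 (x - y) + enorm2 y.
Proof.
have := minkowski2 (x - y).1 (x - y).2 y.1 y.2.
by rewrite /= !subrK.
Qed.

Lemma enorm2_cts : continuous (@enorm2 R).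
Proof.
move=> x; rewrite /enorm2.
apply: (@continuous_comp _ _ _ (fun x : R * R => x.1 ^+ 2 + x.2 ^+ 2) Num.sqrt).
  apply: cvgD; apply: cvgM; first [exact: cvg_fst | exact: cvg_snd].
exact: sqrt_continuous.
Qed.

Lemma measurable_enorm2 : measurable_fun setT (@enorm2 R).
Proof.
apply: measurableT_comp.
  by apply: continuous_measurable_fun; exact: sqrt_continuous.
by apply: measurable_funD; apply: measurable_funX; [exact: measurable_fst|exact: measurable_snd].
Qed.

Lemma enorm2_eq0 x : (enorm2 x == 0) = (x == 0).
Proof.
rewrite /enorm2 sqrtr_eq0 le_eqVlt ltNge addr_ge0 ?sqr_ge0//= orbF.
by rewrite paddr_eq0 ?sqr_ge0// !sqrf_eq0; case: x => a b.
Qed.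

(** At the origin the quotient is 0, and a nonzero power of 0 is 0 for negative exponents too, while
    the power 0 is 1. *)
Lemma normc_expi_theta l x :
  Normc.normc (expi_theta l x) ^+ 2 = ((l == 0) || (x != 0))%:R.
Proof.
have nX (z : R[i]) k : Normc.normc (z ^+ k) = Normc.normc z ^+ k.
  elim: k => [|k IH]; first by rewrite !expr0 Normc.normc1.
  by rewrite !exprS Normc.normcM IH.
have nz (z : R[i]) : Normc.normc (z ^ l) = if l is Negz k
    then (Normc.normc z ^+ k.+1)^-1 else Normc.normc z ^+ `|l|%N.
  by case: (l) => k; rewrite ?NegzE /= -?exprnP ?exprnN /= ?Normc.normcV nX.
rewrite /expi_theta nz.
have [->|x0] := eqVneq x 0.
  have -> : (((0 : R * R).1 +i* (0 : R * R).2)%C = 0) by [].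
  rewrite mul0r Normc.normc0.
  by case: l {nz} => [[|k]|k] /=; rewrite ?expr0 ?expr1n ?exprS ?mul0r ?invr0 ?expr0n ?mul0r.
have en0 : enorm2 x != 0 by rewrite enorm2_eq0.
have -> : Normc.normc ((x.1 +i* x.2)%C / (enorm2 x)%:C%C) = 1.
  rewrite Normc.normcM Normc.normcV /= expr0n addr0 sqrtr_sqr ger0_norm ?sqrtr_ge0//.
  by rewrite -/(enorm2 x) divff.
by case: l {nz} => k; rewrite orbT !expr1n ?invr1 ?expr1n.
Qed.

Lemma measurable_expi_theta l :
  measurable_fun setT (fun x => Normc.normc (expi_theta l x) ^+ 2).
Proof.
have -> : (fun x => Normc.normc (expi_theta l x) ^+ 2) =
    (if l == 0 then cst 1 else \1_(~` [set (0, 0) : R * R])).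
  apply/funext => x; rewrite normc_expi_theta; case: eqVneq => //= _.
  by rewrite indicE; congr (_ %:R); congr nat_of_bool; apply/idP/idP => [h|];
    [rewrite inE /= => h'|rewrite inE => h]; move: h; rewrite ?h' ?eqxx// => /eqP.
case: ifP => _; first exact: measurable_cst.
apply: measurable_indic; apply: measurableC.
rewrite (_ : [set (0, 0)] = [set 0] `*` [set 0]); first exact: measurableX.
by apply/seteqP; split=> [_ ->//|[a b] [/= -> ->]].
Qed.

Lemma expi_thetaZ l a x : 0 < a -> expi_theta l (a *: x) = expi_theta l x.
Proof.
move=> a0; rewrite /expi_theta enorm2Z gtr0_norm//; congr (_ ^ l).
have -> : (((a *: x).1 +i* (a *: x).2)%C = a%:C%C * (x.1 +i* x.2)%C).
  by apply/eqP; rewrite eq_complex /= /GRing.scale /= !mul0r subr0 addr0 !eqxx.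
rewrite rmorphM invfM mulrACA divff ?mul1r//.
by rewrite eq_complex /= negb_and gt_eqF.
Qed.

Lemma scales_lebesgue2 (tau : R) : 0 < tau ->
  scales (@lebesgue2 R) (fun x => tau *: x) (tau^-1 * tau^-1).
Proof.
move=> t0; have h := scales_lebesgue t0.
by apply: scales_prod => //; rewrite invr_ge0 ltW.
Qed.

Lemma lebesgue2_ball_fin : (@lebesgue2 R [set x | (enorm2 x < 1)%R] < +oo)%E.
Proof.
apply: (@le_lt_trans _ _ (@lebesgue2 R (`[-1, 1] `*` `[-1, 1]))).
  apply: le_measure; rewrite ?inE.
  - rewrite -[X in measurable X]setTI.
    have -> : [set x | (enorm2 x < 1)%R] = (@enorm2 R) @^-1` `]-oo, 1[.
      by apply/seteqP; split => x /=; rewrite in_itv.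
    exact: measurable_enorm2.
  - exact: measurableX.
  - move=> x /= h; split; rewrite /= in_itv /= -ler_norml -sqrtr_sqr;
      apply: le_trans (ltW h); rewrite ler_wsqrtr//; [rewrite lerDl|rewrite lerDr]; exact: sqr_ge0.
rewrite /lebesgue2 product_measure1E//.
have e : @lebesgue_measure R `[(-1)%R, 1%R]%classic = 2%:E.
  rewrite lebesgue_measure_itv /= lte_fin ifT; last by lra.
  by congr (_%:E); ring.
by rewrite -[X in (X < _)%E]/(@lebesgue_measure R `[(-1)%R, 1%R]%classic *
  @lebesgue_measure R `[(-1)%R, 1%R]%classic)%E e -EFinM ltry.
Qed.

Lemma lebesgue2_box_gt0 (I1 I2 : interval R) : (0 < @lebesgue_measure R [set` I1])%E ->
  (0 < @lebesgue_measure R [set` I2])%E -> (0 < @lebesgue2 R ([set` I1] `*` [set` I2]))%E.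
Proof. by move=> h1 h2; rewrite /lebesgue2 product_measure1E// mule_gt0. Qed.

(** The gain grows linearly in nu; the threshold makes nu * [decay_rate tau] * tau exceed the
    inverse of the target. *)
Lemma exists_order (tau eps : R) : 0 < tau < 1 -> 0 < eps < 1 ->
  exists2 M0, (0 < M0)%N & forall nu, M0%:R <= nu ->
    (tau * (1 + nu * decay_rate tau))^-1 < 1 - (1 - eps) ^+ 2.
Proof.
move=> ht /andP[e0 e1]; have d0 := decay_rate_gt0 ht; have /andP[t0 t1] := ht.
set D := 1 - (1 - eps) ^+ 2.
have D0 : 0 < D by rewrite subr_gt0 expr_lt1// ?subr_ge0 ?(ltW e1)//; lra.
pose k := decay_rate tau * tau * D.
have k0 : 0 < k by exact: (mulr_gt0 (mulr_gt0 d0 t0) D0).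
exists (Num.truncn k^-1).+1 => // nu hnu.
have nuk : k^-1 < nu.
  apply: lt_le_trans hnu.
  by have /truncn_itv/andP[] : 0 <= k^-1 by rewrite invr_ge0 ltW.
have nu0 : 0 < nu by apply: lt_trans nuk; rewrite invr_gt0.
have h1 : 1 < nu * k by rewrite -ltr_pdivrMr// div1r.
have k1 := mulr_gt0 t0 (addr_gt0 ltr01 (mulr_gt0 nu0 d0)).
rewrite -div1r ltr_pdivrMr//.
have : 0 < D * tau by rewrite mulr_gt0.
move: h1; rewrite /k; lra.
Qed.

End Dimension2Facts.

Section Density2.
Context {R : realType}.
Variables (eps delta n : R).
Hypotheses (heps : 0 < eps < 1 / 2) (hdelta : 0 < delta < 1) (hn : 0 < n < 1).

Let idx (m : nat) : seq int := if m == 0%N then [:: 0] else [:: m%:Z; - m%:Z].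
Let ord (l : int) : nat := `|l|%N.

Let idx_ord m l : l \in idx m -> ord l = m.
Proof.
rewrite /idx /ord; case: eqVneq => [->|m0]; rewrite !inE; first by move/eqP->.
by case/orP => /eqP ->; rewrite ?abszN.
Qed.

Let ord_idx l : l \in idx (ord l).
Proof.
rewrite /idx /ord absz_eq0; case: eqVneq => [->//|l0].
rewrite !inE; case: l {l0} => k; first by rewrite eqxx.
by apply/orP; right; rewrite NegzE eqr_opp.
Qed.

Let idx_uniq m : uniq (idx m).
Proof.
rewrite /idx; case: eqVneq => //= m0; rewrite inE andbT; apply/eqP => h.
by move: m0; lia.
Qed.

Lemma localized2_large_order : exists2 M0, (0 < M0)%N & forall p : R * int,
  modes2 n p -> (M0 <= ord p.2)%N -> n * p.1 <= order_nu 0 (ord p.2) ->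
  localized_modes2 eps delta n p.
Proof.
have /andP[d0 d1] := hdelta; have /andP[n0 n1] := hn.
have eps01 : 0 < eps < 1 by case/andP: heps => -> h /=; lra.
(* Any value strictly between 1 - delta and 1 would do. *)
pose tau := 1 - delta / 2.
have tau01 : 0 < tau < 1 by apply/andP; rewrite /tau; split; lra.
have [M0 M00 hM0] := exists_order tau01 eps01.
exists M0 => // -[k l] /= [/= k0 hF] hm hk; split => //=.
set m := ord l in hm hk *; rewrite -/m in hF.
have m0 : (0 < m)%N by exact: leq_trans hm.
have hf := @besselJ_multiple R m.
have nuE : (2 * m + 0)%:R / 2 = order_nu 0 m :> R.
  by rewrite /order_nu addn0 natrM; field.
have fk : besselJ m k != 0.
  by apply: (bessel_multiple_charF_deriv hf n0 k0 _ hF); rewrite nuE.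
have knu : 0 < k * n <= (2 * m + 0)%:R / 2 by rewrite nuE mulr_gt0//= mulrC.
have e10 : exists x : R * R, enorm2 x = 1.
  by exists (1, 0); rewrite /enorm2 /= expr1n expr0n addr0 sqrtr1.
exists (separated_wave enorm2 (besselJ m) (expi_theta l) (k * n) (besselJ m k)%:C%C),
  (separated_wave enorm2 (besselJ m) (expi_theta l) k (besselJ m (k * n))%:C%C).
have u_en_cts := @enorm2_cts R.
have df := bessel_multiple_derivable hf.
split.
  exact: (eigenpair_exists u_en_cts (@enorm2Z R) df
    (fun a x => @expi_thetaZ R l a x) hF fk).
left; rewrite /localization2.
rewrite (boundary_layerE u_en_cts (@enorm2_ge0 R) (@enorm2Z R) (@enorm2_triangle R) e10 hdelta).
have tau0 : 0 < tau by case/andP: tau01.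
have tauV : 1 <= tau^-1 by rewrite invf_ge1//; case/andP: tau01 => _ /ltW.
have en_tau x : enorm2 (tau *: x) = tau * enorm2 x by rewrite enorm2Z gtr0_norm.
have taud : 1 - delta < tau by rewrite /tau; lra.
have gY_le (x : R * R) : Normc.normc (expi_theta l x) ^+ 2 <= 1.
  by rewrite normc_expi_theta lern1; case: (_ || _).
have c1 : 1 <= tau^-1 * tau^-1 by exact: mulr_ege1.
have gY_pos : exists B (a b : R), [/\ measurable B, (0 < @lebesgue2 R B)%E, 0 < a, 0 < b &
    forall x, B x -> enorm2 x < 1 /\ (a <= enorm2 x /\ b <= Normc.normc (expi_theta l x) ^+ 2)].
  (* The square of this interval lies inside the unit disc and away from the origin, so the angular
     factor has modulus 1 on it. *)
  pose I : interval R := `](1 / 4), (1 / 2)[.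
  have I0 : (0 < @lebesgue_measure R [set` I])%E.
    rewrite lebesgue_measure_itv /= lte_fin ifT; last by lra.
    by rewrite lte_fin; lra.
  exists ([set` I] `*` [set` I]), (1 / 4), 1; split.
  - exact: measurableX.
  - exact: lebesgue2_box_gt0.
  - by rewrite divr_gt0.
  - by [].
  move=> [a b] [/=]; rewrite /I !in_itv /= => /andP[a1 a2] /andP[b1 b2].
  split; last split.
  - by rewrite /enorm2 /= -[ltRHS]sqrtr1 ltr_sqrt//; nra.
  - rewrite /enorm2 /= -[leLHS]ger0_norm; last by rewrite divr_ge0.
    by rewrite -sqrtr_sqr ler_wsqrtr//; nra.
  - rewrite normc_expi_theta; case: eqVneq => //= h.
    case: eqVneq => // -[h1 _]; exfalso.
    by move: a1; rewrite h1; lra.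
have hM : (tau * (1 + (2 * m + 0)%:R / 2 * decay_rate tau))^-1 < 1 - (1 - eps) ^+ 2.
  by apply: hM0; rewrite nuE /order_nu mul0r addr0 ler_nat.
have C0 : (besselJ m k)%:C%C != 0 by rewrite eq_complex /= negb_and fk.
have W := (@wave_localization R _ _ (@lebesgue2 R) enorm2 _ _ _ _ _ _ _ _ _ _
  (@measurable_enorm2 R) (@measurable_expi_theta R l)
  (@enorm2_ge0 R) (scales_lebesgue2 tau0) c1 en_tau (fun x => expi_thetaZ l x tau0)
  tau01 taud (@lebesgue2_ball_fin R) gY_le gY_pos hf isT m0 eps01 hM _ _ C0 knu).
exact: W.
Qed.

(** With n = cos t this is t - n sin t, positive because sin t <= t and n < 1. *)
Lemma P2_gt0 : 0 < P2 n.
Proof.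
have /andP[n0 n1] := hn.
have nN : -1 <= n <= 1 by rewrite (ltW n1) andbT (le_trans _ (ltW n0)).
have a0 : 0 < acos n by apply: acos_gt0; rewrite n1 andbT; case/andP: nN.
rewrite /P2 -sin_acos// subr_gt0.
have h := norm_sin_le (acos n); rewrite (gtr0_norm a0) in h.
apply: (@le_lt_trans _ _ (n * acos n)); last by rewrite gtr_pMl.
by rewrite ler_wpM2l ?(ltW n0)// (le_trans (ler_norm _)).
Qed.

(** The localized and total integrals are [P2 n / 4] and pi / 8 times 1 - n^2; the acos terms at n
    combine into [P2]. *)
Lemma density2_ge : ((2 * P2 n / (pi * (1 - n ^+ 2)))%:E <= density2 eps delta n)%E.
Proof.
have [M0 M00 hM0] := localized2_large_order.
have /andP[n0 n1] := hn.
have nN : -1 <= n <= 1 by rewrite (ltW n1) andbT (le_trans _ (ltW n0)).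
have JE : wkb_profile n * n ^+ 1 / 2%:R + (wkb_prim 0 1 - wkb_prim 0 n) = P2 n / 4.
  rewrite /wkb_profile /wkb_prim /= acos1 cos0 sin0 acosK ?in_itv//= sin_acos// /P2.
  by field.
have IE := @wkb_prim01 R.
have p0 := pi_gt0 R.
have := @liminf_ratio_ge R (R * int)%type int n 0 (@besselJ R) (fun k l => (k, l)) fst snd
  ord idx (modes2 n) (localized_modes2 eps delta n) M0 hn isT (@besselJ_multiple R).
rewrite JE IE.
have -> : P2 n / 4 / (pi / 8 * (1 - n ^+ 2)) = 2 * P2 n / (pi * (1 - n ^+ 2)).
  have : 1 - n ^+ 2 != 0 by rewrite gt_eqF// subr_gt0 expr_lt1// ltW.
  have : (pi : R) != 0 by rewrite gt_eqF.
  by move: (pi : R) (1 - _) => P N P0 N0; field; rewrite P0 N0.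
apply=> //.
- by case.
- move=> m; rewrite /order_nu expr0 mulr1 /idx; case: (m == 0%N) => /=; last by [].
  by rewrite ler1n.
- by move=> m m0; rewrite /order_nu expr0 mulr1 /idx gtn_eqF.
- move=> [k l]; rewrite /modes2 /=; split=> [[k0 hF]|[k0 _ hF]].
    split; [exact: k0|exact: ord_idx|exact: hF].
  by split; [exact: k0|exact: hF].
- by apply: divr_gt0; [exact: P2_gt0|].
- by apply: divr_gt0.
Qed.

End Density2.

(** * The ball *)

Section Dimension3Facts.
Context {R : realType}.
Implicit Types (x y : R * R * R) (a : R) (l : int).

Lemma enorm3E x : enorm3 x = Num.sqrt (enorm2 x.1 ^+ 2 + x.2 ^+ 2).
Proof. by rewrite /enorm3 sqr_sqrtr// addr_ge0 ?sqr_ge0. Qed.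

Lemma enorm3_ge0 x : 0 <= enorm3 x.
Proof. exact: sqrtr_ge0. Qed.

Lemma enorm3Z a x : enorm3 (a *: x) = `|a| * enorm3 x.
Proof.
rewrite /enorm3 /= -sqrtr_sqr -sqrtrM ?sqr_ge0//.
by congr Num.sqrt; rewrite /GRing.scale /=; ring.
Qed.

Lemma enorm3_triangle x y : enorm3 x <= enorm3 (x - y) + enorm3 y.
Proof.
rewrite !enorm3E; apply: le_trans (minkowski2 _ _ _ _).
have -> : (x - y).2 + y.2 = x.2 by rewrite /= subrK.
rewrite ler_wsqrtr// lerD2r ler_sqr ?nnegrE ?addr_ge0 ?enorm2_ge0//.
exact: enorm2_triangle.
Qed.

Lemma enorm3_cts : continuous (@enorm3 R).
Proof.
move=> x; have -> : @enorm3 R = (fun x => Num.sqrt (enorm2 x.1 ^+ 2 + x.2 ^+ 2)).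
  by apply/funext => y; exact: enorm3E.
apply: (@continuous_comp _ _ _ (fun x : R * R * R => enorm2 x.1 ^+ 2 + x.2 ^+ 2) Num.sqrt).
  have h : enorm2 (y : R * R * R).1 @[y --> x] --> enorm2 x.1.
    by apply: (@continuous_comp _ _ _ fst (@enorm2 R)); [exact: cvg_fst|exact: enorm2_cts].
  by apply: cvgD; apply: cvgM; first [exact: h | exact: cvg_snd].
exact: sqrt_continuous.
Qed.

Lemma measurable_enorm3 : measurable_fun setT (@enorm3 R).
Proof.
have -> : @enorm3 R = (fun x => Num.sqrt (enorm2 x.1 ^+ 2 + x.2 ^+ 2)).
  by apply/funext => y; exact: enorm3E.
apply: measurableT_comp.
  by apply: continuous_measurable_fun; exact: sqrt_continuous.
apply: measurable_funD; apply: measurable_funX; last exact: measurable_snd.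
by apply: measurableT_comp; [exact: measurable_enorm2|exact: measurable_fst].
Qed.

Lemma scales_lebesgue3 (tau : R) : 0 < tau ->
  scales (@lebesgue3 R) (fun x => tau *: x) (tau^-1 * tau^-1 * tau^-1).
Proof.
move=> t0; have ti : 0 <= tau^-1 by rewrite invr_ge0 ltW.
have h2 := scales_lebesgue2 t0; have h1 := scales_lebesgue t0.
by apply: scales_prod => //; exact: mulr_ge0.
Qed.

Lemma lebesgue3_ball_fin : (@lebesgue3 R [set x | (enorm3 x < 1)%R] < +oo)%E.
Proof.
pose B2 := [set x : R * R | (enorm2 x < 1)%R].
have mB2 : measurable B2.
  rewrite -[X in measurable X]setTI.
  have -> : B2 = (@enorm2 R) @^-1` `]-oo, 1[.
    by apply/seteqP; split => x /=; rewrite in_itv.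
  exact: measurable_enorm2.
apply: (@le_lt_trans _ _ (@lebesgue3 R (B2 `*` `[-1, 1]))).
  apply: le_measure; rewrite ?inE.
  - rewrite -[X in measurable X]setTI.
    have -> : [set x | (enorm3 x < 1)%R] = (@enorm3 R) @^-1` `]-oo, 1[.
      by apply/seteqP; split => x /=; rewrite in_itv.
    exact: measurable_enorm3.
  - exact: measurableX.
  - move=> x; rewrite /= enorm3E => h; split; rewrite /B2 /= ?in_itv /=.
      apply: le_lt_trans h; rewrite -[leLHS]ger0_norm ?enorm2_ge0// -sqrtr_sqr.
      by rewrite ler_wsqrtr// lerDl sqr_ge0.
    rewrite -ler_norml -sqrtr_sqr; apply: le_trans (ltW h).
    by rewrite ler_wsqrtr// lerDr sqr_ge0.
have e : @lebesgue_measure R `[(-1)%R, 1%R]%classic = 2%:E.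
  rewrite lebesgue_measure_itv /= lte_fin ifT; last by lra.
  by congr (_%:E); ring.
rewrite /lebesgue3 product_measure1E//.
rewrite -[X in (X < _)%E]/(@lebesgue2 R B2 * @lebesgue_measure R `[(-1)%R, 1%R]%classic)%E e.
by rewrite muleC lte_mul_pinfty// lebesgue2_ball_fin.
Qed.

Lemma lebesgue3_nbhs (x0 : R * R * R) (P : set (R * R * R)) : nbhs x0 P ->
  exists B, [/\ measurable B, (0 < @lebesgue3 R B)%E & B `<=` P].
Proof.
move=> /nbhs_ballP[e /= e0 he].
pose I (a : R) : interval R := `](a - e), (a + e)[.
have I0 a : (0 < @lebesgue_measure R [set` I a])%E.
  rewrite lebesgue_measure_itv /= lte_fin ifT; last by lra.
  by rewrite lte_fin; lra.
exists (([set` I x0.1.1] `*` [set` I x0.1.2]) `*` [set` I x0.2]); split.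
- by apply: measurableX => //; exact: measurableX.
- rewrite /lebesgue3 product_measure1E//; last exact: measurableX.
  apply: mule_gt0; last exact: I0.
  exact: (lebesgue2_box_gt0 (I0 _) (I0 _)).
- move=> x [[/= h1 h2] h3]; apply: he.
  move: h1 h2 h3; rewrite /I !in_itv /= -!ltr_distlC => h1 h2 h3.
  by split; [split|].
Qed.

(** The top coefficient of (X^2 - 1)^m, in degree 2 m, survives m + k <= 2 m derivations, multiplied
    by a nonzero falling factorial. *)
Lemma legendre_derivn_neq0 (m k : nat) : (k <= m)%N ->
  (@legendre R m)^`(k) != 0.
Proof.
move=> km; set p := ('X^2 - 1 : {poly R}) ^+ m.
have pm : p \is monic by rewrite monic_exp// monicXnsubC.
have sp : size p = (2 * m).+1.
  have := size_exp ('X^2 - 1 : {poly R}) m; rewrite size_XnsubC//= => h.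
  by rewrite -h prednK// lt0n size_poly_eq0 monic_neq0.
apply/eqP => /(congr1 (fun r : {poly R} => r`_(m - k))).
rewrite /legendre derivnZ coefZ coef0 /derivn -iterD -/(derivn _ _) coef_derivn => /eqP.
have -> : (k + m + (m - k) = 2 * m)%N by lia.
have -> : p`_(2 * m) = 1.
  by have /monicP := pm; rewrite /lead_coef sp.
rewrite mulf_eq0 invr_eq0 !pnatr_eq0 muln_eq0 expn_eq0 /= !eqn0Ngt fact_gt0 /=.
by rewrite ffact_gt0; lia.
Qed.

Lemma assoc_legendre_neq0 (m k : nat) : (k <= m)%N ->
  exists2 t : R, 0 < t < 1 & assoc_legendre m k t != 0.
Proof.
move=> km; have p0 := legendre_derivn_neq0 km; set p := _^`(k) in p0.
(* These are as many distinct points of (0, 1) as the size of [p], one more than the number of roots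
   [p] can have. *)
pose rs := [seq (j.+2%:R)^-1 : R | j <- iota 0 (size p)].
have urs : uniq rs.
  rewrite map_inj_uniq ?iota_uniq// => i j /invr_inj/eqP.
  by rewrite eqr_nat => /eqP[].
have : ~~ all (root p) rs.
  apply/negP => h; have := max_poly_roots p0 h urs.
  by rewrite size_map size_iota ltnn.
move=> /allPn[_ /mapP[j _ ->] hj]; exists (j.+2%:R)^-1.
  by rewrite invr_gt0 ltr0n invf_lt1 ?ltr0n//= ltr1n.
rewrite /assoc_legendre mulf_neq0// expf_neq0// gt_eqF// sqrtr_gt0 subr_gt0.
by rewrite expr_lt1// ?invr_ge0// invf_lt1 ?ltr0n//= ltr1n.
Qed.

Lemma assoc_legendre_cts (m k : nat) : continuous (@assoc_legendre R m k).
Proof.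
move=> t; rewrite /assoc_legendre; apply: cvgM; last exact: continuous_horner.
apply: (@continuous_comp _ _ _ (fun t : R => Num.sqrt (1 - t ^+ 2)) (fun u => u ^+ k)).
  apply: (@continuous_comp _ _ _ (fun t : R => 1 - t ^+ 2) Num.sqrt).
    by apply: cvgB; [exact: cvg_cst|apply: cvgM; exact: cvg_id].
  exact: sqrt_continuous.
exact: exprn_continuous.
Qed.

End Dimension3Facts.

Section SphericalHarmonic.
Context {R : realType}.
Variables (m : nat) (l : int).

Lemma normc_sph_harmonic : exists2 K : R, 0 < K & forall x : R * R * R,
  Normc.normc (sph_harmonic m l x) ^+ 2 =
    K * assoc_legendre m `|l|%N (x.2 / enorm3 x) ^+ 2 * Normc.normc (expi_theta l x.1) ^+ 2.
Proof.
set q := `|l|%N.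
pose k : R := (2 * m + 1)%:R / (4 * pi) * ((m - q)`!)%:R / ((m + q)`!)%:R.
have k0 : 0 < k.
  have h1 : 0 < (2 * m + 1)%:R / (4 * pi) :> R.
    by apply: divr_gt0; [rewrite ltr0n addn1|exact: (mulr_gt0 _ (pi_gt0 R))].
  have h2 : 0 < ((m - q)`!)%:R :> R by rewrite ltr0n fact_gt0.
  have h3 : 0 < ((m + q)`!)%:R :> R by rewrite ltr0n fact_gt0.
  exact: (divr_gt0 (mulr_gt0 h1 h2) h3).
exists k => // x.
have -> : sph_harmonic m l x =
    (Num.sqrt k * assoc_legendre m q (x.2 / enorm3 x))%:C%C * expi_theta l x.1 by [].
rewrite Normc.normcM /= expr0n addr0 exprMn sqr_sqrtr ?sqr_ge0// exprMn sqr_sqrtr//.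
exact: (ltW k0).
Qed.

Lemma sph_harmonicZ (a : R) (x : R * R * R) : 0 < a ->
  sph_harmonic m l (a *: x) = sph_harmonic m l x.
Proof.
move=> a0.
have e1 : (a *: x).2 / enorm3 (a *: x) = x.2 / enorm3 x.
  by rewrite enorm3Z (gtr0_norm a0) /= invfM /GRing.scale /= mulrACA divff ?mul1r// gt_eqF.
have e2 : expi_theta l (a *: x).1 = expi_theta l x.1 by exact: expi_thetaZ.
by rewrite /sph_harmonic e1 e2.
Qed.

Lemma measurable_sph_harmonic :
  measurable_fun setT (fun x : R * R * R => Normc.normc (sph_harmonic m l x) ^+ 2).
Proof.
have [K _ E] := normc_sph_harmonic; under eq_fun do rewrite E.
apply: measurable_funM; last first.
  by apply: (measurableT_comp (measurable_expi_theta l)); exact: measurable_fst.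
apply: measurable_funM; first exact: measurable_cst.
apply: measurable_funX.
apply: (measurableT_comp (f := assoc_legendre m `|l|%N)).
  by apply: continuous_measurable_fun; exact: assoc_legendre_cts.
apply: measurable_funM; first exact: measurable_snd.
under eq_fun do rewrite -powR_inv1 ?enorm3_ge0//.
by apply: (measurableT_comp (f := fun t : R => t `^ (-1)));
  [exact: measurable_powR|exact: measurable_enorm3].
Qed.

(** The polar cosine stays in [-1, 1], also at the origin where the quotient is 0, so the continuous
    Legendre factor is bounded. *)
Lemma sph_harmonic_le : exists BY : R, forall x : R * R * R,
  Normc.normc (sph_harmonic m l x) ^+ 2 <= BY.
Proof.
have [K K0 E] := normc_sph_harmonic.
pose h (t : R) := assoc_legendre m `|l|%N t ^+ 2.
have hc : {within `[-1, 1], continuous h}.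
  apply: continuous_subspaceT => t.
  by apply: cvgM; exact: assoc_legendre_cts.
have [c _ hmax] : exists2 c, c \in `[-1, 1]%R & forall t, t \in `[-1, 1]%R -> h t <= h c.
  by apply: EVT_max => //; lra.
exists (K * h c) => x; rewrite E -[leRHS]mulr1.
have e1 : Normc.normc (expi_theta l x.1) ^+ 2 <= 1.
  by rewrite normc_expi_theta lern1; case: (_ || _).
have t1 : x.2 / enorm3 x \in `[-1, 1].
  rewrite in_itv /= -ler_norml normrM normfV (ger0_norm (enorm3_ge0 x)).
  have [->|n0] := eqVneq (enorm3 x) 0; first by rewrite invr0 mulr0.
  rewrite ler_pdivrMr ?lt_neqAle ?enorm3_ge0 ?andbT 1?eq_sym// mul1r.
  by rewrite enorm3E -sqrtr_sqr ler_wsqrtr// lerDr sqr_ge0.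
apply: ler_pM => //.
- by apply: mulr_ge0; [exact: (ltW K0)|exact: sqr_ge0].
- exact: sqr_ge0.
- by rewrite ler_pM2l//; exact: hmax.
Qed.

Lemma sph_harmonic_pos : (`|l| <= m)%N -> exists B (a b : R),
  [/\ measurable B, (0 < @lebesgue3 R B)%E, 0 < a, 0 < b &
    forall x, B x -> enorm3 x < 1 /\
      (a <= enorm3 x /\ b <= Normc.normc (sph_harmonic m l x) ^+ 2)].
Proof.
move=> lm; have [K K0 E] := normc_sph_harmonic.
have [t /andP[t0 t1] ht] := @assoc_legendre_neq0 R _ _ lm.
(* The point of radius 1 / 2 whose polar cosine is [t], where the Legendre factor does not
   vanish. *)
pose x0 : R * R * R := ((Num.sqrt (1 - t ^+ 2) / 2, 0), t / 2).
have t21 : 0 < 1 - t ^+ 2 by rewrite subr_gt0 expr_lt1// ltW.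
have s0 : 0 < Num.sqrt (1 - t ^+ 2) by rewrite sqrtr_gt0.
have ex0 : enorm3 x0 = 1 / 2.
  rewrite /enorm3 /x0 /= expr0n addr0 !exprMn sqr_sqrtr ?(ltW t21)//.
  rewrite -mulrDl subrK mul1r -[RHS]gtr0_norm; last by lra.
  by rewrite -sqrtr_sqr; congr Num.sqrt; field.
pose h (x : R * R * R) := K * assoc_legendre m `|l|%N (x.2 / enorm3 x) ^+ 2.
have hx0 : 0 < h x0.
  rewrite /h ex0 /x0 /= div1r invrK divfK//.
  by rewrite mulr_gt0// exprn_even_gt0.
have ec := @enorm3_cts R x0.
have hc : h x @[x --> x0] --> h x0.
  apply: cvgM; first exact: cvg_cst.
  have c1 : assoc_legendre m `|l|%N (x.2 / enorm3 x) @[x --> x0] -->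
      assoc_legendre m `|l|%N (x0.2 / enorm3 x0).
    apply: (@continuous_comp _ _ _ (fun x : R * R * R => x.2 / enorm3 x)
       (assoc_legendre m `|l|%N)); last exact: assoc_legendre_cts.
    by apply: cvgM; [exact: cvg_snd|apply: cvgV => //; rewrite ex0; lra].
  by apply: cvgM; exact: c1.
have x1c : (x : R * R * R).1.1 @[x --> x0] --> x0.1.1.
  by apply: (@continuous_comp _ _ _ fst fst); exact: cvg_fst.
(* A positive first coordinate keeps away from the polar axis, where the azimuthal factor may
   vanish. *)
pose P := [set x : R * R * R | [/\ h x0 / 2 < h x, 1 / 4 < enorm3 x, enorm3 x < 1 & 0 < x.1.1]].
have : nbhs x0 P.
  have n1 : \forall x \near x0, h x0 / 2 < h x.
    by apply: (cvgr_gt _ hc); rewrite ltr_pdivrMr// ltr_pMr// ltr1n.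
  have n2 : \forall x \near x0, 1 / 4 < enorm3 x.
    by apply: (cvgr_gt _ ec); rewrite ex0; lra.
  have n3 : \forall x \near x0, enorm3 x < 1.
    by apply: (cvgr_lt _ ec); rewrite ex0; lra.
  have n4 : \forall x \near x0, 0 < (x : R * R * R).1.1.
    by apply: (cvgr_gt _ x1c); rewrite /x0 /= divr_gt0.
  by near=> x; split; near: x.
move=> /lebesgue3_nbhs[B [mB B0 BP]].
exists B, (1 / 4), (h x0 / 2); split => //; first by apply: divr_gt0.
move=> x /BP[h1 h2 h3 h4]; split=> //; split; first exact: ltW.
rewrite E normc_expi_theta -/(h x).
have -> : x.1 != 0 by apply: contraTneq h4 => ->; rewrite ltxx.
by rewrite orbT mulr1 ltW.
Unshelve. all: by end_near.
Qed.

End SphericalHarmonic.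

Section Density3.
Context {R : realType}.
Variables (eps delta n : R).
Hypotheses (heps : 0 < eps < 1 / 2) (hdelta : 0 < delta < 1) (hn : 0 < n < 1).

Lemma localized3_large_order : exists2 M0, (0 < M0)%N & forall p : R * nat * int,
  modes3 n p -> (M0 <= p.1.2)%N -> n * p.1.1 <= order_nu 1 p.1.2 ->
  localized_modes3 eps delta n p.
Proof.
have /andP[d0 d1] := hdelta; have /andP[n0 n1] := hn.
have eps01 : 0 < eps < 1 by case/andP: heps => -> h /=; lra.
pose tau := 1 - delta / 2.
have tau01 : 0 < tau < 1 by apply/andP; rewrite /tau; split; lra.
have [M0 M00 hM0] := exists_order tau01 eps01.
exists M0 => // -[[k m] l] [/= k0 lm hF] hm hk; split => //=.
have m0 : (0 < m)%N by exact: leq_trans hm.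
have hf := @sphBesselJ_multiple R m.
have nuE : (2 * m + 1)%:R / 2 = order_nu 1 m :> R.
  by rewrite /order_nu natrD natrM; field.
have fk : sphBesselJ m k != 0.
  by apply: (bessel_multiple_charF_deriv hf n0 k0 _ hF); rewrite nuE.
have knu : 0 < k * n <= (2 * m + 1)%:R / 2 by rewrite nuE mulr_gt0//= mulrC.
have e10 : exists x : R * R * R, enorm3 x = 1.
  by exists ((1, 0), 0); rewrite /enorm3 /= expr1n expr0n !addr0 sqrtr1.
exists (separated_wave enorm3 (sphBesselJ m) (sph_harmonic m l) (k * n) (sphBesselJ m k)%:C%C),
  (separated_wave enorm3 (sphBesselJ m) (sph_harmonic m l) k (sphBesselJ m (k * n))%:C%C).
have u_en_cts := @enorm3_cts R.
have df := bessel_multiple_derivable hf.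
split.
  exact: (eigenpair_exists u_en_cts (@enorm3Z R) df
    (fun a x => @sph_harmonicZ R m l a x) hF fk).
left; rewrite /localization3.
rewrite (boundary_layerE u_en_cts (@enorm3_ge0 R) (@enorm3Z R) (@enorm3_triangle R) e10 hdelta).
have tau0 : 0 < tau by case/andP: tau01.
have tauV : 1 <= tau^-1 by rewrite invf_ge1//; case/andP: tau01 => _ /ltW.
have en_tau x : enorm3 (tau *: x) = tau * enorm3 x by rewrite enorm3Z gtr0_norm.
have taud : 1 - delta < tau by rewrite /tau; lra.
have [BY gY_le] := @sph_harmonic_le R m l.
have c1 : 1 <= tau^-1 * tau^-1 * tau^-1 by apply: mulr_ege1 => //; exact: mulr_ege1.
have gY_pos := @sph_harmonic_pos R m l lm.
have hM : (tau * (1 + (2 * m + 1)%:R / 2 * decay_rate tau))^-1 < 1 - (1 - eps) ^+ 2.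
  apply: hM0; rewrite nuE /order_nu.
  apply: (@le_trans _ _ m%:R); first by rewrite ler_nat.
  by rewrite lerDl divr_ge0.
have C0 : (sphBesselJ m k)%:C%C != 0 by rewrite eq_complex /= negb_and fk.
exact: (@wave_localization R _ _ (@lebesgue3 R) enorm3 _ _ _ _ _ _ _ _ _ _
  (@measurable_enorm3 R) (@measurable_sph_harmonic R m l)
  (@enorm3_ge0 R) (scales_lebesgue3 tau0) c1 en_tau (fun x => sph_harmonicZ m l x tau0)
  tau01 taud (@lebesgue3_ball_fin R) gY_le gY_pos hf isT m0 eps01 hM _ _ C0 knu).
Qed.

Lemma P3_gt0 : 0 < P3 n.
Proof.
by have /andP[n0 n1] := hn; rewrite /P3 powR_gt0// subr_gt0 expr_lt1// ltW.
Qed.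

(** In space l does not determine the degree, so the angular index is the pair (m, l). *)
Let idx (m : nat) : seq (nat * int) := [seq (m, j%:Z - m%:Z) | j <- iota 0 (2 * m + 1)].

Let idxP m i : (i \in idx m) = (i.1 == m) && (`|i.2| <= m)%N.
Proof.
apply/mapP/andP => [[j]|]; first by rewrite mem_iota => hj -> /=; split=> //; lia.
case: i => a l /= [/eqP -> hl]; exists (absz (l + m%:Z)%R); last by congr (_, _); lia.
by rewrite mem_iota; lia.
Qed.

(** Here the two integrals are [P3 n / 9] and 1 / 9 times 1 - n^3; the acos terms cancel altogether,
    leaving a power of sqrt (1 - n^2). *)
Lemma density3_ge : ((P3 n / (1 - n ^+ 3))%:E <= density3 eps delta n)%E.
Proof.
have [M0 M00 hM0] := localized3_large_order.
have /andP[n0 n1] := hn.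
have n21 : 0 < 1 - n ^+ 2 by rewrite subr_gt0 expr_lt1// ltW.
have JE : wkb_profile n * n ^+ 2 / 3%:R + (wkb_prim 1 1 - wkb_prim 1 n) = P3 n / 9.
  set w := Num.sqrt (1 - n ^+ 2).
  have w2 : w ^+ 2 = 1 - n ^+ 2 by rewrite sqr_sqrtr// ltW.
  have -> : P3 n = w ^+ 3.
    have -> : P3 n = (1 - n ^+ 2) `^ (2^-1 * 3%:R) by congr (_ `^ _); lra.
    by rewrite powRrM powR12_sqrt ?(ltW n21)// powR_mulrn ?sqrtr_ge0.
  have nN : -1 <= n <= 1 by rewrite (ltW n1) andbT (le_trans _ (ltW n0)).
  rewrite /wkb_profile /wkb_prim /= acos1 cos0 sin0 acosK ?in_itv//= sin_acos// -/w.
  have -> : w ^+ 3 = w * (1 - n ^+ 2) by rewrite exprS w2.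
  by field.
have IE := @wkb_prim11 R.
have := @liminf_ratio_ge R (R * nat * int)%type (nat * int)%type n 1 (@sphBesselJ R)
  (fun k i => (k, i.1, i.2)) (fun p => p.1.1) (fun p => (p.1.2, p.2))
  fst idx (modes3 n) (localized_modes3 eps delta n) M0 hn isT (@sphBesselJ_multiple R).
rewrite JE IE.
have -> : P3 n / 9 / (1 / 9 * (1 - n ^+ 3)) = P3 n / (1 - n ^+ 3).
  have N0 : 1 - n ^+ 3 != 0 by rewrite gt_eqF// subr_gt0 expr_lt1// ltW.
  by field.
apply.
- by case=> -[].
- by [].
- by move=> k [].
- by move=> m; rewrite map_inj_uniq ?iota_uniq// => i j []; lia.
- by move=> m i; rewrite idxP => /andP[/eqP].
- move=> m; rewrite size_map size_iota /order_nu expr1 natrD natrM; lra.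
- move=> m _; rewrite size_map size_iota /order_nu expr1 natrD natrM; lra.
- move=> [[k m] l]; rewrite /modes3 idxP /= eqxx /=; split=> [[k0 lm hF]|[k0 lm hF]]; by split.
- exact: M00.
- exact: hM0.
- by apply: divr_gt0; [exact: P3_gt0|].
- by apply: divr_gt0.
Qed.

End Density3.

Theorem theorem2p3 (R : realType) (eps delta n : R)
    (heps : 0 < eps < 1 / 2) (hdelta : 0 < delta < 1) (hn : 0 < n < 1) :
  ((0%:E < density2 eps delta n)%E /\
   ((2 * P2 n / (pi * (1 - n ^+ 2)))%:E <= density2 eps delta n)%E) /\
  ((0%:E < density3 eps delta n)%E /\
   ((P3 n / (1 - n ^+ 3))%:E <= density3 eps delta n)%E).
Proof.
have /andP[n0 n1] := hn.
have n21 : 0 < 1 - n ^+ 2 by rewrite subr_gt0 expr_lt1// ltW.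
have n31 : 0 < 1 - n ^+ 3 by rewrite subr_gt0 expr_lt1// ltW.
have h2 := density2_ge heps hdelta hn; have h3 := density3_ge heps hdelta hn.
have p2 : 0 < 2 * P2 n / (pi * (1 - n ^+ 2)).
  apply: divr_gt0; first by rewrite mulr_gt0// P2_gt0.
  exact: (mulr_gt0 (pi_gt0 R) n21).
have p3 : 0 < P3 n / (1 - n ^+ 3) by apply: divr_gt0 => //; exact: P3_gt0.
by do 2!split=> //; [apply: lt_le_trans h2|apply: lt_le_trans h3]; rewrite lte_fin.
Qed.
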